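(* Let $n\ge3$ and let $\mu=(\mu_{\overline n},\dots,\mu_{\overline 1})\in P^+_{D_n}$, and put $\mu'=(\mu_{\overline{n-1}},\dots,\mu_{\overline 1})\in P^+_{D_{n-1}}$. Then $$Q^{D_n}_{\mu}=\sum_{\gamma\in P^+_{D_{n-1}}}\ \sum_{R=0}^{+\infty}\ \sum_{\substack{r,m\ge 0\\ r+2m=R}} q^{R}\sum_{\lambda\in(\gamma\otimes r)_{D_{n-1}}} d^{\lambda}_{\gamma,r}\,K^{D_{n-1}}_{\lambda,\mu'}(q)\,s_{(\mu_{\overline n}+R,\gamma)} .$$
   Context: Notation for type $D_k$ ($k\ge2$). Let $\varepsilon_{\overline 1},\dots,\varepsilon_{\overline k}$ be an orthonormal basis of $\mathbb R^k$ and write $\beta=(\beta_{\overline k},\dots,\beta_{\overline 1})$ for $\sum_i\beta_{\overline i}\varepsilon_{\overline i}$. The weight lattice of $so_{2k}$ is $P_{D_k}=\mathbb Z^k\cup(\tfrac12+\mathbb Z)^k$; the positive roots are $R^+_{D_k}=\{\varepsilon_{\overline i}\pm\varepsilon_{\overline j}:1\le j<i\le k\}$; $\rho=(k-1,k-2,\dots,0)$; the dominant weights are $P^+_{D_k}=\{\beta\in P_{D_k}:\beta_{\overline k}\ge\cdots\ge\beta_{\overline 2}\ge|\beta_{\overline 1}|\}$ (so $\beta_{\overline1}$ may be negative). The Weyl group $W$ is the group of signed permutations of the coordinates with an even number of sign changes, with length function $l$. The $q$-partition function $\mathcal P_q$ is defined by $\prod_{\alpha\in R^+}\frac1{1-qx^\alpha}=\sum_\beta\mathcal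 P_q(\beta)x^\beta$, with $\mathcal P_q(\beta)=0$ if $\beta$ is not a nonnegative integral combination of positive roots. For $\lambda,\mu\in P^+_{D_k}$ the Kostka-Foulkes polynomial is $K^{D_k}_{\lambda,\mu}(q)=\sum_{\sigma\in W}(-1)^{l(\sigma)}\mathcal P_q(\sigma(\lambda+\rho)-(\mu+\rho))$. For any $\beta\in P_{D_k}$ let $a_\beta=\sum_{\sigma\in W}(-1)^{l(\sigma)}x^{\sigma(\beta)}$ and $s_\beta=a_{\beta+\rho}/a_\rho$ (so $s_\beta$ is either $0$ or $\pm$ an irreducible character). The Hall-Littlewood element is $$Q^{D_k}_\beta=\Big(\prod_{\alpha\in R^+_{D_k}}\frac1{1-qR_\alpha}\Big)s_\beta ,$$ where the raising operators $R_\alpha$ act on indices, i.e. $Q_\beta=\sum_{(m_\alpha)\in\mathbb N^{R^+}}q^{\sum m_\alpha}s_{\beta+\sum m_\alpha\alpha}$; identities between such elements are identities of formal power series in $q$. For $\gamma\in P^+_{D_{n-1}}$ and an integer $r\ge0$, $d^\lambda_{\gamma,r}$ denotes the multiplicity of the irreducible $so_{2n-2}$-module $V(\lambda)$ in $V(\gamma)\otimes V(r\varepsilon_{\overline{n-1}})$ (tensor product with the module of highest weight $r$ times the highest weight of the vector representation), and $(\gamma\otimes r)_{D_{n-1}}=\{\lambda\in P^+_{D_{n-1}}:d^\lambda_{\gamma,r}\ne0\}$. For a number $a$, $(a,\gamma)=(a,\gamma_{\overline{n-1}},\dots,\gamma_{\overline 1})$; $s_{(a,\gamma)}$ is the Schur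 function of type $D_n$ (for nonzero terms one automatically has $(a,\gamma)\in P_{D_n}$). *)

(* Defs.v *)
From HB Require Import structures.
From mathcomp Require Import all_boot all_order all_fingroup all_algebra.
From mathcomp Require Import mxtens ring.
From mathcomp Require Import mpoly.

Set Implicit Arguments.
Unset Strict Implicit.
Unset Printing Implicit Defensive.

Import GRing.Theory Num.Theory.
Local Open Scope ring_scope.

(* Coordinates are 0-based: the coordinate of index [i : 'I_k] of a weight is
   the coefficient of eps_{i+1} (with a bar), so [ord0] carries the coordinate
   that may be negative and the last index carries the leading coordinate. *)
Section Weights.
Variable k : nat.
Implicit Types (be la mu : 'rV[rat]_k) (N : nat).

(* [eps j] is 0 when [k <= j]. *)
Definition eps (j : nat) : 'rV[rat]_k := \row_i (i == j :> nat)%:R.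

Definition weight_lattice : pred 'rV[rat]_k := fun be =>
  [forall i, be 0 i \is a Num.int] || [forall i, be 0 i - 2^-1 \is a Num.int].

Definition dominant : pred 'rV[rat]_k := fun be =>
  weight_lattice be &&
  [forall i : 'I_k, forall j : 'I_k, (i.+1 == j :> nat) ==>
     ((if i == 0%N :> nat then `|be 0 i| else be 0 i) <= be 0 j)].

Definition rho : 'rV[rat]_k := \row_i i%:R.

(* [(i, j, false)] stands for eps_i + eps_j and [(i, j, true)] for
   eps_i - eps_j. *)
Definition posroot : Type := {p : 'I_k * 'I_k * bool | (p.1.2 < p.1.1)%N}.
HB.instance Definition _ := Finite.on posroot.

Definition root_of (a : posroot) : 'rV[rat]_k :=
  let: (i, j, b) := val a in eps i + (-1) ^+ b *: eps j.

(* A permutation and the set of the coordinates whose sign is changed. *)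
Definition weyl : Type := {w : {perm 'I_k} * {set 'I_k} | ~~ odd #|w.2|}.
HB.instance Definition _ := Finite.on weyl.

Definition wact (w : weyl) be : 'rV[rat]_k :=
  \row_i ((-1) ^+ (i \in (val w).2) * be 0 ((val w).1 i)).

(* The simple roots eps_1 + eps_2 and eps_{i+1} - eps_i; all have norm 2. *)
Definition simple_root (i : 'I_k) : 'rV[rat]_k :=
  if i == 0%N :> nat then eps 0 + eps 1 else eps i - eps i.-1.

Definition sreflection (i : 'I_k) be : 'rV[rat]_k :=
  be - (be *m (simple_root i)^T) 0 0 *: simple_root i.

Definition word_act (t : seq 'I_k) be : 'rV[rat]_k := foldr sreflection be t.

Definition has_word_of_size (w : weyl) (m : nat) : bool :=
  [exists t : m.-tuple 'I_k, [forall j : 'I_k, wact w (eps j) == word_act t (eps j)]].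

Let lf (f : 'rV[rat]_k -> 'rV[rat]_k) := exists t, f =1 word_act t.

Lemma word_act_comp f g : lf f -> lf g -> lf (f \o g).
Proof.
by move=> [s fs] [t gt]; exists (s ++ t) => be; rewrite /= gt fs /word_act foldr_cat.
Qed.

Lemma word_act_ext f g : lf f -> f =1 g -> lf g.
Proof. by move=> [s fs] fg; exists s => be; rewrite -fg fs. Qed.

Lemma word_act_id : lf id. Proof. by exists [::]. Qed.

Let pact (s : {perm 'I_k}) be : 'rV[rat]_k := \row_i be 0 (s i).
Let sact (E : {set 'I_k}) be : 'rV[rat]_k := \row_i ((-1) ^+ (i \in E) * be 0 i).

Lemma dot_eps be (i : 'I_k) : \sum_j be 0 j * eps i 0 j = be 0 i.
Proof.
rewrite (bigD1 i) //= mxE eqxx mulr1 big1 ?addr0 // => j ji.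
by rewrite mxE -val_eqE in ji *; rewrite (negPf ji) mulr0.
Qed.

Let add_entry (u v : 'rV[rat]_k) l : (u + v) 0 l = u 0 l + v 0 l.
Proof. by rewrite mxE. Qed.

Let sub_entry (u v : 'rV[rat]_k) l : (u - v) 0 l = u 0 l - v 0 l.
Proof. by rewrite !mxE. Qed.

Lemma sreflectionE be i : sreflection i be =
  be - (\sum_j be 0 j * simple_root i 0 j) *: simple_root i.
Proof. by rewrite /sreflection mxE; under eq_bigr do rewrite mxE. Qed.

Lemma word_act_adj (i j : 'I_k) : i.+1 = j -> lf (pact (tperm i j)).
Proof.
move=> ij; exists [:: j] => be; rewrite /= sreflectionE /simple_root -ij /= .
under eq_bigr do rewrite sub_entry mulrBr.
rewrite sumrB ij !dot_eps; apply/rowP => l; rewrite !mxE.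
case: tpermP => [->|->|/eqP li /eqP lj].
- have -> : (i == j :> nat) = false by rewrite -ij ltn_eqF.
  by rewrite eqxx sub0r mulrN1 opprK addrCA subrr addr0.
- have -> : (j == i :> nat) = false by rewrite -ij gtn_eqF.
  by rewrite eqxx subr0 mulr1 opprB addrCA subrr addr0.
- by rewrite !val_eqE (negPf li) (negPf lj) subrr mulr0 subr0.
Qed.

Lemma pactM s t : pact (s * t)%g =1 pact s \o pact t.
Proof. by move=> be; apply/rowP => i; rewrite !mxE permM. Qed.

Lemma word_act_tperm_lt n : forall i j : 'I_k, (j = i + n :> nat)%N ->
  lf (pact (tperm i j)).
Proof.
elim: n => [|n IHn] i j ij.
  have -> : j = i by apply: val_inj; rewrite /= ij addn0.
  apply: word_act_ext word_act_id _ => be.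
  by apply/rowP => l; rewrite tperm1 !mxE perm1.
have lt_k : (i + n < k)%N by apply: leq_trans (ltn_ord j); rewrite ij addnS.
pose l := Ordinal lt_k.
have lj : l.+1 = j by rewrite ij addnS.
have Hl := word_act_adj lj; have Hi := IHn i l erefl.
case: (posnP n) => [n0|n_gt0].
  by have -> : i = l by apply: val_inj; rewrite /= n0 addn0.
have il : i != l.
  by apply/eqP => /(congr1 val)/= /eqP; rewrite -[X in X == _]addn0 eqn_add2l eq_sym gtn_eqF.
have ji : j != i.
  apply/eqP => /(congr1 val)/= /eqP.
  by rewrite ij -[X in _ == X]addn0 eqn_add2l.
have -> : tperm i j = (tperm l j * (tperm i l * tperm l j))%g.
  rewrite -[X in (X * _)%g]tpermV -[RHS]/(tperm i l ^ tperm l j)%g.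
  by rewrite tpermJ tpermL tpermD // eq_sym.
apply: word_act_ext (word_act_comp Hl (word_act_comp Hi Hl)) _ => be.
by rewrite pactM /= pactM.
Qed.

Lemma word_act_perm s : lf (pact s).
Proof.
have Ht (i j : 'I_k) : lf (pact (tperm i j)).
  case: (leqP i j) => [ij|/ltnW ji].
    by apply: (@word_act_tperm_lt (j - i)); rewrite subnKC.
  by rewrite tpermC; apply: (@word_act_tperm_lt (i - j)); rewrite subnKC.
have [ts -> _] := prod_tpermP s.
elim: ts => [|t ts IHts].
  rewrite big_nil; apply: word_act_ext word_act_id _ => be.
  by apply/rowP => l; rewrite !mxE perm1.
rewrite big_cons; apply: word_act_ext (word_act_comp (Ht t.1 t.2) IHts) _ => be.
by rewrite pactM.
Qed.

Lemma word_act_sign2 (a b : 'I_k) : a != b -> lf (sact [set a; b]).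
Proof.
move=> ab.
have k_gt1 : (1 < k)%N.
  case: (k) a b ab => [|[|//]] a b; first by case: a.
  by rewrite !ord1.
pose o0 : 'I_k := Ordinal (ltnW k_gt1); pose o1 : 'I_k := Ordinal k_gt1.
have o01 : o0 != o1 by [].
have H0 : lf (sact [set o0; o1] \o pact (tperm o0 o1)).
  exists [:: o0] => be; rewrite /= sreflectionE /simple_root /= .
  under eq_bigr do rewrite add_entry mulrDr.
  rewrite big_split /= (dot_eps be o0) (dot_eps be o1).
  apply/rowP => l; rewrite !mxE !inE.
  case: tpermP => [->|->|/eqP l0 /eqP l1].
  - by rewrite eqxx /= addr0 mulr1 expr1 mulN1r opprD addrA subrr add0r.
  - by rewrite eqxx orbT /= add0r mulr1 expr1 mulN1r opprD addrCA subrr addr0.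
  - rewrite (negPf l0) (negPf l1) /= expr0 mul1r.
    move: l0 l1; rewrite -!val_eqE /= => /negPf -> /negPf ->.
    by rewrite addr0 mulr0 subr0.
have H1 : lf (sact [set o0; o1]).
  apply: word_act_ext (word_act_comp H0 (word_act_perm (tperm o0 o1))) _ => be.
  by apply/rowP => l; rewrite !mxE tpermK.
have [s [sa sb]] : exists s : {perm 'I_k}, s a = o0 /\ s b = o1.
  exists (tperm a o0 * tperm (tperm a o0 b) o1)%g.
  rewrite !permM tpermL tpermL; split=> //.
  rewrite (@tpermD _ _ _ o0) //; apply/eqP => e; case/eqP: ab.
  by apply/(@perm_inj _ (tperm a o0)); rewrite tpermL e.
apply: word_act_ext (word_act_comp (word_act_perm s)
  (word_act_comp H1 (word_act_perm s^-1))) _ => be.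
apply/rowP => l; rewrite !mxE permK; congr (_ ^+ _ * _).
by rewrite !inE -sa -sb !(inj_eq perm_inj).
Qed.

Lemma word_act_sign n (E : {set 'I_k}) : #|E| = n.*2 -> lf (sact E).
Proof.
elim: n E => [|n IHn] E cE.
  have -> : E = set0 by apply/eqP; rewrite -cards_eq0 cE.
  apply: word_act_ext word_act_id _ => be.
  by apply/rowP => l; rewrite !mxE inE expr0 mul1r.
have /card_gt0P[a aE] : (0 < #|E|)%N by rewrite cE.
have cE1 : #|E :\ a| = n.*2.+1 by have := cardsD1 a E; rewrite aE cE => -[].
have /card_gt0P[b bE] : (0 < #|E :\ a|)%N by rewrite cE1.
have cE2 : #|E :\ a :\ b| = n.*2 by have := cardsD1 b (E :\ a); rewrite bE cE1 => -[].
have ab : a != b by move: bE; rewrite !inE eq_sym => /andP[].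
have bE' : b \in E by move: bE; rewrite !inE => /andP[].
apply: word_act_ext (word_act_comp (word_act_sign2 ab) (IHn _ cE2)) _ => be.
apply/rowP => l; rewrite !mxE mulrA !inE.
case: (eqVneq l a) => [->|la]; first by rewrite aE /= andbF expr0 mulr1.
case: (eqVneq l b) => [->|lb]; first by rewrite bE' /= expr0 mulr1.
by rewrite /= expr0 mul1r.
Qed.

Lemma exists_word w : exists m, has_word_of_size w m.
Proof.
have [t tE] : lf (wact w).
  have cE : #|(val w).2| = #|(val w).2|./2.*2.
    by rewrite -[LHS]odd_double_half (negPf (valP w)).
  apply: word_act_ext (word_act_comp (word_act_sign cE) (word_act_perm (val w).1)) _.
  by move=> be; apply/rowP => i; rewrite !mxE.
exists (size t); apply/existsP; exists (in_tuple t).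
by apply/forallP => j; rewrite tE.
Qed.

Definition wlength (w : weyl) : nat := ex_minn (exists_word w).

(* Power series in q are represented by their coefficients: the argument [N]
   is the exponent of q. *)

(* The families of multiplicities (m_alpha) of sum [N]. *)
Definition multiplicities N : {set {ffun posroot -> 'I_N.+1}} :=
  [set m : {ffun posroot -> 'I_N.+1} | (\sum_a m a)%N == N :> nat].

Definition root_sum N (m : {ffun posroot -> 'I_N.+1}) : 'rV[rat]_k :=
  \sum_a root_of a *+ m a.

Definition qpartition be N : nat :=
  #|[set m in multiplicities N | root_sum m == be]|.

Definition kostka la mu N : int :=
  \sum_(w : weyl) (-1) ^+ wlength w *
    (qpartition (wact w (la + rho) - (mu + rho)) N)%:Z.

(* The field of fractions of Z[y_1, .., y_k], where y_i is the exponential of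
   eps_i / 2; it contains the group algebra of the weight lattice. *)
Definition char_field : fieldType := {fraction {mpoly int[k]}}.

Definition wexp be : char_field :=
  \prod_(i < k)
    (FracField.tofrac ('X_i : {mpoly int[k]}) : char_field) ^ numq (2 * be 0 i).

Definition alternant be : char_field :=
  \sum_(w : weyl) (-1) ^+ wlength w * wexp (wact w be).

Definition schur be : char_field := alternant (be + rho) / alternant rho.

Definition hall_littlewood be N : char_field :=
  \sum_(m in multiplicities N) schur (be + root_sum m).

End Weights.


(* The weight (a, ga). *)
Definition wcons k (a : rat) (ga : 'rV[rat]_k) : 'rV[rat]_k.+1 :=
  \row_i (if unlift ord_max i is Some j then ga 0 j else a).

(* The weight [mu] without its leading coordinate. *)
Definition wtail k (mu : 'rV[rat]_k.+1) : 'rV[rat]_k :=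
  \row_j mu 0 (lift ord_max j).

Section Modules.
Variables (C : numClosedFieldType) (k : nat).

(* so_{2k} is taken with respect to the symmetric form pairing the i-th and the
   (k+i)-th vectors of the canonical basis, so that its diagonal matrices form
   a Cartan subalgebra. *)
Definition so_form : 'M[C]_(k + k) := block_mx 0 1%:M 1%:M 0.

Definition so : pred 'M[C]_(k + k) := fun X => X^T *m so_form + so_form *m X == 0.

Definition bracket d (X Y : 'M[C]_d) : 'M[C]_d := X *m Y - Y *m X.

(* The action on column vectors of dimension [mdim]; the values of [mact]
   outside so_{2k} are irrelevant. *)
Record so_module : Type := SoModule {
  mdim : nat;
  mact : 'M[C]_(k + k) -> 'M[C]_mdim;
  mact_linear : forall (a : C) X Y, so X -> so Y ->
    mact (a *: X + Y) = a *: mact X + mact Y;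
  mact_bracket : forall X Y, so X -> so Y ->
    mact (bracket X Y) = bracket (mact X) (mact Y)
}.

Definition so_iso (M N : so_module) : Prop :=
  exists T : 'M[C]_(mdim N, mdim M),
    [/\ row_free T, row_full T & forall X, so X -> T *m mact M X = mact N X *m T].

Definition so_irreducible (M : so_module) : Prop :=
  mdim M != 0%N /\
  forall U : {vspace 'cV[C]_(mdim M)},
    (forall X u, so X -> u \in U -> mact M X *m u \in U) -> U = 0%VS \/ U = fullv.

(* The basis of the diagonal matrices of so_{2k} dual to (eps_i). *)
Definition cartan (i : 'I_k) : 'M[C]_(k + k) :=
  block_mx (delta_mx i i) 0 0 (- delta_mx i i).

Definition in_root_space (al : 'rV[rat]_k) (X : 'M[C]_(k + k)) : Prop :=
  so X /\ forall i, bracket (cartan i) X = ratr (al 0 i) *: X.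

Definition highest_weight_vector (M : so_module) (la : 'rV[rat]_k)
    (v : 'cV[C]_(mdim M)) : Prop :=
  [/\ v != 0,
      forall i, mact M (cartan i) *m v = ratr (la 0 i) *: v &
      forall (a : posroot k) X, in_root_space (root_of a) X -> mact M X *m v = 0].

Definition irreducible_of_highest_weight (la : 'rV[rat]_k) (M : so_module) : Prop :=
  so_irreducible M /\ exists v, highest_weight_vector (M := M) la v.

Lemma tensmx_linear m n (c : C) (A B : 'M[C]_m) (D E : 'M[C]_n) :
  (c *: A + B) *t 1%:M + 1%:M *t (c *: D + E) =
  c *: (A *t 1%:M + 1%:M *t D) + (B *t 1%:M + 1%:M *t E) :> 'M[C]_(m * n)%N.
Proof. by apply/matrixP => i j; rewrite !mxE; ring. Qed.

Lemma tensmx_bracket m n (A B : 'M[C]_m) (D E : 'M[C]_n) :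
  bracket A B *t 1%:M + 1%:M *t bracket D E =
  bracket (A *t 1%:M + 1%:M *t D) (B *t 1%:M + 1%:M *t E) :> 'M[C]_(m * n)%N.
Proof.
rewrite /bracket !(mulmxDl, mulmxDr) !tensmx_mul !mul1mx !mulmx1.
by apply/matrixP => i j; rewrite !mxE; ring.
Qed.

Program Definition so_tensor (M N : so_module) : so_module :=
  @SoModule (mdim M * mdim N)%N
    (fun X => mact M X *t 1%:M + 1%:M *t mact N X) _ _.
Next Obligation. by rewrite !mact_linear // tensmx_linear. Qed.
Next Obligation. by rewrite !mact_bracket // tensmx_bracket. Qed.

Program Definition so_zero : so_module := @SoModule 0%N (fun _ => 0) _ _.
Next Obligation. by rewrite scaler0 addr0. Qed.
Next Obligation. by rewrite /bracket !mulmx0 subr0. Qed.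

Program Definition so_sum2 (M N : so_module) : so_module :=
  @SoModule (mdim M + mdim N)%N (fun X => block_mx (mact M X) 0 0 (mact N X)) _ _.
Next Obligation.
by rewrite !mact_linear // scale_block_mx add_block_mx !scaler0 !addr0.
Qed.
Next Obligation.
rewrite !mact_bracket // /bracket !mulmx_block opp_block_mx add_block_mx.
by rewrite !(mulmx0, mul0mx, addr0, add0r, oppr0).
Qed.

Definition so_sum (Ms : seq so_module) : so_module := foldr so_sum2 so_zero Ms.

(* [V la] is meant to be the irreducible module of highest weight [la]: the
   multiplicity of [V la] in [M] is its number of occurrences in a decomposition
   of [M] into irreducible modules. *)
Definition multiplicity (V : 'rV[rat]_k -> so_module) (la : 'rV[rat]_k)
    (M : so_module) (m : nat) : Prop :=
  exists s : seq 'rV[rat]_k,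
    [/\ all (@dominant k) s, so_iso M (so_sum (map V s)) & m = count_mem la s].

(* [r] times the highest weight of the vector representation. *)
Definition vector_weight (r : nat) : 'rV[rat]_k := r%:R *: eps k k.-1.

End Modules.

(* Main.v *)
From HB Require Import structures.
From mathcomp Require Import all_boot all_order all_fingroup all_algebra.
From mathcomp Require Import mxtens mpoly ring lra zify.
From Stdlib Require Import Classical.
Require Import Defs.

Set Implicit Arguments.
Unset Strict Implicit.
Unset Printing Implicit Defensive.

Import Order.TTheory GRing.Theory Num.Theory.
Local Open Scope ring_scope.

(** Proof idea. Splitting the positive roots of D_n into those of D_{n-1} and the
    eps_n +- eps_j, the latter contribute, in degree R, a factor q^R, a shift of the
    leading coordinate by R and the complete homogeneous function h_R of the
    x_j, 1/x_j (j < n), acting on the other coordinates. Since beta |-> s_(a, beta) is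
    antisymmetric under the dot action of the Weyl group W of D_{n-1}, the q-partition
    function sums up to the Kostka-Foulkes polynomials, and the product of h_R with the
    weight lambda straightens to
      sum_gamma (sum_w (-1)^l(w) [x^(w(gamma+rho)-(lambda+rho))] h_R) s_(a, gamma).
    It remains to see that the inner sum is that of the tensor multiplicities
    d^lambda_(gamma, r) over r + 2m = R. This is Brauer's formula together with the
    fact that the character of V(r) is h_r - h_(r-2); both follow from the Weyl
    character formula for the irreducible modules of so_2k.

    The Weyl character formula is proved inside the module: evaluating the trace of the
    Casimir element on the weight spaces gives Freudenthal's identity, by which the
    product of the Weyl denominator and of the character is an eigenvector of the
    Laplacian; being antisymmetric with exponents below lambda + rho, it is the
    alternant of lambda + rho. The Weyl denominator and the character of V(r) are
    computed from a Vandermonde determinant in the x_i + 1/x_i. *)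

(** * The Weyl group *)

(** Characters are not formed as elements of a group ring. An identity between them is the equality
    of two sums of [phi (weight)] for an arbitrary function [phi] into an abelian group: it can be
    read over the integers (counting weights), over [C] (traces) or in the field of fractions, and
    multiplying by a further character is a change of [phi]. What is proved in the field, where
    determinants and division are available, is brought into this form by the independence of
    Laurent monomials.

    Finiteness shapes the end: la and gamma range over infinite sets, but in a fixed degree N only
    finitely many weights occur, so lists of dominant weights are built that serve all R <= N at
    once and contain every nonzero term.

    The condition r + 2m = R comes from h_R = sum_m (h_(R-2m) - h_(R-2m-2)), whose terms are the
    characters of the V(R-2m). A multiplicity is given by a decomposition of the tensor product, so
    it is read off the alternants of the summands, each having exactly one strictly dominant
    exponent. *)

Section Dot.
Variable k : nat.
Implicit Types u v w : 'rV[rat]_k.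

Definition dot u v : rat := \sum_i u 0 i * v 0 i.

Lemma dotC u v : dot u v = dot v u.
Proof. by apply: eq_bigr => i _; rewrite mulrC. Qed.

Lemma dotDl u v w : dot (u + v) w = dot u w + dot v w.
Proof. by rewrite -big_split; apply: eq_bigr => i _; rewrite mxE mulrDl. Qed.

Lemma dotDr u v w : dot u (v + w) = dot u v + dot u w.
Proof. by rewrite !(dotC u) dotDl. Qed.

Lemma dotZl c u v : dot (c *: u) v = c * dot u v.
Proof. by rewrite mulr_sumr; apply: eq_bigr => i _; rewrite mxE mulrA. Qed.

Lemma dotZr c u v : dot u (c *: v) = c * dot u v.
Proof. by rewrite dotC dotZl dotC. Qed.

Lemma dotNl u v : dot (- u) v = - dot u v.
Proof. by rewrite -scaleN1r dotZl mulN1r. Qed.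

Lemma dotNr u v : dot u (- v) = - dot u v.
Proof. by rewrite dotC dotNl dotC. Qed.

Lemma dotBl u v w : dot (u - v) w = dot u w - dot v w.
Proof. by rewrite dotDl dotNl. Qed.

Lemma dotBr u v w : dot u (v - w) = dot u v - dot u w.
Proof. by rewrite dotDr dotNr. Qed.

Lemma dot0l u : dot 0 u = 0.
Proof. by rewrite -(scale0r u) dotZl mul0r. Qed.

Lemma dot_suml (I : Type) (s : seq I) (P : pred I) (F : I -> 'rV[rat]_k) v :
  dot (\sum_(i <- s | P i) F i) v = \sum_(i <- s | P i) dot (F i) v.
Proof.
elim/big_rec2: _ => [|i y x _ <-]; first exact: dot0l.
by rewrite dotDl.
Qed.

Lemma dot_epsr u (j : 'I_k) : dot u (eps k j) = u 0 j.
Proof. exact: dot_eps. Qed.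

Lemma dot_root u (a : posroot k) :
  dot u (root_of a) = u 0 (val a).1.1 + (-1) ^+ (val a).2 * u 0 (val a).1.2.
Proof.
by rewrite /root_of; case: (val a) => [[i j] b] /=; rewrite dotDr dotZr !dot_epsr.
Qed.

Lemma dot_rho (a : posroot k) : 0 < dot (rho k) (root_of a).
Proof.
rewrite dot_root !mxE; case: a => [[[i j] []] /= ij].
  by rewrite expr1 mulN1r subr_gt0 ltr_nat.
by rewrite expr0 mul1r -natrD ltr0n; lia.
Qed.

End Dot.

Section WeylGroup.
Variable k : nat.
Implicit Types (w : weyl k) (be la mu : 'rV[rat]_k).

Lemma wactE w be i :
  wact w be 0 i = (-1) ^+ (i \in (val w).2) * be 0 ((val w).1 i).
Proof. by rewrite mxE. Qed.

Lemma wactD w be la : wact w (be + la) = wact w be + wact w la.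
Proof. by apply/rowP => i; rewrite !(mxE, wactE) mulrDr. Qed.

Lemma wactN w be : wact w (- be) = - wact w be.
Proof. by apply/rowP => i; rewrite !(mxE, wactE) mulrN. Qed.

Lemma wactB w be la : wact w (be - la) = wact w be - wact w la.
Proof. by rewrite wactD wactN. Qed.

Lemma wactZ w c be : wact w (c *: be) = c *: wact w be.
Proof. by apply/rowP => i; rewrite !(mxE, wactE); ring. Qed.

Lemma wact0 w : wact w 0 = 0.
Proof. by rewrite -[in LHS](subrr (0 : 'rV_k)) wactB subrr. Qed.

Lemma wact_sum (I : Type) (s : seq I) (P : pred I) w (F : I -> 'rV[rat]_k) :
  wact w (\sum_(i <- s | P i) F i) = \sum_(i <- s | P i) wact w (F i).
Proof.
by elim/big_rec2: _ => [|i y x _ <-]; [exact: wact0 | rewrite wactD].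
Qed.

Lemma dot_wact w be la : dot (wact w be) (wact w la) = dot be la.
Proof.
rewrite /dot [RHS](reindex_inj (@perm_inj _ (val w).1)) /=.
by apply: eq_bigr => i _; rewrite !wactE mulrACA -expr2 -exprM mulnC exprM sqrrN !expr1n mul1r.
Qed.

Lemma odd_card_symdiff (A B : {set 'I_k}) :
  odd #|A :\: B :|: (B :\: A)| = odd #|A| (+) odd #|B|.
Proof.
rewrite cardsU !cardsD [B :&: A]setIC.
have -> : (A :\: B) :&: (B :\: A) = set0.
  by apply/setP => x; rewrite !inE; case: (x \in A); case: (x \in B).
rewrite cards0 subn0 oddD !oddB ?subset_leq_card ?subsetIl ?subsetIr //.
by rewrite addbACA addbb addbF.
Qed.

(** Applying [w'] and then [w] multiplies the signs, so the set of sign changes is the symmetric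
    difference of that of [w] and of a preimage of that of [w']. *)
Definition wmul_fun w w' : {perm 'I_k} * {set 'I_k} :=
  (((val w).1 * (val w').1)%g,
   let E := [set i | (val w).1 i \in (val w').2] in
   (val w).2 :\: E :|: (E :\: (val w).2)).

Lemma wmul_even w w' : ~~ odd #|(wmul_fun w w').2|.
Proof.
rewrite odd_card_symdiff (negPf (valP w)) /=.
suff -> : #|[set i | (val w).1 i \in (val w').2]| = #|(val w').2| by exact: valP w'.
rewrite -[RHS](card_imset _ (@perm_inj _ (val w).1^-1)); apply: eq_card => i.
by rewrite inE; apply/idP/imsetP => [H|[j jE ->]]; [exists ((val w).1 i);
  rewrite ?permK | rewrite permKV].
Qed.

Definition wmul w w' : weyl k := exist _ (wmul_fun w w') (wmul_even w w').

Lemma wact_wmul w w' be : wact (wmul w w') be = wact w (wact w' be).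
Proof.
apply/rowP => i; rewrite !wactE mulrA /= permM; congr (_ * _).
rewrite -signr_addb !inE; congr (_ ^+ nat_of_bool _).
by case: (_ \in _); case: (_ \in _).
Qed.

Lemma wone_even : ~~ odd #|(1%g : {perm 'I_k}, set0 : {set 'I_k}).2|.
Proof. by rewrite cards0. Qed.

Definition wone : weyl k := exist _ (1%g, set0) wone_even.

Lemma wact_wone be : wact wone be = be.
Proof. by apply/rowP => i; rewrite wactE /= inE perm1 expr0 mul1r. Qed.

(** The all-ones vector reads off the signs; the coordinates of rho are pairwise distinct and then
    give the permutation. *)
Lemma weyl_eq w w' : (forall i, wact w (rho k) 0 i = wact w' (rho k) 0 i) ->
  (forall i, wact w (const_mx 1) 0 i = wact w' (const_mx 1) 0 i) -> w = w'.
Proof.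
move=> H1 H2.
have HE : (val w).2 = (val w').2.
  apply/setP => i; have := H2 i; rewrite !wactE !mxE !mulr1.
  by case: (i \in _); case: (i \in _) => // /eqP.
apply: val_inj; rewrite [LHS]surjective_pairing [RHS]surjective_pairing HE; congr pair.
apply/permP => i; have := H1 i; rewrite !wactE !mxE HE => /(mulrI (unitrX _ (unitrN1 _))).
by move/eqP; rewrite eqr_nat => /eqP /val_inj.
Qed.

Lemma weyl_faithful w w' : wact w =1 wact w' -> w = w'.
Proof. by move=> H; apply: weyl_eq => i; rewrite H. Qed.

Lemma wmul_inj w : injective (wmul w).
Proof.
move=> w1 w2 e; apply: weyl_faithful => be.
have wact_inj : injective (wact w).
  move=> u v uv; apply/rowP => j; have /rowP/(_ ((val w).1^-1 j)%g) := uv.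
  by rewrite !wactE permKV => /(mulrI (unitrX _ (unitrN1 _))).
by apply: wact_inj; rewrite -!wact_wmul e.
Qed.

(** [wmul w] is an injection of a finite set into itself, hence a bijection. *)
Definition winv w : weyl k := invF (@wmul_inj w) wone.

Lemma wmulV w : wmul w (winv w) = wone.
Proof. exact: f_invF. Qed.

Lemma wactKV w : cancel (wact (winv w)) (wact w).
Proof. by move=> be; rewrite -wact_wmul wmulV wact_wone. Qed.

Lemma wactK w : cancel (wact w) (wact (winv w)).
Proof.
move=> be; suff inj : injective (wact w) by apply: inj; rewrite wactKV.
move=> u v uv; apply/rowP => j; have /rowP/(_ ((val w).1^-1 j)%g) := uv.
by rewrite !wactE permKV => /(mulrI (unitrX _ (unitrN1 _))).
Qed.

Lemma wact_inj w : injective (wact w). Proof. exact: can_inj (@wactK w). Qed.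

Lemma wmulA w1 w2 w3 : wmul w1 (wmul w2 w3) = wmul (wmul w1 w2) w3.
Proof. by apply: weyl_faithful => be; rewrite !wact_wmul. Qed.

Lemma winvM w : wmul (winv w) w = wone.
Proof. by apply: weyl_faithful => be; rewrite wact_wmul wactK wact_wone. Qed.

Lemma winvK : involutive winv.
Proof.
move=> w; apply: weyl_faithful => be.
by apply: (@wact_inj (winv w)); rewrite wactKV wactK.
Qed.

Lemma wact_eqV w be la : (wact w be == la) = (be == wact (winv w) la).
Proof. by apply/eqP/eqP => [<-|->]; rewrite ?wactK ?wactKV. Qed.

(** An even number of sign changes has determinant 1, so the determinant of [w] is the sign of its
    permutation. By [sign_wlength] it is (-1)^l(w) when k > 1. *)
Definition wodd w : bool := odd_perm (val w).1.

Lemma wodd_mul w w' : wodd (wmul w w') = wodd w (+) wodd w'.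
Proof. exact: odd_permM. Qed.

Lemma wodd_inv w : wodd (winv w) = wodd w.
Proof.
have := wodd_mul w (winv w); rewrite wmulV /wodd /= odd_perm1.
by case: odd_perm; case: odd_perm.
Qed.

(** The reflection in eps_i - eps_j exchanges two coordinates; the one in eps_i + eps_j also changes
    both signs. *)
Lemma refl_even (a : posroot k) :
  ~~ odd #|(tperm (val a).1.1 (val a).1.2,
            if (val a).2 then set0 else [set (val a).1.1; (val a).1.2]).2|.
Proof.
case: a => [[[i j] b] /= ij]; case: b => /=; rewrite ?cards0 // cards2.
by have -> : i != j by rewrite -val_eqE gtn_eqF.
Qed.

Definition wrefl (a : posroot k) : weyl k := exist _ (_, _) (refl_even a).

Lemma wact_wrefl a be : wact (wrefl a) be = be - dot be (root_of a) *: root_of a.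
Proof.
apply/rowP => l; rewrite wactE dot_root /root_of; case: a => [[[i j] b] /= ij].
have nij : (i == j :> nat) = false by rewrite gtn_eqF.
rewrite !mxE; case: tpermP => [->|->|/eqP li /eqP lj].
- rewrite eqxx nij; case: b => /=; rewrite !inE ?eqxx /= ?expr0 ?expr1; ring.
- rewrite eqxx eq_sym nij; case: b => /=; rewrite !inE ?eqxx ?orbT /= ?expr0 ?expr1; ring.
move: li lj; rewrite -!val_eqE => /negPf li /negPf lj; rewrite li lj.
by case: b; rewrite !inE /= -?val_eqE ?li ?lj /= ?expr0 ?expr1; ring.
Qed.

Lemma wodd_wrefl a : wodd (wrefl a).
Proof.
by rewrite /wodd odd_tperm; case: a => [[[i j] b] /= ij]; rewrite -val_eqE /= gtn_eqF.
Qed.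

Lemma wrefl_invol a : involutive (wact (wrefl a)).
Proof.
move=> be; apply/rowP => i; rewrite !wactE mulrA /= tpermK.
suff -> : (tperm (val a).1.1 (val a).1.2 i \in (val (wrefl a)).2) = (i \in (val (wrefl a)).2).
  by rewrite -signr_addb addbb expr0 mul1r.
rewrite /=; case: (val a).2; rewrite ?inE //.
by case: tpermP => [->|->|//]; rewrite !eqxx ?orbT.
Qed.

Lemma winv_wrefl a : winv (wrefl a) = wrefl a.
Proof.
by apply: weyl_faithful => be; apply: (@wact_inj (wrefl a)); rewrite wactKV wrefl_invol.
Qed.

Lemma weight_lattice_wact w be : weight_lattice be -> weight_lattice (wact w be).
Proof.
move=> /orP[/forallP H|/forallP H]; apply/orP; [left|right]; apply/forallP => i.
  by rewrite wactE rpredM ?rpredX ?rpredN ?rpred1.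
rewrite wactE; case: (i \in _); rewrite ?expr1 ?expr0 ?mulN1r ?mul1r //.
set x := be 0 _; have -> : - x - 2^-1 = - (x - 2^-1) - 1 :> rat.
  by field.
by rewrite rpredB ?rpred1 // rpredN; apply: H.
Qed.

Hypothesis k_gt1 : (1 < k)%N.

Lemma simple_rootE (i : 'I_k) : exists a : posroot k, simple_root i = root_of a.
Proof.
case: (posnP i) => i0.
  have p : ((Ordinal (ltnW k_gt1), false).1 < Ordinal k_gt1)%N by [].
  exists (exist _ (Ordinal k_gt1, Ordinal (ltnW k_gt1), false) p).
  by rewrite /simple_root /root_of i0 /= scale1r addrC.
have p : (i.-1 < k)%N by apply: leq_ltn_trans (ltn_ord i); rewrite leq_pred.
have q : (Ordinal p < i)%N by rewrite /= prednK.
exists (exist _ (i, Ordinal p, true) q).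
by rewrite /simple_root /root_of (gtn_eqF i0) /= scaleN1r.
Qed.

Lemma sreflection_wrefl (i : 'I_k) : exists2 a : posroot k,
  simple_root i = root_of a & sreflection i =1 wact (wrefl a).
Proof.
have [a ia] := simple_rootE i; exists a => // be.
by rewrite wact_wrefl sreflectionE -ia.
Qed.

Lemma word_act_weyl (t : seq 'I_k) :
  exists2 w, word_act t =1 wact w & wodd w = odd (size t).
Proof.
elim: t => [|i t [w tw ow]].
  by exists wone => [be|]; rewrite ?wact_wone // /wodd odd_perm1.
have [a _ ia] := sreflection_wrefl i; exists (wmul (wrefl a) w).
  by move=> be; rewrite /= ia tw wact_wmul.
by rewrite wodd_mul wodd_wrefl ow.
Qed.

(** Simple reflections are odd, so every word for [w], in particular a shortest one, has a length of
    the parity of [wodd w]. *)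
Lemma sign_wlength (R : pzRingType) w : (-1) ^+ wlength w = (-1) ^+ wodd w :> R.
Proof.
rewrite /wlength; case: ex_minnP => m /existsP[t /forallP tP] _.
have [w' tw' ow'] := word_act_weyl t; rewrite -signr_odd -{1}(size_tuple t) -ow'.
congr (_ ^+ nat_of_bool _); congr (odd_perm _); apply/permP => i.
(* The i-th coordinate of the image of this basis vector is nonzero, which forces the permutation of
   [w'] to agree with that of [w] at i. *)
have /eqP/rowP/(_ i) := tP ((val w).1 i); rewrite tw' !wactE !mxE eqxx mulr1.
case: eqP => [/val_inj //|_]; rewrite mulr0 => /esym/eqP.
by rewrite eq_sym signr_eq0.
Qed.

(** Induction along a word for [w]: invariance under W reduces to invariance under single
    reflections. *)
Lemma weyl_ind (Q : weyl k -> Prop) : Q wone ->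
  (forall r w, Q w -> Q (wmul (wrefl r) w)) -> forall w, Q w.
Proof.
move=> Q1 QM w; have [m /existsP[t /forallP tP]] := exists_word w.
have [w' tw' Qw'] : exists2 w', word_act t =1 wact w' & Q w'.
  elim: (tval t) => [|i s [w' sw' Qw']].
    by exists wone => // be; rewrite wact_wone.
  have [a _ ia] := sreflection_wrefl i; exists (wmul (wrefl a) w'); last exact: QM.
  by move=> be; rewrite /= ia sw' wact_wmul.
suff -> : w = w' by [].
apply: weyl_faithful => be.
have -> : be = \sum_(j < k) be 0 j *: eps k j.
  apply/rowP => i; rewrite summxE (bigD1 i) //= big1 ?addr0 => [|j ji].
    by rewrite !mxE eqxx mulr1.
  by rewrite !mxE val_eqE eq_sym (negPf ji) mulr0.
rewrite !wact_sum; apply: eq_bigr => j _; rewrite !wactZ.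
by have /eqP := tP j; rewrite tw' => ->.
Qed.

End WeylGroup.

(** * Dominant weights as representatives of the orbits *)

Section Dominance.
Variable k : nat.
Implicit Types (w : weyl k) (be la mu nu : 'rV[rat]_k).

Lemma weight_lattice_dot be (a : posroot k) :
  weight_lattice be -> dot be (root_of a) \is a Num.int.
Proof.
rewrite dot_root; move: (val a) => [[i j] b] /= /orP[/forallP H|/forallP H].
  by rewrite rpredD ?rpredM ?rpredX ?rpredN ?rpred1.
have -> : be 0 i + (-1) ^+ b * be 0 j =
  (be 0 i - 2^-1) + (-1) ^+ b * (be 0 j - 2^-1) + (~~ b)%:R :> rat.
  by case: b; rewrite ?expr0 ?expr1 /=; field.
by rewrite rpredD ?rpred_nat // rpredD ?rpredM ?rpredX ?rpredN ?rpred1 //; apply: H.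
Qed.

Lemma weight_lattice_int be la : (forall i, la 0 i \is a Num.int) ->
  weight_lattice be -> weight_lattice (be + la).
Proof.
move=> Hla /orP[/forallP H|/forallP H]; apply/orP; [left|right]; apply/forallP => i.
  by rewrite mxE rpredD.
by rewrite mxE addrAC rpredD //; apply: H.
Qed.

Lemma root_int (a : posroot k) i : root_of a 0 i \is a Num.int.
Proof.
rewrite /root_of; case: (val a) => [[i1 j] b]; rewrite !mxE.
by rewrite rpredD ?rpredM ?rpredX ?rpredN ?rpred1 ?rpred_nat.
Qed.

Lemma rho_int i : rho k 0 i \is a Num.int.
Proof. by rewrite mxE rpred_nat. Qed.

Lemma weight_lattice_rho be : weight_lattice (be + rho k) = weight_lattice be.
Proof.
apply/idP/idP => H; last exact: weight_lattice_int rho_int H.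
by rewrite -[be](addrK (rho k)); apply: weight_lattice_int H => i; rewrite mxE rpredN rho_int.
Qed.

(** The adjacent inequalities chain up to |be_j| <= be_i for j < i, which controls both eps_i +
    eps_j and eps_i - eps_j. *)
Lemma dominant_dot be (a : posroot k) : dominant be -> 0 <= dot be (root_of a).
Proof.
case/andP=> _ /forallP H; rewrite dot_root; case: a => [[[i j] b] /= ji].
have step (l m : 'I_k) : l.+1 = m -> `|be 0 l| <= be 0 m.
  have [n ln] : {n | nat_of_ord l = n} by exists l.
  elim: n l ln m => [|n IHn] l ln m lm.
    by have /forallP/(_ m)/implyP/(_ (introT eqP lm)) := H l; rewrite ln eqxx.
  have ltn_k : (n < k)%N by apply: leq_trans (ltn_ord l); rewrite ln.
  have := IHn (Ordinal ltn_k) erefl l (esym ln).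
  have /forallP/(_ m)/implyP/(_ (introT eqP lm)) := H l; rewrite ln => H1 H2.
  by rewrite ger0_norm // (le_trans (normr_ge0 _) H2).
have le_ji : `|be 0 j| <= be 0 i.
  have [n iE] : {n | nat_of_ord i = n} by exists i.
  elim: n i ji iE => [i|n IHn i]; first by move=> ji iE; rewrite iE in ji.
  move=> ji iE; move: (ji); rewrite iE ltnS leq_eqVlt => /orP[/eqP jn|jn].
    by apply: step; rewrite jn iE.
  have ltn_k : (n < k)%N by apply: leq_trans (ltn_ord i); rewrite iE.
  apply: le_trans (IHn (Ordinal ltn_k) jn erefl) _.
  by apply: le_trans (ler_norm _) (step _ _ _); rewrite /= iE.
have := ler_norm (be 0 j); have := ler_norm (- be 0 j); rewrite normrN.
by case: b; rewrite ?expr0 ?expr1; lra.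
Qed.

Lemma dominantP be : (1 < k)%N -> weight_lattice be ->
  (forall a : posroot k, 0 <= dot be (root_of a)) -> dominant be.
Proof.
move=> k1 beP H; apply/andP; split=> //; apply/forallP => i; apply/forallP => j.
apply/implyP => /eqP ij.
have ji : ((j, i, true).1.2 < (j, i, true).1.1)%N by rewrite /= -ij.
have ji' : ((j, i, false).1.2 < (j, i, false).1.1)%N by rewrite /= -ij.
have := H (exist _ (j, i, true) ji); have := H (exist _ (j, i, false) ji').
rewrite !dot_root /= expr0 expr1 => H1 H2.
by case: ifP => _; [case: (ger0P (be 0 i)); lra | lra].
Qed.

Definition strictly_dominant nu := forall a : posroot k, 0 < dot nu (root_of a).

Lemma strictly_dominant_rho la : dominant la -> strictly_dominant (la + rho k).
Proof. by move=> H a; rewrite dotDl ltr_wpDl ?dot_rho // dominant_dot. Qed.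

(** On the weight lattice the products with roots are integers, so positive ones are at least 1,
    which is the product of rho with a simple root. *)
Lemma strictly_dominant_sub_rho nu : (1 < k)%N -> weight_lattice nu ->
  strictly_dominant nu -> dominant (nu - rho k).
Proof.
move=> k1 nuP H; apply/andP; split; first by rewrite -weight_lattice_rho subrK.
apply/forallP => i; apply/forallP => j; apply/implyP => /eqP ij.
have ji : ((j, i, true).1.2 < (j, i, true).1.1)%N by rewrite /= -ij.
have ji' : ((j, i, false).1.2 < (j, i, false).1.1)%N by rewrite /= -ij.
have int_ge1 (x : rat) : x \is a Num.int -> 0 < x -> 1 <= x.
  by move=> /intrP[m ->]; rewrite ltr0z (ler1z rat).
have := int_ge1 _ (weight_lattice_dot (exist _ (j, i, true) ji) nuP) (H _).
have := int_ge1 _ (weight_lattice_dot (exist _ (j, i, false) ji') nuP) (H _).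
rewrite !dot_root /= expr0 expr1 !mxE -ij => H1 H2.
have nE : i.+1%:R = i%:R + 1 :> rat by rewrite -natr1.
rewrite nE; case: ifP => [/eqP -> |_]; last by lra.
by rewrite subr0 add0r; case: (ger0P (nu 0 i)); lra.
Qed.

(** Among the finitely many images of nu take one with the largest product with rho: reflecting it
    in a root with which its product is negative would increase that maximum. *)
Lemma exists_dominant nu :
  exists w, forall a : posroot k, 0 <= dot (wact w nu) (root_of a).
Proof.
have [w _ wmax] := @Order.TotalTheory.arg_maxP _ _ _ (wone k) predT
   (fun w => dot (wact w nu) (rho k)) isT.
exists w => a; have := wmax (wmul (wrefl a) w) isT; rewrite /=.
rewrite wact_wmul wact_wrefl dotBl dotZl gerBl [dot (root_of a) _]dotC.
by rewrite pmulr_lge0 // dot_rho.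
Qed.

Lemma strictly_dominant_lt nu (i j : 'I_k) : strictly_dominant nu ->
  (j < i)%N -> `|nu 0 j| < nu 0 i.
Proof.
move=> H ji.
have := H (exist _ (i, j, true) ji); have := H (exist _ (i, j, false) ji).
by rewrite !dot_root /= expr0 expr1; case: (ger0P (nu 0 j)); lra.
Qed.

(** The absolute values of the coordinates increase with the index, so the permutation is
    increasing, hence trivial. All coordinates but the one of index 0 are positive, so a sign can
    change only there, and a single change is not even. *)
Lemma strictly_dominant_wact_eq nu w : (1 < k)%N ->
  strictly_dominant nu -> strictly_dominant (wact w nu) -> w = wone k.
Proof.
move=> k1 H Hw.
have abs_lt la (i j : 'I_k) : strictly_dominant la ->
    (`|la 0 j| < `|la 0 i|) = (j < i)%N.
  move=> la_dom.
  have lt (l m : 'I_k) : (m < l)%N -> `|la 0 m| < `|la 0 l|.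
    by move=> ml; apply: lt_le_trans (strictly_dominant_lt la_dom ml) (ler_norm _).
  case: (ltngtP j i) => [/lt //|/lt/lt_gtF //|/val_inj ->]; exact: ltxx.
have wp1 : (val w).1 = 1%g.
  have mono : {mono (val w).1 : i j / (i < j)%N}.
    move=> i j; rewrite -(abs_lt (wact w nu) j i Hw) -(abs_lt nu _ _ H) !wactE !normrM !normrX.
    by rewrite normrN normr1 !expr1n !mul1r.
  have le n : forall i : 'I_k, i = n :> nat -> (i <= (val w).1 i)%N.
    elim: n => [|n IHn] i iE; first by rewrite iE.
    have nk : (n < k)%N by apply: leq_trans (ltn_ord i); rewrite iE.
    rewrite iE; apply: leq_ltn_trans (IHn (Ordinal nk) erefl) _.
    by rewrite mono iE.
  apply/permP => i; rewrite perm1; apply: val_inj; apply/eqP; rewrite eqn_leq (le i) // andbT.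
  (* An increasing permutation s satisfies i <= s(i); both sides have the same sum, so equality
     holds everywhere. *)
  have sum_eq : (\sum_i (val w).1 i = \sum_(i : 'I_k) i)%N.
    by rewrite [RHS](reindex_inj (@perm_inj _ (val w).1)).
  have := leqif_sum (fun (i : 'I_k) (_ : predT i) => leqif_eq (le i i erefl)).
  by rewrite sum_eq => -[_]; rewrite eqxx => /esym/forallP/(_ i)/=/eqP {1}->.
have sg (i : 'I_k) : (0 < i)%N -> i \notin (val w).2.
  move=> i0; pose z := Ordinal (ltnW k1).
  have := strictly_dominant_lt Hw (i0 : (z < i)%N).
  have := strictly_dominant_lt H (i0 : (z < i)%N).
  rewrite !wactE wp1 !perm1 normrM normrX normrN normr1 expr1n mul1r.
  by have := normr_ge0 (nu 0 z); case: (i \in _); rewrite ?expr0 ?expr1; lra.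
apply: val_inj; rewrite [LHS]surjective_pairing wp1; congr pair.
apply/setP => i; rewrite inE; case: (posnP i) => [i0|/sg/negPf //].
have : (val w).2 \subset [set i].
  apply/subsetP => j jw; rewrite inE -val_eqE /= i0.
  by case: (posnP j) => [//|/sg]; rewrite jw.
by rewrite subset1 => /orP[/eqP E|/eqP ->]; [have := valP w; rewrite E cards1|rewrite inE].
Qed.

Lemma wact_strictly_dominant_inj w w' nu nu' : (1 < k)%N ->
  strictly_dominant nu -> strictly_dominant nu' -> wact w nu = wact w' nu' ->
  w = w' /\ nu = nu'.
Proof.
move=> k1 H H' e.
have e' : wact (wmul (winv w') w) nu = nu' by rewrite wact_wmul e wactK.
have := strictly_dominant_wact_eq k1 H; rewrite -e' in H' *.
move=> /(_ _ H') ww; split; last by rewrite ww wact_wone.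
by apply: (@wmul_inj _ (winv w')); rewrite ww winvM.
Qed.

End Dominance.

(** * Exponentials *)

Section Exponentials.
Variable k : nat.
Implicit Types (w : weyl k) (be la mu nu : 'rV[rat]_k).

(** On these rows the [numq] in [wexp] is the exponent itself, so that [wexp] is multiplicative. *)
Definition half_int be := forall i, 2 * be 0 i \is a Num.int.

Lemma int_half_int be : (forall i, be 0 i \is a Num.int) -> half_int be.
Proof. by move=> H i; rewrite rpredM ?rpred_nat. Qed.

Lemma half_intD be la : half_int be -> half_int la -> half_int (be + la).
Proof. by move=> H1 H2 i; rewrite mxE mulrDr rpredD. Qed.

Lemma half_intN be : half_int be -> half_int (- be).
Proof. by move=> H i; rewrite mxE mulrN rpredN. Qed.

Lemma half_intB be la : half_int be -> half_int la -> half_int (be - la).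
Proof. by move=> H1 H2; apply/half_intD/half_intN. Qed.

Lemma half_int_wact w be : half_int be -> half_int (wact w be).
Proof. by move=> H i; rewrite wactE mulrCA rpredM ?rpredX ?rpredN ?rpred1. Qed.

Lemma half_int_rho : half_int (rho k).
Proof. by apply: int_half_int => i; apply: rho_int. Qed.

Lemma half_int_sum (I : Type) (s : seq I) (P : pred I) (F : I -> 'rV[rat]_k) :
  (forall i, P i -> half_int (F i)) -> half_int (\sum_(i <- s | P i) F i).
Proof.
move=> H; elim/big_ind: _ => [i|be la|//]; first by rewrite mxE mulr0 rpred0.
exact: half_intD.
Qed.

Let X (i : 'I_k) : char_field k := FracField.tofrac ('X_i : {mpoly int[k]}).

Lemma X_neq0 i : X i != 0.
Proof. by rewrite tofrac_eq0 -msupp_eq0 msuppX. Qed.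

Lemma wexpD be la : half_int be -> half_int la ->
  wexp (be + la) = wexp be * wexp la.
Proof.
move=> Hb Hl; rewrite /wexp -big_split /=; apply: eq_bigr => i _.
rewrite -expfzDr ?X_neq0 // mxE mulrDr; congr (_ ^ _).
have /intrP[m mE] := Hb i; have /intrP[n nE] := Hl i.
by rewrite mE nE -intrD !numq_int.
Qed.

Lemma wexp0 : wexp (0 : 'rV[rat]_k) = 1.
Proof. by rewrite /wexp big1 // => i _; rewrite mxE mulr0. Qed.

Lemma wexpN be : half_int be -> wexp (- be) = (wexp be)^-1.
Proof.
move=> H; have /(congr1 (fun x => (wexp be)^-1 * x)) := wexpD H (half_intN H).
rewrite subrr wexp0 mulr1 mulKf //.
by apply/prodf_neq0 => i _; rewrite expfz_neq0 // X_neq0.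
Qed.

Lemma wexp_sum (I : Type) (s : seq I) (P : pred I) (F : I -> 'rV[rat]_k) :
  (forall i, P i -> half_int (F i)) ->
  wexp (\sum_(i <- s | P i) F i) = \prod_(i <- s | P i) wexp (F i).
Proof.
move=> H; elim: s => [|i s IHs]; first by rewrite !big_nil wexp0.
rewrite !big_cons; case: ifP => Pi //; rewrite wexpD ?IHs //; first exact: H.
exact: half_int_sum.
Qed.

Lemma wexp_Mn be n : half_int be -> wexp (be *+ n) = wexp be ^+ n.
Proof.
move=> H; rewrite -[n in LHS]subn0 -sumr_const_nat wexp_sum // prodr_const_nat.
by rewrite subn0.
Qed.

Lemma intr_char_field_eq0 (n : int) : (n%:~R == 0 :> char_field k) = (n == 0).
Proof.
rewrite -(rmorph_int (@FracField.tofrac {mpoly int[k]})) tofrac_eq0.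
have -> : n%:~R = n%:MP_[k] by rewrite -(rmorph_int (@mpolyC k int)) intz.
by rewrite mpolyC_eq0.
Qed.

(* Distinct Laurent monomials are linearly independent, so an identity between
   sums of exponentials holds for any function of the exponent. *)
Lemma wexp_transfer_seq (M : zmodType) (phi : 'rV[rat]_k -> M)
    (s : seq (int * 'rV[rat]_k)) :
  (forall x, x \in s -> half_int x.2) ->
  \sum_(x <- s) x.1%:~R * wexp x.2 = 0 -> \sum_(x <- s) phi x.2 *~ x.1 = 0.
Proof.
move=> Hs s0.
(* Multiplying by the N-th power of every variable turns the Laurent monomials into monomials. *)
have [N Nge] : exists N : nat, forall x, x \in s -> forall i, 0 <= numq (2 * x.2 0 i) + N%:Z.
  exists (\sum_(x <- s) \sum_(i < k) `|numq (2 * x.2 0%R i)%R|)%N => x xs i.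
  rewrite (big_rem x) //= (bigD1 i) //=; lia.
pose m (x : int * 'rV[rat]_k) : 'X_{1..k} := [multinom absz (numq (2 * x.2 0 i) + N%:Z)%R | i <
  k].
have mE x : x \in s ->
    wexp x.2 * \prod_i X i ^+ N = FracField.tofrac ('X_[m x] : {mpoly int[k]}).
  move=> xs; rewrite mpolyXE_id rmorph_prod /wexp -big_split /=; apply: eq_bigr => i _.
  rewrite rmorphXn /= mnmE /= !exprnP -/(X i) -expfzDr ?X_neq0 //.
  by rewrite gez0_abs ?Nge.
have m_inj x y : x \in s -> y \in s -> (m x == m y) = (x.2 == y.2).
  move=> xs ys; apply/eqP/eqP => [/mnmP e|e]; last by rewrite /m e.
  apply/rowP => i; have := e i; rewrite !mnmE => /(congr1 Posz).
  rewrite !gez0_abs ?Nge // => /addIr.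
  have /intrP[a aE] := Hs _ xs i; have /intrP[b bE] := Hs _ ys i.
  by rewrite aE bE !numq_int => ab; apply: (@mulfI _ 2) => //; rewrite aE bE ab.
have p0 : \sum_(x <- s) x.1 *: 'X_[m x] = 0 :> {mpoly int[k]}.
  apply/eqP; rewrite -tofrac_eq0 rmorph_sum /=; apply/eqP.
  transitivity ((\sum_(x <- s) x.1%:~R * wexp x.2) * \prod_i X i ^+ N); last by rewrite s0 mul0r.
  rewrite mulr_suml.
  apply: eq_big_seq => x xs; rewrite -mulrA mE // -mul_mpolyC rmorphM /=.
  congr (_ * _); rewrite -(rmorph_int (@FracField.tofrac {mpoly int[k]})).
  by rewrite -(rmorph_int (@mpolyC k int)) intz.
(* Distinct exponents give distinct monomials, so the coefficient at [m y] collects exactly the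
   terms with exponent [y.2]. *)
have c0 y : y \in s -> \sum_(x <- s | x.2 == y.2) x.1 = 0.
  move=> ys; have /(congr1 (mcoeff (m y))) := p0.
  rewrite raddf_sum mcoeff0 /=; apply: etrans; rewrite big_mkcond; apply: eq_big_seq => x xs.
  by rewrite mcoeffZ mcoeffX m_inj //; case: eqP => _; rewrite ?mulr1 ?mulr0.
pose D := undup (map snd s).
transitivity (\sum_(be <- D) \sum_(x <- s | x.2 == be) phi x.2 *~ x.1).
  rewrite (exchange_big_dep predT) //=; apply: eq_big_seq => x xs.
  have xD : x.2 \in D by rewrite mem_undup map_f.
  rewrite big_mkcond (bigD1_seq x.2) ?undup_uniq //= eqxx big1 ?addr0 // => be.
  by rewrite eq_sym => /negPf ->.
rewrite big_seq big1 // => be; rewrite mem_undup => /mapP[y ys ->].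
rewrite -[RHS](mulr0z (phi y.2)) -(c0 y ys) mulrz_sumr.
by apply: eq_bigr => x /eqP ->.
Qed.

Lemma wexp_transfer (M : zmodType) (phi : 'rV[rat]_k -> M) (I J : finType)
    (c : I -> int) (be : I -> 'rV[rat]_k) (d : J -> int) (la : J -> 'rV[rat]_k) :
  (forall i, half_int (be i)) -> (forall j, half_int (la j)) ->
  \sum_i (c i)%:~R * wexp (be i) = \sum_j (d j)%:~R * wexp (la j) ->
  \sum_i phi (be i) *~ c i = \sum_j phi (la j) *~ d j.
Proof.
move=> Hbe Hla e; apply/eqP; rewrite -subr_eq0; apply/eqP.
pose s := [seq (c i, be i) | i <- enum I] ++ [seq (- d j, la j) | j <- enum J].
have sE (V : zmodType) (f : int * 'rV[rat]_k -> V) :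
    \sum_(x <- s) f x = \sum_i f (c i, be i) + \sum_j f (- d j, la j).
  by rewrite big_cat !big_map; congr (_ + _); apply: big_enum.
have := @wexp_transfer_seq _ phi s; rewrite !sE /= => T.
rewrite -sumrN; under [X in _ + X]eq_bigr do rewrite -mulrNz.
apply: T => [x|].
  by rewrite mem_cat => /orP[] /mapP[i _ ->]; [apply: Hbe | apply: Hla].
rewrite e; under [X in _ + X]eq_bigr do rewrite mulrNz mulNr.
by rewrite sumrN subrr.
Qed.

End Exponentials.

Section Alternants.
Variable k : nat.
Hypothesis k_gt1 : (1 < k)%N.
Implicit Types (w : weyl k) (be la mu nu : 'rV[rat]_k).

Lemma wmulr_inj w : injective (fun w' : weyl k => wmul w' w).
Proof.
move=> w1 w2 /(congr1 (fun u => wmul u (winv w))); rewrite -!wmulA wmulV => e.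
apply: weyl_faithful => be; have := congr1 (fun u => wact u be) e.
by rewrite !wact_wmul !wact_wone.
Qed.

Lemma alternant_wact w be : alternant (wact w be) = (-1) ^+ wodd w * alternant be.
Proof.
rewrite /alternant mulr_sumr [RHS](reindex_inj (@wmulr_inj w)) /=.
apply: eq_bigr => w' _; rewrite !sign_wlength // wodd_mul addbC signr_addb.
by rewrite wact_wmul !mulrA -expr2 sqrr_sign mul1r.
Qed.

End Alternants.

(** * The Lie algebra so_2k *)

Section Orthogonal.
Variables (C : numClosedFieldType) (k : nat).
Implicit Types (a b c d : 'I_(k + k)).

(** [so_form] pairs the basis vectors [a] and [dual_index a], whose weights are opposite. *)
Definition dual_index a : 'I_(k + k) :=
  match split a with inl i => rshift k i | inr i => lshift k i end.

Lemma dual_lshift (i : 'I_k) : dual_index (lshift k i) = rshift k i.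
Proof. by rewrite /dual_index (unsplitK (inl _ i)). Qed.

Lemma dual_rshift (i : 'I_k) : dual_index (rshift k i) = lshift k i.
Proof. by rewrite /dual_index (unsplitK (inr _ i)). Qed.

Lemma dual_indexK : involutive dual_index.
Proof.
by move=> a; rewrite -(splitK a); case: (split a) => i; rewrite /= !(dual_lshift, dual_rshift).
Qed.

Lemma dual_index_eq a b : (dual_index a == b) = (a == dual_index b).
Proof. by rewrite -{1}(dual_indexK b) (inj_eq (inv_inj dual_indexK)). Qed.

Lemma dual_index_neq a : (dual_index a == a) = false.
Proof.
rewrite -(splitK a); case: (split a) => i; rewrite /= !(dual_lshift, dual_rshift).
  by rewrite eq_rlshift.
by rewrite eq_lrshift.
Qed.

Definition vec_weight a : 'rV[rat]_k :=
  match split a with inl i => eps k i | inr i => - eps k i end.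

Lemma vec_weight_lshift (i : 'I_k) : vec_weight (lshift k i) = eps k i.
Proof. by rewrite /vec_weight (unsplitK (inl _ i)). Qed.

Lemma vec_weight_rshift (i : 'I_k) : vec_weight (rshift k i) = - eps k i.
Proof. by rewrite /vec_weight (unsplitK (inr _ i)). Qed.

Lemma vec_weight_dual a : vec_weight (dual_index a) = - vec_weight a.
Proof.
rewrite -(splitK a); case: (split a) => i /=.
  by rewrite dual_lshift vec_weight_lshift vec_weight_rshift.
by rewrite dual_rshift vec_weight_lshift vec_weight_rshift opprK.
Qed.

Lemma vec_weightE a (i : 'I_k) :
  vec_weight a 0 i = (a == lshift k i)%:R - (a == rshift k i)%:R.
Proof.
rewrite -(splitK a); case: (split a) => j /=.
  by rewrite vec_weight_lshift mxE eq_lshift eq_lrshift subr0 eq_sym.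
by rewrite vec_weight_rshift !mxE eq_rshift eq_rlshift sub0r eq_sym.
Qed.

Lemma so_formE a b : so_form C k a b = (a == dual_index b)%:R.
Proof.
rewrite -(splitK a) -(splitK b) /so_form.
case: (split a) => i; case: (split b) => j; rewrite /= ?dual_lshift ?dual_rshift.
- by rewrite block_mxEul mxE eq_lrshift.
- by rewrite block_mxEur mxE eq_lshift.
- by rewrite block_mxEdl mxE eq_rshift.
- by rewrite block_mxEdr mxE eq_rlshift.
Qed.

Lemma soP (X : 'M[C]_(k + k)) :
  reflect (forall a b, X a b = - X (dual_index b) (dual_index a)) (so X).
Proof.
have E a b : (X^T *m so_form C k + so_form C k *m X) a b =
             X (dual_index b) a + X (dual_index a) b.
  rewrite [LHS]mxE ![(_ *m _) _ _]mxE (bigD1 (dual_index b)) //=.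
  rewrite [X in _ + X](bigD1 (dual_index a)) //=.
  rewrite !so_formE [X^T _ _]mxE dual_indexK !eqxx mulr1 mul1r.
  rewrite !big1 ?addr0 // => c cb; rewrite so_formE.
    by rewrite eq_sym dual_index_eq (negPf cb) mul0r.
  by rewrite (negPf cb) mulr0.
apply: (iffP eqP) => [X0 a b|H].
  have /matrixP/(_ b (dual_index a)) := X0; rewrite E !mxE dual_indexK => /eqP.
  by rewrite addr_eq0 => /eqP.
by apply/matrixP => a b; rewrite E mxE H dual_indexK addNr.
Qed.

(** A vector of weight [vec_weight a - vec_weight b]. All pairs are kept, although (a, b) and (b',
    a') give opposite matrices: the relations and the Casimir element are then uniform in the
    indices. *)
Definition so_elt a b : 'M[C]_(k + k) :=
  delta_mx a b - delta_mx (dual_index b) (dual_index a).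

Lemma so_so_elt a b : so (so_elt a b).
Proof.
apply/soP => c d; rewrite !mxE opprB !dual_index_eq !dual_indexK.
by rewrite [(d == b) && _]andbC [(d == _) && _]andbC.
Qed.

Lemma so_elt_dual a b : so_elt (dual_index b) (dual_index a) = - so_elt a b.
Proof. by rewrite /so_elt !dual_indexK opprB. Qed.

(** For X in so_2k the pair (a, b) and its dual pair contribute the same multiple of the same
    matrix, hence the factor 1/2. *)
Lemma so_sum_elt (X : 'M[C]_(k + k)) : so X ->
  X = \sum_a \sum_b (2^-1 * X a b) *: so_elt a b.
Proof.
move=> /soP HX; rewrite {1}(matrix_sum_delta X).
have dual_sum (f : 'I_(k + k) -> 'M[C]_(k + k)) : \sum_a f a = \sum_a f (dual_index a).
  by rewrite (reindex_inj (inv_inj dual_indexK)).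
have -> : \sum_a \sum_b (2^-1 * X a b) *: so_elt a b =
  2^-1 *: \sum_a \sum_b X a b *: delta_mx a b +
  2^-1 *: \sum_a \sum_b X a b *: delta_mx a b.
  rewrite [X in _ = _ + _ *: X]exchange_big [X in _ = _ + _ *: X]dual_sum.
  under [X in _ = _ + _ *: X]eq_bigr do rewrite dual_sum.
  rewrite !scaler_sumr -big_split; apply: eq_bigr => a _.
  rewrite !scaler_sumr -big_split; apply: eq_bigr => b _.
  by rewrite /= [X in _ = _ + _ *: (X *: _)]HX !dual_indexK -scalerA -scalerDr scaleNr -scalerBr.
by rewrite -scalerDl -[2^-1]div1r -splitr scale1r.
Qed.

Lemma cartan_elt i : cartan C i = so_elt (lshift k i) (lshift k i).
Proof.
apply/matrixP => a b; rewrite /so_elt dual_lshift -(splitK a) -(splitK b) /cartan.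
case: (split a) => j; case: (split b) => l /=.
- by rewrite block_mxEul !mxE !eq_lshift !eq_lrshift subr0.
- by rewrite block_mxEur !mxE !eq_lshift !eq_lrshift eq_rlshift andbF subr0.
- by rewrite block_mxEdl !mxE !eq_lshift !eq_lrshift eq_rlshift andbF subr0.
- by rewrite block_mxEdr !mxE !eq_rshift !eq_rlshift sub0r.
Qed.

Lemma bracket_delta a b c d :
  bracket (delta_mx a b) (delta_mx c d) =
  (b == c)%:R *: delta_mx a d - (d == a)%:R *: delta_mx c b :> 'M[C]_(k + k).
Proof. by rewrite /bracket !mul_delta_mx_cond !scaler_nat. Qed.

Lemma bracketBB (X Y Z T : 'M[C]_(k + k)) :
  bracket (X - Y) (Z - T) = bracket X Z - bracket X T - bracket Y Z + bracket Y T.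
Proof.
rewrite /bracket !(mulmxBl, mulmxBr).
by apply/matrixP => i j; rewrite !mxE; ring.
Qed.

Lemma bracket_so_elt a b c d : bracket (so_elt a b) (so_elt c d) =
  (b == c)%:R *: so_elt a d - (a == d)%:R *: so_elt c b
  - (b == dual_index d)%:R *: so_elt a (dual_index c)
  + (a == dual_index c)%:R *: so_elt (dual_index d) b.
Proof.
rewrite /so_elt bracketBB !bracket_delta !dual_indexK.
rewrite !dual_index_eq !dual_indexK.
rewrite [d == a]eq_sym [d == dual_index b]eq_sym dual_index_eq [c == dual_index a]eq_sym.
rewrite dual_index_eq [c == b]eq_sym.
by apply/matrixP => i j; rewrite !mxE; ring.
Qed.

End Orthogonal.

Section PositiveRoots.
Variable k : nat.

Lemma posroot_big (R : Type) (idx : R) (op : Monoid.com_law idx)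
    (f : 'I_k * 'I_k * bool -> R) :
  \big[op/idx]_(a : posroot k) f (val a) =
  \big[op/idx]_(i < k) \big[op/idx]_(j < k | (j < i)%N)
    op (f (i, j, true)) (f (i, j, false)).
Proof.
transitivity (\big[op/idx]_(p : 'I_k * 'I_k * bool | (p.1.2 < p.1.1)%N) f p).
  by apply: esym; exact: (big_sub (fun p : 'I_k * 'I_k * bool => (p.1.2 < p.1.1)%N)).
rewrite (@eq_big _ _ _ _ _ _ (fun p : 'I_k * 'I_k * bool => (p.1.2 < p.1.1)%N && true) _
  (fun p => f (p.1, p.2))); last 2 first.
- by move=> p; rewrite andbT.
- by case=> p b.
rewrite -(pair_big_dep (fun p : 'I_k * 'I_k => (p.2 < p.1)%N) (fun _ _ => true)
  (fun p b => f (p, b))) [RHS]pair_big_dep /=.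
by apply: eq_bigr => -[i j] _; rewrite big_bool.
Qed.

Lemma posroot_sum (R : nmodType) (f : 'I_k * 'I_k * bool -> R) :
  \sum_(a : posroot k) f (val a) =
  \sum_(i < k) \sum_(j < k | (j < i)%N) (f (i, j, true) + f (i, j, false)).
Proof. exact: posroot_big. Qed.

(** The weights of the two indices differ by the root: [so_elt] at this pair is a root vector for
    [a], and at the reversed pair one for the opposite root. *)
Definition root_left (a : posroot k) : 'I_(k + k) := lshift k (val a).1.1.
Definition root_right (a : posroot k) : 'I_(k + k) :=
  if (val a).2 then lshift k (val a).1.2 else rshift k (val a).1.2.

Lemma root_of_vec_weight a :
  root_of a = vec_weight (root_left a) - vec_weight (root_right a).
Proof.
rewrite /root_of /root_left /root_right; case: (val a) => [[i j] []] /=.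
  by rewrite !vec_weight_lshift scaleN1r.
by rewrite vec_weight_lshift vec_weight_rshift scale1r opprK.
Qed.

Lemma root_left_neq_right a : (root_left a == root_right a) = false.
Proof.
rewrite /root_left /root_right; case: a => [[[i j] []] /= ji]; last exact: eq_lrshift.
by rewrite eq_lshift -val_eqE gtn_eqF.
Qed.

Lemma root_left_neq_dual a : (root_left a == dual_index (root_right a)) = false.
Proof.
rewrite /root_left /root_right; case: a => [[[i j] []] /= ji].
  by rewrite dual_lshift eq_lrshift.
by rewrite dual_rshift eq_lshift -val_eqE gtn_eqF.
Qed.

(* Every nonzero pair is, up to the duality (a, b) |-> (b', a'), diagonal or the
   pair of a root. *)
Lemma index_pair_ind (Q : 'I_(k + k) -> 'I_(k + k) -> Prop) :
  (forall a b, Q a b -> Q (dual_index b) (dual_index a)) ->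
  (forall a, Q a (dual_index a)) -> (forall a, Q a a) ->
  (forall r, Q (root_left r) (root_right r)) ->
  (forall r, Q (root_right r) (root_left r)) -> forall a b, Q a b.
Proof.
move=> Hd H0 H1 Hp Hn.
pose r (i j : 'I_k) (b : bool) (ji : (j < i)%N) : posroot k := exist _ (i, j, b) ji.
have Qll i j : Q (lshift k i) (lshift k j).
  case: (ltngtP i j) => [ij|ji|/val_inj -> //].
    exact: (Hn (r j i true ij)).
  exact: (Hp (r i j true ji)).
have Qlr i j : Q (lshift k i) (rshift k j).
  case: (ltngtP i j) => [ij|ji|/val_inj ->].
  - by have := Hd _ _ (Hp (r j i false ij)); rewrite /= dual_lshift dual_rshift.
  - exact: (Hp (r i j false ji)).
  - by have := H0 (lshift k j); rewrite dual_lshift.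
have Qrl i j : Q (rshift k i) (lshift k j).
  case: (ltngtP i j) => [ij|ji|/val_inj ->].
  - exact: (Hn (r j i false ij)).
  - by have := Hd _ _ (Hn (r i j false ji)); rewrite /= dual_lshift dual_rshift.
  - by have := H0 (rshift k j); rewrite dual_rshift.
move=> a b; rewrite -(splitK a) -(splitK b).
case: (split a) => i; case: (split b) => j //=.
by have := Hd _ _ (Qll j i); rewrite !dual_lshift.
Qed.

(** The duality has as fixed points the pairs (a, a'), where f vanishes. Representatives of the
    other orbits are the diagonal pairs and, for each positive root, its pair in both orders. *)
Lemma sum_index_pair (R : nmodType) (f : 'I_(k + k) -> 'I_(k + k) -> R) :
  (forall a b, f (dual_index b) (dual_index a) = f a b) ->
  (forall a, f a (dual_index a) = 0) ->
  \sum_a \sum_b f a b = (\sum_i f (lshift k i) (lshift k i) +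
    \sum_(r : posroot k) (f (root_left r) (root_right r) +
                          f (root_right r) (root_left r))) *+ 2.
Proof.
move=> fd f0.
have frr i j : f (rshift k i) (rshift k j) = f (lshift k j) (lshift k i).
  by rewrite -fd !dual_rshift.
have flrC i j : f (lshift k i) (rshift k j) = f (lshift k j) (rshift k i).
  by rewrite -fd dual_rshift dual_lshift.
have frlC i j : f (rshift k i) (lshift k j) = f (rshift k j) (lshift k i).
  by rewrite -fd dual_rshift dual_lshift.
have flr0 i : f (lshift k i) (rshift k i) = 0 by rewrite -dual_lshift f0.
have frl0 i : f (rshift k i) (lshift k i) = 0 by rewrite -dual_rshift f0.
pose g i j := f (lshift k i) (lshift k j) + f (lshift k j) (lshift k i) +
   f (lshift k i) (rshift k j) + f (rshift k i) (lshift k j).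
have -> : \sum_a \sum_b f a b = \sum_i \sum_j g i j.
  rewrite big_split_ord /=; under eq_bigr do rewrite big_split_ord /=.
  under [X in _ + X]eq_bigr do rewrite big_split_ord /=.
  rewrite !big_split /= -!big_split /=.
  apply: eq_bigr => i _; rewrite -!big_split /=; apply: eq_bigr => j _.
  rewrite frr /g -!addrA; congr (_ + _); rewrite [RHS]addrCA; congr (_ + _).
  by rewrite addrC.
have gC i j : g i j = g j i.
  by rewrite /g [f (lshift k i) (rshift k j)]flrC frlC [_ _ (lshift k j) + _]addrC.
have gii i : g i i = f (lshift k i) (lshift k i) *+ 2.
  by rewrite /g flr0 frl0 !addr0 mulr2n.
have -> : \sum_i \sum_j g i j = \sum_i g i i + (\sum_(i < k) \sum_(j < k | (j < i)%N) g i j) *+ 2.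
  transitivity (\sum_(i < k) (g i i + (\sum_(j < k | (j < i)%N) g i j +
                                      \sum_(j < k | (i < j)%N) g i j))).
    apply: eq_bigr => i _; rewrite (bigD1 i) //= (bigID (fun j : 'I_k => (j < i)%N)) /=.
    congr (_ + (_ + _)); apply: eq_bigl => j; rewrite -val_eqE /=; lia.
  rewrite [LHS]big_split /= mulr2n; congr (_ + _).
  rewrite [LHS]big_split /=; congr (_ + _).
  rewrite (exchange_big_dep predT) //=; apply: eq_bigr => i _.
  by apply: eq_bigr => j _; rewrite gC.
under eq_bigr do rewrite gii.
rewrite sumrMnl -mulrnDl; congr ((_ + _) *+ 2).
under [RHS]eq_bigr do rewrite /root_left /root_right.
rewrite (posroot_sum (fun p =>
  f (lshift k p.1.1) (if p.2 then lshift k p.1.2 else rshift k p.1.2) +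
  f (if p.2 then lshift k p.1.2 else rshift k p.1.2) (lshift k p.1.1))).
apply: eq_bigr => i _; apply: eq_bigr => j ji /=; rewrite /g.
by rewrite -!addrA [f (rshift k j) _]frlC.
Qed.

(** For j < i the roots eps_i - eps_j and eps_i + eps_j add up to 2 eps_i, and there are i such
    j. *)
Lemma sum_posroot : \sum_(a : posroot k) root_of a = rho k *+ 2.
Proof.
apply/rowP => l; rewrite summxE.
transitivity (\sum_(a : posroot k) ((val a).1.1 == l)%:R +
   \sum_(a : posroot k) (-1) ^+ (val a).2 * ((val a).1.2 == l)%:R : rat).
  rewrite -big_split; apply: eq_bigr => a _; rewrite /root_of.
  by case: (val a) => [[i j] b]; rewrite !mxE /= ![l == _ :> nat]eq_sym.
have sgn0 : \sum_(a : posroot k) (-1) ^+ (val a).2 * ((val a).1.2 == l)%:R = 0 :> rat.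
  rewrite (posroot_sum (fun p => (-1) ^+ p.2 * (p.1.2 == l)%:R : rat)).
  rewrite big1 // => i _; rewrite big1 // => j _ /=.
  by rewrite expr1 expr0 -mulrDl addNr mul0r.
rewrite sgn0 addr0 (posroot_sum (fun p => (p.1.1 == l)%:R : rat)).
rewrite (bigD1 l) //= [X in _ + X]big1 ?addr0 => [|i /negPf il]; last first.
  by rewrite big1 // => j _; rewrite il addr0.
rewrite eqxx mulmxnE mxE -[RHS]mulr_natr mulr_natl -mulr2n sumr_const; congr (_ *+ _).
by rewrite -sum1_card (big_ord_narrow (ltnW (ltn_ord l))) sum1_card card_ord.
Qed.

End PositiveRoots.

(** * Weight bases of highest weight representations *)

Lemma dot_vec_weight k (a b : 'I_(k + k)) :
  dot (vec_weight a) (vec_weight b) = (a == b)%:R - (a == dual_index b)%:R.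
Proof.
rewrite -(splitK b); case: (split b) => j /=.
  by rewrite vec_weight_lshift dual_lshift dot_epsr vec_weightE.
by rewrite vec_weight_rshift dual_rshift dotNr dot_epsr vec_weightE opprB.
Qed.

Section Representation.
Variables (C : numClosedFieldType) (k d : nat).
Implicit Types (a b c e : 'I_(k + k)) (mu nu : 'rV[rat]_k).

(** The relations between the [so_elt], stated for arbitrary matrices: they survive a change of
    basis, and hold both for the [so_elt] and for their images in a module. *)
Record rep_axioms (P : 'I_(k + k) -> 'I_(k + k) -> 'M[C]_d) : Prop := RepAxioms {
  rep_dual : forall a b, P (dual_index b) (dual_index a) = - P a b;
  rep_bracket : forall a b c e, P a b *m P c e - P c e *m P a b =
    (b == c)%:R *: P a e - (a == e)%:R *: P c b
    - (b == dual_index e)%:R *: P a (dual_index c)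
    + (a == dual_index c)%:R *: P (dual_index e) b
}.

Variable P : 'I_(k + k) -> 'I_(k + k) -> 'M[C]_d.
Hypothesis repP : rep_axioms P.

Lemma rep0 a : P a (dual_index a) = 0.
Proof.
have /eqP := rep_dual repP a (dual_index a).
by rewrite dual_indexK -addr_eq0 -mulr2n -scaler_nat scaler_eq0 pnatr_eq0 => /eqP.
Qed.

Lemma rep_bracket_cartan c a b : P c c *m P a b - P a b *m P c c =
  ratr (dot (vec_weight a - vec_weight b) (vec_weight c)) *: P a b.
Proof.
rewrite rep_bracket // dotBl !dot_vec_weight !rmorphB /= !rmorph_nat.
have -> : (c == a)%:R *: P c b = (a == c)%:R *: P a b by case: eqVneq => [->|] //;
  rewrite !scale0r.
have -> : (c == b)%:R *: P a c = (b == c)%:R *: P a b by case: eqVneq => [->|] //;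
  rewrite !scale0r.
have -> : (c == dual_index b)%:R *: P c (dual_index a) = - ((b == dual_index c)%:R *: P a b).
  rewrite -dual_index_eq eq_sym [b == _]eq_sym dual_index_eq.
  by case: eqVneq => [->|]; rewrite ?scale0r ?oppr0 // !scale1r rep_dual.
have -> : (c == dual_index a)%:R *: P (dual_index b) c = - ((a == dual_index c)%:R *: P a b).
  rewrite -dual_index_eq eq_sym [a == _]eq_sym dual_index_eq.
  by case: eqVneq => [->|]; rewrite ?scale0r ?oppr0 // !scale1r rep_dual.
by apply/matrixP => i j; rewrite !mxE; ring.
Qed.

Lemma rep_bracket_opp a b : b != dual_index a ->
  P a b *m P b a - P b a *m P a b = P a a - P b b.
Proof.
move=> ba; rewrite rep_bracket // !eqxx !scale1r (negPf ba).
by rewrite eq_sym dual_index_eq (negPf ba) !scale0r subr0 addr0.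
Qed.

(** By duality each product occurs twice, so the eigenvalue for the highest weight la is twice the
    usual |la|^2 + 2 (la, rho). *)
Definition casimir : 'M[C]_d := \sum_a \sum_b P a b *m P b a.

Let sum_dual (f : 'I_(k + k) -> 'M[C]_d) : \sum_a f a = \sum_a f (dual_index a).
Proof. by rewrite (reindex_inj (inv_inj (@dual_indexK k))). Qed.

(** Bracketing with [P c e] is a derivation; the relations turn its action on each of the two
    factors into four single sums, and the two totals cancel. *)
Lemma casimir_comm c e : P c e *m casimir = casimir *m P c e.
Proof.
apply/eqP; rewrite -subr_eq0 /casimir mulmx_sumr mulmx_suml -sumrB.
pose B a b := P c e *m P a b - P a b *m P c e.
have S (f : 'I_(k + k) -> 'M[C]_d) i : \sum_j (j == i)%:R *: f j = f i.
  rewrite (bigD1 i) //= eqxx scale1r big1 ?addr0 // => j /negPf ->.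
  by rewrite scale0r.
have dualE a b : (a == dual_index b) = (b == dual_index a).
  by rewrite eq_sym dual_index_eq.
have -> : \sum_a (P c e *m (\sum_b P a b *m P b a) - (\sum_b P a b *m P b a) *m P c e) =
   \sum_a \sum_b B a b *m P b a + \sum_a \sum_b P a b *m B b a.
  rewrite -big_split; apply: eq_bigr => a _ /=; rewrite -big_split mulmx_sumr mulmx_suml -sumrB.
  apply: eq_bigr => b _; rewrite /B !(mulmxBl, mulmxBr) !mulmxA.
  by rewrite /= addrA subrK.
have -> : \sum_a \sum_b B a b *m P b a =
   \sum_b P c b *m P b e - \sum_a P a e *m P c a
   - \sum_a P c (dual_index a) *m P (dual_index e) a
   + \sum_b P (dual_index b) e *m P b (dual_index c).
  rewrite /B; under eq_bigr => a _ do under eq_bigr => b _ do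
    rewrite rep_bracket // !(mulmxDl, mulNmx) -!scalemxAl.
  under eq_bigr do rewrite !big_split /= !sumrN.
  rewrite !big_split /= !sumrN; congr (_ - _ - _ + _).
  - rewrite exchange_big /=; apply: eq_bigr => b _.
    by under eq_bigr do rewrite eq_sym; rewrite S.
  - by apply: eq_bigr => a _; under eq_bigr do rewrite eq_sym; rewrite S.
  - by apply: eq_bigr => a _; under eq_bigr do rewrite dualE; rewrite S.
  - rewrite exchange_big; apply: eq_bigr => b _ /=.
    by under eq_bigr do rewrite dualE; rewrite S.
have -> : \sum_a \sum_b P a b *m B b a =
   \sum_a P a e *m P c a - \sum_b P c b *m P b e
   - \sum_b P (dual_index e) b *m P c (dual_index b)
   + \sum_a P a (dual_index c) *m P (dual_index a) e.
  rewrite /B; under eq_bigr => a _ do under eq_bigr => b _ do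
    rewrite rep_bracket // !(mulmxDr, mulmxN) -!scalemxAr.
  under eq_bigr do rewrite !big_split /= !sumrN.
  rewrite !big_split /= !sumrN; congr (_ - _ - _ + _).
  - by apply: eq_bigr => a _; under eq_bigr do rewrite eq_sym; rewrite S.
  - rewrite exchange_big; apply: eq_bigr => b _ /=.
    by under eq_bigr do rewrite eq_sym; rewrite S.
  - rewrite exchange_big; apply: eq_bigr => b _ /=.
    by under eq_bigr do rewrite dualE; rewrite S.
  - by apply: eq_bigr => a _; under eq_bigr do rewrite dualE; rewrite S.
(* Duality identifies the remaining sums, up to sign, with the two that are named [x] and [y] at the
   end; the totals become 2(x - y) and 2(y - x). *)
have E1 : \sum_a P c (dual_index a) *m P (dual_index e) a = - \sum_b P c b *m P b e.
  rewrite [in RHS]sum_dual -sumrN; apply: eq_bigr => a _.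
  by rewrite -{2}(dual_indexK a) rep_dual // mulmxN.
have E2 : \sum_b P (dual_index b) e *m P b (dual_index c) = - \sum_a P a e *m P c a.
  rewrite [in RHS]sum_dual -sumrN; apply: eq_bigr => a _.
  by rewrite -{2}(dual_indexK a) rep_dual // mulmxN.
have E3 : \sum_b P (dual_index e) b *m P c (dual_index b) = - \sum_a P a e *m P c a.
  rewrite [in RHS]sum_dual -sumrN; apply: eq_bigr => a _.
  by rewrite -{1}(dual_indexK a) rep_dual // mulNmx.
have E4 : \sum_a P a (dual_index c) *m P (dual_index a) e = - \sum_b P c b *m P b e.
  rewrite [in RHS]sum_dual -sumrN; apply: eq_bigr => a _.
  by rewrite -{1}(dual_indexK a) rep_dual // mulNmx.
rewrite E1 E2 E3 E4; set x := \sum_b _; set y := \sum_a _.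
by apply/eqP/matrixP => i j; rewrite !mxE; ring.
Qed.

End Representation.

Section PosCone.
Variable k : nat.
Implicit Types be : 'rV[rat]_k.

Definition pos_cone be := exists s : seq (posroot k), be = \sum_(a <- s) root_of a.

Lemma pos_cone_dot_ge0 be nu : (forall a : posroot k, 0 <= dot nu (root_of a)) ->
  pos_cone be -> 0 <= dot be nu.
Proof.
by move=> H [s ->]; rewrite dot_suml sumr_ge0 // => a _; rewrite dotC.
Qed.

(** Every root has a positive product with nu, so only the empty list of roots has product 0. *)
Lemma pos_cone_eq0 be nu : strictly_dominant nu -> pos_cone be -> dot be nu = 0 -> be = 0.
Proof.
move=> H [s ->]; case: s => [|a s]; first by rewrite big_nil.
rewrite big_cons dotDl => e; suff : 0 < dot (root_of a) nu + dot (\sum_(j <- s) root_of j) nu by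
  rewrite e ltxx.
rewrite ltr_wpDr 1?dotC //.
by rewrite dotC; apply: pos_cone_dot_ge0; [move=> b; apply: ltW | exists s].
Qed.

Lemma pos_coneD be be' : pos_cone be -> pos_cone be' -> pos_cone (be + be').
Proof. by move=> [s ->] [s' ->]; exists (s ++ s'); rewrite big_cat. Qed.

Lemma pos_cone0 : pos_cone 0.
Proof. by exists [::]; rewrite big_nil. Qed.

Lemma pos_cone_root a : pos_cone (root_of a).
Proof. by exists [:: a]; rewrite big_seq1. Qed.

Lemma pos_cone_add_eq0 be be' : pos_cone be -> pos_cone be' -> be + be' = 0 -> be = 0.
Proof.
move=> H H' e; apply: (@pos_cone_eq0 _ (rho k)) => //; first exact: dot_rho.
have rho_ge0 a : 0 <= dot (rho k) (root_of a) by apply/ltW/dot_rho.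
have := pos_cone_dot_ge0 rho_ge0 H; have := pos_cone_dot_ge0 rho_ge0 H'.
have /(congr1 (fun v => dot v (rho k))) := e; rewrite dotDl dot0l; lra.
Qed.

End PosCone.

Section HighestWeight.
Variables (C : numClosedFieldType) (k d : nat).
Implicit Types (a b c e : 'I_(k + k)) (mu nu : 'rV[rat]_k) (u : 'cV[C]_d).

Variable P : 'I_(k + k) -> 'I_(k + k) -> 'M[C]_d.
Hypothesis repP : rep_axioms P.

Definition weight_vector u mu :=
  forall c, P c c *m u = ratr (dot mu (vec_weight c)) *: u.

Lemma weight_vectorM u mu a b : weight_vector u mu ->
  weight_vector (P a b *m u) (mu + (vec_weight a - vec_weight b)).
Proof.
move=> H c; rewrite mulmxA -[P c c *m _](subrK (P a b *m P c c)).
rewrite rep_bracket_cartan // mulmxDl -mulmxA H -scalemxAl -scalemxAr -scalerDl.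
by rewrite -rmorphD /= -dotDl [X in dot X _]addrC.
Qed.

Lemma weight_vector_inj u mu nu : u != 0 ->
  weight_vector u mu -> weight_vector u nu -> mu = nu.
Proof.
move=> u0 Hmu Hnu; apply/rowP => i.
have := Hmu (lshift k i); rewrite Hnu => /eqP.
rewrite -subr_eq0 -scalerBl scaler_eq0 (negPf u0) orbF subr_eq0.
by move/eqP/fmorph_inj; rewrite vec_weight_lshift !dot_epsr.
Qed.

Variables (la : 'rV[rat]_k) (v : 'cV[C]_d).
Hypothesis v_neq0 : v != 0.
Hypothesis v_wt : weight_vector v la.
Hypothesis v_pos : forall r : posroot k, P (root_left r) (root_right r) *m v = 0.

(** Vectors obtained from [v] by words in the negative root vectors. The weight is an index,
    computed along the word, because the vector may be 0 and then determines none. *)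
Inductive lowered : 'cV[C]_d -> 'rV[rat]_k -> Prop :=
| lowered_hw : lowered v la
| lowered_step r u mu : lowered u mu ->
    lowered (P (root_right r) (root_left r) *m u) (mu - root_of r).

Lemma lowered_weight u mu : lowered u mu -> weight_vector u mu.
Proof.
elim=> [//|r {}u {}mu _ IH].
by rewrite root_of_vec_weight opprB; apply: weight_vectorM.
Qed.

Lemma lowered_pos_cone u mu : lowered u mu -> pos_cone (la - mu).
Proof.
elim=> [|r {}u {}mu _ IH]; first by rewrite subrr; apply: pos_cone0.
by rewrite opprB addrCA addrC; apply: pos_coneD => //; apply: pos_cone_root.
Qed.

Lemma lowered_eq_hw u mu : lowered u mu -> mu = la -> u = v.
Proof.
case=> // r u' mu' H' e.
have sum0 : root_of r + (la - mu') = 0.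
  by rewrite -e; apply/rowP => i; rewrite !mxE; ring.
have r0 := pos_cone_add_eq0 (pos_cone_root r) (lowered_pos_cone H') sum0.
by have := dot_rho r; rewrite r0 dotC dot0l ltxx.
Qed.

(** Positive root vectors kill [v], so of the two products for a root r one vanishes and the other
    reduces to a commutator, acting by (la, r); the positive roots sum up to 2 rho. *)
Lemma casimir_hw : casimir P *m v = ratr ((dot la la + 2 * dot la (rho k)) * 2) *: v.
Proof.
rewrite /casimir mulmx_suml; under eq_bigr do rewrite mulmx_suml.
rewrite (@sum_index_pair _ _ (fun a b => P a b *m P b a *m v)); last 2 first.
- by move=> a b; rewrite !rep_dual // mulNmx mulmxN opprK.
- by move=> a; rewrite rep0 // !mul0mx.
rewrite -scaler_nat [RHS](_ : _ = 2 *: (ratr (dot la la + 2 * dot la (rho k)) *: v)); last first.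
  by rewrite scalerA mulrC rmorphM /= rmorph_nat.
congr (_ *: _); rewrite rmorphD scalerDl; congr (_ + _).
  rewrite /dot rmorph_sum scaler_suml; apply: eq_bigr => i _.
  rewrite -mulmxA v_wt -scalemxAr v_wt scalerA -rmorphM /=.
  by rewrite vec_weight_lshift dot_epsr.
have -> : 2 * dot la (rho k) = \sum_(a : posroot k) dot la (root_of a).
  by rewrite -dotZr scaler_nat -sum_posroot dotC dot_suml; apply: eq_bigr => a _; rewrite dotC.
rewrite rmorph_sum scaler_suml; apply: eq_bigr => r _ /=.
rewrite -[X in _ + X]mulmxA v_pos mulmx0 addr0.
rewrite -[P _ _ *m P _ _](subrK (P (root_right r) (root_left r) *m P (root_left r) (root_right
  r))).
rewrite rep_bracket_opp //; last by rewrite eq_sym dual_index_eq root_left_neq_dual.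
rewrite mulmxDl -[X in _ + X]mulmxA v_pos mulmx0 addr0 mulmxBl !v_wt -scalerBl -rmorphB /=.
by rewrite -dotBr root_of_vec_weight.
Qed.

Lemma casimir_lowered u mu : lowered u mu ->
  casimir P *m u = ratr ((dot la la + 2 * dot la (rho k)) * 2) *: u.
Proof.
elim=> [|r {}u {}mu _ IH]; first exact: casimir_hw.
by rewrite mulmxA -casimir_comm // -mulmxA IH -scalemxAr.
Qed.

Hypothesis irr : forall U : {vspace 'cV[C]_d},
  (forall a b u, u \in U -> P a b *m u \in U) -> U = 0%VS \/ U = fullv.

Definition lowered_family (s : seq ('cV[C]_d * 'rV[rat]_k)) :=
  [/\ free (map fst s), v \in map fst s & forall x, x \in s -> lowered x.1 x.2].

(** The size of an independent family is bounded by the dimension, so adding lowered vectors outside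
    the span must stop; [m] bounds the room that is left. *)
Lemma exists_maximal_lowered_family : exists2 s, lowered_family s &
  forall u mu, lowered u mu -> u \in <<map fst s>>%VS.
Proof.
have bound s : lowered_family s -> (size s <= \dim {: 'cV[C]_d})%N.
  by case=> /eqP + _ _; rewrite size_map => <-; apply/dimvS/subvf.
have start : lowered_family [:: (v, la)].
  split; rewrite ?inE //= ?seq1_free // => x.
  by rewrite inE => /eqP ->; apply: lowered_hw.
suff H m s : lowered_family s -> (\dim {: 'cV[C]_d} - size s < m)%N ->
    exists2 s, lowered_family s & forall u mu, lowered u mu -> u \in <<map fst s>>%VS.
  exact: H start (ltnSn _).
elim: m s => [//|m IHm] s Hs le_m.
case: (classic (forall u mu, lowered u mu -> u \in <<map fst s>>%VS)) => [H|].
  by exists s.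
move=> /not_all_ex_not[u] /not_all_ex_not[mu] H.
have {H} [Hu us] : lowered u mu /\ u \notin <<map fst s>>%VS.
  by split; [apply: NNPP => H'; apply: H => /H' | apply/negP => us; apply: H].
have Hs' : lowered_family ((u, mu) :: s).
  case: Hs => fs vs ls; split; rewrite /= ?free_cons ?us ?inE ?vs ?orbT //.
  by move=> x; rewrite inE => /orP[/eqP ->|/ls].
have le_s := bound _ Hs'; apply: IHm Hs' _; move: le_m le_s => /=; lia.
Qed.

Lemma memv_span_stable (s : seq ('cV[C]_d)) (A : 'M[C]_d) (U : {vspace 'cV[C]_d}) :
  (forall u, u \in s -> A *m u \in U) -> forall u, u \in <<s>>%VS -> A *m u \in U.
Proof.
move=> H u /(@coord_span _ _ _ (in_tuple s)) ->.
rewrite mulmx_sumr memv_suml // => i _; rewrite -scalemxAr memvZ //.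
by apply: H; apply: mem_nth.
Qed.

(** The span is stable under every [P a b]: moving [P a b] past a lowering operator leaves a
    commutator, which is a combination of such operators applied to a shorter word. It contains [v],
    hence is everything by irreducibility. *)
Lemma lowered_span (s : seq ('cV[C]_d * 'rV[rat]_k)) : lowered_family s ->
  (forall u mu, lowered u mu -> u \in <<map fst s>>%VS) -> <<map fst s>>%VS = fullv.
Proof.
move=> [fs vs ls] H; set U := <<_>>%VS.
have Uf r u : u \in U -> P (root_right r) (root_left r) *m u \in U.
  apply: memv_span_stable => _ /mapP[[x mu] /ls/= Hx ->].
  exact: H (lowered_step r Hx).
have Ulow u mu : lowered u mu -> forall a b, P a b *m u \in U.
  elim=> [|r {}u {}mu Hu IH] a b.
    move: a b; apply: index_pair_ind => [a b|a|a|r|r].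
    - by rewrite rep_dual // mulNmx rpredN.
    - by rewrite rep0 // mul0mx mem0v.
    - by rewrite v_wt memvZ // (H _ _ lowered_hw).
    - by rewrite v_pos mem0v.
    - exact: H (lowered_step r lowered_hw).
  rewrite mulmxA -[P a b *m _](subrK (P (root_right r) (root_left r) *m P a b)).
  rewrite mulmxDl -mulmxA rpredD ?Uf // rep_bracket //.
  by rewrite !(mulmxDl, mulNmx) -!scalemxAl !(rpredD, rpredB, rpredN) // memvZ.
case: (irr (U := U)) => // [a b u|U0].
  by apply: memv_span_stable => _ /mapP[[x mu] /ls/= /Ulow Hx ->].
by case/negP: v_neq0; rewrite -memv0 -U0 (H _ _ lowered_hw).
Qed.

(** A maximal independent family of lowered vectors is a basis. Its weights are la minus sums of
    positive roots, and only the empty word has weight la, so la occurs once. *)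
Lemma weight_basis : exists n (wt : 'I_n -> 'rV[rat]_k) (B : 'M[C]_(d, n)) (E : 'M[C]_(n, d)),
  [/\ B *m E = 1%:M, E *m B = 1%:M,
      forall c, P c c *m B = B *m diag_mx (\row_j ratr (dot (wt j) (vec_weight c))),
      casimir P *m B = ratr ((dot la la + 2 * dot la (rho k)) * 2) *: B &
      (forall j, pos_cone (la - wt j)) /\ #|[set j | wt j == la]| = 1%N].
Proof.
have [s Hs Hspan] := exists_maximal_lowered_family.
have full := lowered_span Hs Hspan; case: Hs => fs vs ls.
pose X := in_tuple (map fst s).
pose x0 : 'cV[C]_d * 'rV[rat]_k := (0, 0).
have sz : size (map fst s) = size s by rewrite size_map.
pose wt (j : 'I_(size (map fst s))) := (nth x0 s j).2.
pose B := \matrix_(i < d, j < size (map fst s)) (X`_j i 0).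
pose E := \matrix_(j < size (map fst s), i < d) coord X j (delta_mx i 0).
have nthX (j : 'I_(size (map fst s))) : X`_j = (nth x0 s j).1.
  by rewrite (nth_map x0) // -sz.
have colB j : col j B = X`_j by apply/colP => i; rewrite !mxE.
have lowX (j : 'I_(size (map fst s))) : lowered X`_j (wt j).
  by rewrite nthX; apply: ls; apply: mem_nth; rewrite -sz.
have eq_cols (A A' : 'M[C]_(d, size (map fst s))) : (forall j, col j A = col j A') -> A = A'.
  by move=> H; apply/matrixP => i j; have /colP/(_ i) := H j; rewrite !mxE.
exists (size (map fst s)), wt, B, E; split.
- apply/matrixP => i j; rewrite !mxE.
  have : delta_mx j 0 = \sum_l coord X l (delta_mx j 0) *: X`_l :> 'cV[C]_d.
    by apply: coord_span; rewrite full memvf.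
  move=> /matrixP/(_ i 0); rewrite !mxE eqxx andbT summxE => ->.
  by apply: eq_bigr => l _; rewrite !mxE mulrC.
- apply/matrixP => i j; rewrite !mxE.
  have -> : (i == j)%:R = coord X i X`_j by rewrite coord_free // eq_sym.
  rewrite -colB [in RHS](matrix_sum_delta (col j B)) linear_sum; apply: eq_bigr => l _ /=.
  by rewrite big_ord1 linearZ /= !mxE mulrC.
- move=> c; apply: eq_cols => j; rewrite colE -mulmxA -colE colB.
  rewrite (lowered_weight (lowX j)); apply/colP => i.
  by rewrite mul_mx_diag !mxE mulrC.
- apply: eq_cols => j; rewrite colE -mulmxA -colE colB (casimir_lowered (lowX j)).
  by apply/colP => i; rewrite !mxE.
split=> [j|]; first exact: lowered_pos_cone (lowX j).
have iv : (index v (map fst s) < size (map fst s))%N by rewrite index_mem.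
pose j0 := Ordinal iv; have Xj0 : X`_j0 = v by rewrite nth_index.
apply/eqP/cards1P; exists j0; apply/setP => j; rewrite !inE.
have low0 : lowered v (wt j0) by rewrite -{1}Xj0.
apply/eqP/eqP => [/(lowered_eq_hw (lowX j)) Xj|->].
  apply: val_inj; apply/eqP => /=.
  by rewrite -(nth_uniq 0 _ _ (free_uniq fs)) ?ltn_ord // -/(X`_j) Xj -{1}Xj0.
exact: weight_vector_inj v_neq0 (lowered_weight low0) v_wt.
Qed.

End HighestWeight.

(** * Weyl group invariance of the weights *)

Lemma count_codom (I : finType) (T : Type) (f : I -> T) (q : pred T) :
  count q (codom f) = #|[pred i | q (f i)]|.
Proof.
rewrite /codom /image_mem count_map -size_filter cardE /enum_mem -filter_predI.
by congr size; apply: eq_filter => i; rewrite /= andbT.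
Qed.

Lemma perm_eq_codom (I J : finType) (T : eqType) (f : I -> T) (g : J -> T) :
  (forall x, #|[pred i | f i == x]| = #|[pred j | g j == x]|) ->
  perm_eq (codom f) (codom g).
Proof.
by move=> H; apply/allP => x _ /=; rewrite !count_codom H.
Qed.

Lemma perm_eq_codom_sum (I J : finType) (T : eqType) (M : nmodType)
    (phi : T -> M) (f : I -> T) (g : J -> T) :
  perm_eq (codom f) (codom g) -> \sum_i phi (f i) = \sum_j phi (g j).
Proof.
have S (K : finType) (h : K -> T) : \sum_i phi (h i) = \sum_(x <- codom h) phi x.
  by rewrite big_image.
by move=> fg; rewrite !S; apply: perm_big.
Qed.

Section SL2.
Variables (C : numClosedFieldType) (n : nat) (e f h : 'M[C]_n).
Hypothesis ef : e *m f - f *m e = h.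
Hypothesis hf : h *m f - f *m h = - 2 *: f.
Hypothesis he : h *m e - e *m h = 2 *: e.
Implicit Types u : 'cV[C]_n.

Local Notation "f ^^ m" := (iter m (mulmx f)) (at level 20).

Lemma sl2_h_lower u (c : C) m : h *m u = c *: u -> h *m (f ^^ m) u = (c - m%:R *+ 2) *: (f ^^ m)
  u.
Proof.
move=> hu; elim: m => [|m IHm]; first by rewrite mul0rn subr0.
rewrite iterS mulmxA -[h *m f](subrK (f *m h)) hf mulmxDl -mulmxA IHm -scalemxAr.
by rewrite -scalemxAl -scalerDl; congr (_ *: _); rewrite -natr1; ring.
Qed.

Lemma sl2_raise_lower u (c : C) m : h *m u = c *: u ->
  e *m (f ^^ m.+1) u = (f ^^ m.+1) (e *m u) + (m.+1%:R * (c - m%:R)) *: (f ^^ m) u.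
Proof.
move=> hu; elim: m => [|m IHm].
  by rewrite /= !mulmxA -{1}[e *m f](subrK (f *m e)) ef mulmxDl hu addrC subr0 mul1r.
rewrite iterS mulmxA -[e *m f](subrK (f *m e)) ef mulmxDl (sl2_h_lower _ hu).
rewrite -mulmxA IHm mulmxDr -!iterS addrCA; congr (_ + _).
rewrite -scalemxAr -iterS -scalerDl; congr (_ *: _); rewrite -!natr1; ring.
Qed.

Lemma iter_mulmx0 (A : 'M[C]_n) m : (A ^^ m) 0 = 0 :> 'cV_n.
Proof. by elim: m => //= m ->; rewrite mulmx0. Qed.

(* [e *m u] is killed by [f ^+ (m + 2)], hence vanishes by induction on the nilpotency
   order [p] of [e]; then [e] maps [f ^+ l.+1 u] to a nonzero multiple of [f ^+ l u]
   for [l < m]. *)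
Lemma sl2_lower_inj p m u : (e ^^ p) u = 0 -> h *m u = m%:R *: u -> (f ^^ m) u = 0 -> u = 0.
Proof.
elim: p m u => [//|p IHp] m u eu hu fu.
have eu0 : e *m u = 0.
  apply: (IHp m.+2); first by rewrite -iterSr.
    rewrite mulmxA -[h *m e](subrK (e *m h)) he mulmxDl -mulmxA hu -scalemxAr.
    by rewrite -scalemxAl -scalerDl; congr (_ *: _); rewrite -!natr1; ring.
  have := sl2_raise_lower m.+1 hu.
  rewrite !(iterS _ _ u) fu !mulmx0 scaler0 addr0.
  by move=> <-.
have H l : (l <= m)%N -> (f ^^ l) u = 0 -> u = 0.
  elim: l => [//|l IHl] lm fl0; apply: IHl; first exact: ltnW.
  have := sl2_raise_lower l hu; rewrite fl0 eu0 mulmx0 iter_mulmx0 add0r => /esym/eqP.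
  rewrite scaler_eq0 mulf_eq0 pnatr_eq0 /= subr_eq0 eqr_nat gtn_eqF //=.
  by move/eqP.
exact: H (leqnn m) fu.
Qed.

End SL2.

Section DiagonalRepresentation.
Variables (C : numClosedFieldType) (k n : nat).
Variable P : 'I_(k + k) -> 'I_(k + k) -> 'M[C]_n.
Hypothesis repP : rep_axioms P.
Variable wt : 'I_n -> 'rV[rat]_k.
Hypothesis P_diag : forall c, P c c = diag_mx (\row_j ratr (dot (wt j) (vec_weight c))).
Implicit Types (a b c : 'I_(k + k)) (mu nu : 'rV[rat]_k).

(** Compare the entries (i, j) in the commutation of [P a b] with the diagonal [P c c]. *)
Lemma diag_rep_entry a b i j : P a b i j != 0 ->
  wt i = wt j + (vec_weight a - vec_weight b).
Proof.
move=> Pij; apply/rowP => l.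
have := congr1 (fun A : 'M_n => A i j) (rep_bracket_cartan repP (lshift k l) a b).
rewrite P_diag mul_diag_mx mul_mx_diag !mxE => /eqP.
rewrite [_ * P a b i j]mulrC -mulrBr [_ * P a b i j]mulrC (inj_eq (mulfI Pij)).
rewrite -rmorphB /= (fmorph_eq) => /eqP.
by rewrite vec_weight_lshift !dot_epsr !mxE => <-; rewrite addrC subrK.
Qed.

Section Reflection.
Variables a b : 'I_(k + k).
Hypotheses (ab : (a == b) = false) (ab' : (a == dual_index b) = false).
Let al := vec_weight a - vec_weight b.

Lemma dot_al_al : dot al al = 2.
Proof.
have neq_dual c : (c == dual_index c) = false by rewrite eq_sym dual_index_neq.
have ba : (b == a) = false by rewrite eq_sym.
have ba' : (b == dual_index a) = false by rewrite -dual_index_eq eq_sym.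
by rewrite /al !(dotBl, dotBr) !dot_vec_weight !eqxx !neq_dual ab ab' ba ba'.
Qed.

Let e := P a b.
Let f := P b a.
Let h := P a a - P b b.

Let ef : e *m f - f *m e = h.
Proof. by apply: rep_bracket_opp => //; rewrite eq_sym dual_index_eq ab'. Qed.

Let h_comm c c' : h *m P c c' - P c c' *m h =
  ratr (dot (vec_weight c - vec_weight c') al) *: P c c'.
Proof.
rewrite dotBr rmorphB scalerBl -!rep_bracket_cartan // mulmxBl mulmxBr.
by apply/matrixP => i j; rewrite !mxE; ring.
Qed.

Let he : h *m e - e *m h = 2 *: e.
Proof. by rewrite h_comm dot_al_al rmorph_nat. Qed.

Let hf : h *m f - f *m h = - 2 *: f.
Proof. by rewrite h_comm -opprB dotNl dot_al_al rmorphN rmorph_nat. Qed.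

Lemma h_entry i j : h i j = ratr (dot (wt i) al) *+ (i == j).
Proof.
rewrite /h !P_diag !mxE -mulrnBl -rmorphB -dotBr; case: eqP => [->|] //.
Qed.

Lemma power_entry_shift c c' (m : nat) i j :
  iter m (mulmx (P c c')) 1%:M i j != 0 ->
  wt i = wt j + m%:R *: (vec_weight c - vec_weight c').
Proof.
elim: m i => [|m IHm] i /=.
  by rewrite scale0r addr0 mxE; case: (i =P j) => [->|_] //; rewrite eqxx.
rewrite mxE => sum_neq0.
have /existsP[l] : [exists l, P c c' i l * iter m (mulmx (P c c')) 1%:M l j != 0].
  apply: contraR sum_neq0 => /existsPn H; rewrite big1 // => l _.
  by apply/eqP; have := H l; rewrite negbK.
rewrite mulf_eq0 negb_or => /andP[/diag_rep_entry -> /IHm ->].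
by rewrite -addrA -natr1 scalerDl scale1r.
Qed.

Lemma iter_mulmx1 (A : 'M[C]_n) m (u : 'cV[C]_n) :
  iter m (mulmx A) u = iter m (mulmx A) 1%:M *m u.
Proof. by elim: m => [|m IHm] /=; rewrite ?mul1mx // -mulmxA -IHm. Qed.

(** [e] raises the product with the root by 2, while these products are bounded on the finitely many
    weights. *)
Lemma power_nilpotent : exists p, iter p (mulmx e) 1%:M = 0.
Proof.
pose x i := dot (wt i) al.
exists (\sum_i Num.bound `|x i|).+1; apply/matrixP => i j; rewrite [RHS]mxE.
apply/eqP; apply: contraT => /power_entry_shift/(congr1 (fun be => dot be al)).
set N := (\sum_i _)%N; rewrite dotDl dotZl dot_al_al -/(x i) -/(x j) => xE.
have bnd l : `|x l| < N%:R.
  apply: lt_le_trans (archi_boundP _) _ => //.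
  by rewrite ler_nat /N (bigD1 l) //= leq_addr.
have := bnd i; have := bnd j; rewrite !ltr_norml xE -natr1.
by move=> /andP[? ?] /andP[? ?]; lra.
Qed.

(** By [sl2_lower_inj], f^m is injective on the weight space of mu, and it lands in the weight mu -
    m al. [B] is the transpose of the block of f^m between the two spaces, so independence of its
    rows bounds their number. *)
Lemma wt_mult_le mu (m : nat) : dot mu al = m%:R ->
  (#|[pred i | wt i == mu]| <= #|[pred i | wt i == (mu - m%:R *: al)%R]|)%N.
Proof.
move=> mu_al; set I := [pred i | wt i == mu]; set J := [pred i | wt i == _].
pose N := iter m (mulmx f) 1%:M.
pose B := \matrix_(i < #|I|, j < #|J|) N (enum_val j) (enum_val i).
suff : row_free B by move=> /eqP <-; apply: rank_leq_col.
apply: inj_row_free => x xB.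
(* The vector of weight mu with coordinates [x]; the rows of f^m u outside [J] vanish because of
   their weight. *)
pose u : 'cV[C]_n := \sum_(i < #|I|) x 0 i *: delta_mx (enum_val i) 0.
have uE i : u (enum_val i) 0 = x 0 i.
  rewrite /u summxE (bigD1 i) //= big1 => [|j ji]; first by rewrite !mxE !eqxx mulr1 addr0.
  by rewrite !mxE (inj_eq enum_val_inj) eq_sym (negPf ji) mulr0.
suff u0 : u = 0 by apply/rowP => i; rewrite -uE u0 !mxE.
have [p ep] := power_nilpotent.
apply: (sl2_lower_inj ef hf he (p := p) (m := m)).
- by rewrite iter_mulmx1 ep mul0mx.
- rewrite /u mulmx_sumr scaler_sumr; apply: eq_bigr => i _.
  rewrite -scalemxAr scalerA [_%:R * _]mulrC -scalerA; congr (_ *: _).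
  apply/colP => l; rewrite -colE [LHS]mxE h_entry !mxE eqxx andbT.
  case: eqP => [->|_]; last by rewrite mulr0.
  have /eqP -> : wt (enum_val i) == mu by have := enum_valP i.
  by rewrite mulr1 mu_al rmorph_nat.
rewrite iter_mulmx1 -/N; apply/colP => l; rewrite [RHS]mxE.
have NuE : (N *m u) l 0 = \sum_i x 0 i * N l (enum_val i).
  rewrite /u mulmx_sumr summxE; apply: eq_bigr => i _.
  by rewrite -scalemxAr -colE !mxE.
rewrite NuE; case: (boolP (l \in J)) => [lJ|lJ].
  have /rowP/(_ (enum_rank_in lJ l)) := xB; rewrite !mxE => xBl; rewrite -[RHS]xBl.
  by apply: eq_bigr => i _; rewrite mxE enum_rankK_in.
rewrite big1 // => i _; apply/eqP; rewrite mulf_eq0; apply/orP; right.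
apply: contraR lJ => /power_entry_shift wtl.
have /eqP wti : wt (enum_val i) == mu by have := enum_valP i.
by rewrite inE /= wtl wti -[vec_weight b - _]opprB scalerN.
Qed.
End Reflection.

(** The number of lowering steps is the product of mu with the root; if it is negative, the opposite
    root is used, by exchanging the two indices. *)
Lemma wt_refl_le (r : posroot k) mu : dot mu (root_of r) \is a Num.int ->
  (#|[pred i | wt i == mu]| <= #|[pred i | wt i == wact (wrefl r) mu]|)%N.
Proof.
move=> /intrP[m mE]; rewrite wact_wrefl mE.
have lr := root_left_neq_right r; have lr' := root_left_neq_dual r.
case: m mE => m mE.
  have := @wt_mult_le (root_left r) (root_right r) lr lr' mu m.
  by rewrite -root_of_vec_weight; apply.
have rl : (root_right r == root_left r) = false by rewrite eq_sym.
have rl' : (root_right r == dual_index (root_left r)) = false by rewrite -dual_index_eq eq_sym.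
have := @wt_mult_le _ _ rl rl' mu m.+1; rewrite -opprB -root_of_vec_weight dotNr mE.
by rewrite NegzE mulrNz opprK scalerN scaleNr; apply.
Qed.

Hypothesis wt_int : forall i (r : posroot k), dot (wt i) (root_of r) \is a Num.int.

(** The inequality holds at mu and at its reflection, so the multiplicities are equal. *)
Lemma wt_wrefl (r : posroot k) : perm_eq (codom wt) (codom (fun i => wact (wrefl r) (wt i))).
Proof.
have le mu : (#|[pred i | wt i == mu]| <= #|[pred i | wt i == wact (wrefl r) mu]|)%N.
  case: (posnP #|[pred i | wt i == mu]|) => [-> //|/card_gt0P[i]].
  by rewrite inE => /eqP <-; apply: wt_refl_le.
apply: perm_eq_codom => mu; apply/eqP; rewrite eqn_leq.
have -> : #|[pred i | wact (wrefl r) (wt i) == mu]| = #|[pred i | wt i == wact (wrefl r) mu]|.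
  by apply: eq_card => i; rewrite !inE wact_eqV winv_wrefl.
by rewrite le /=; apply: leq_trans (le _) _; rewrite wrefl_invol.
Qed.

Lemma wt_wact (w : weyl k) : (1 < k)%N -> perm_eq (codom wt) (codom (fun i => wact w (wt i))).
Proof.
move=> k1; elim/(weyl_ind k1): w => [|r w IH].
  by apply: perm_eq_codom => mu; apply: eq_card => i; rewrite !inE wact_wone.
have -> : codom (fun i => wact (wmul (wrefl r) w) (wt i)) = map (wact (wrefl r)) (codom (fun i
  => wact w (wt i))).
  by rewrite /codom /image_mem -map_comp; apply: eq_map => i /=; rewrite wact_wmul.
apply: perm_trans (wt_wrefl r) _.
have -> : codom (fun i => wact (wrefl r) (wt i)) = map (wact (wrefl r)) (codom wt).
  by rewrite /codom /image_mem -map_comp.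
exact: perm_map.
Qed.

End DiagonalRepresentation.

(** * The Weyl character formula *)

Lemma sum_set_split (I : finType) (R : nmodType) (x : I) (F : {set I} -> R) :
  \sum_S F S = \sum_(S : {set I} | x \notin S) (F S + F (x |: S)).
Proof.
rewrite (bigID (fun S : {set I} => x \notin S)) /= big_split /=; congr (_ + _).
rewrite (reindex_onto (fun S => x |: S) (fun S => S :\ x)) /=; last first.
  by move=> S; rewrite negbK => /setD1K.
apply: eq_bigl => S; rewrite negbK setU11 /=.
apply/eqP/idP => [<-|xS]; first by rewrite !inE eqxx.
by rewrite setU1K.
Qed.

Section Freudenthal.
Variables (C : numClosedFieldType) (k n : nat).
Variable P : 'I_(k + k) -> 'I_(k + k) -> 'M[C]_n.
Hypothesis repP : rep_axioms P.
Variable wt : 'I_n -> 'rV[rat]_k.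
Hypothesis P_diag : forall c, P c c = diag_mx (\row_j ratr (dot (wt j) (vec_weight c))).
Implicit Types (a b c : 'I_(k + k)) (mu nu be : 'rV[rat]_k) (phi : 'rV[rat]_k -> C).

(* [T a b phi] is the trace of [P a b *m P b a] against [phi] of the weight. The
   cyclicity of the trace compares it with itself shifted by the root. *)
Let T a b phi := \sum_i phi (wt i) * (P a b *m P b a) i i.
Let chi r phi := \sum_i ratr (dot (wt i) (root_of r)) * phi (wt i).

Let Tshift a b phi :
  T a b phi = T b a (fun be => phi (be + (vec_weight a - vec_weight b))).
Proof.
rewrite /T; under eq_bigr => i _ do rewrite mxE mulr_sumr.
under [RHS]eq_bigr => i _ do rewrite mxE mulr_sumr.
rewrite exchange_big /=; apply: eq_bigr => j _; apply: eq_bigr => i _.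
case: (eqVneq (P a b i j) 0) => [->|/(diag_rep_entry repP P_diag) ->].
  by rewrite !(mul0r, mulr0).
by congr (_ * _); rewrite mulrC.
Qed.

Let Tcomm r phi : T (root_right r) (root_left r) phi =
  T (root_left r) (root_right r) phi - chi r phi.
Proof.
rewrite /T /chi -sumrB; apply: eq_bigr => i _.
rewrite -[P (root_right r) _ *m _](subKr (P (root_left r) (root_right r) *m P (root_right r)
  (root_left r))).
rewrite rep_bracket_opp //; last by rewrite eq_sym dual_index_eq root_left_neq_dual.
rewrite !P_diag !mxE eqxx mulrBr [in X in _ - X]mulrC; congr (_ - _ * _).
by rewrite root_of_vec_weight dotBr rmorphB.
Qed.

Let T_root r phi : T (root_left r) (root_right r) phi =
  T (root_left r) (root_right r) (fun be => phi (be + root_of r)) -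
  chi r (fun be => phi (be + root_of r)).
Proof. by rewrite Tshift -root_of_vec_weight Tcomm. Qed.

Variable kappa : C.
Hypothesis P_casimir : casimir P = (kappa *+ 2)%:M.

(** The trace is computed from the scalar and from the sum over index pairs; duality supplies the
    factor 2 that is built into the scalar. *)
Let casimir_trace phi : kappa * \sum_i phi (wt i) =
  \sum_i ratr (dot (wt i) (wt i)) * phi (wt i) +
  \sum_r (T (root_left r) (root_right r) phi *+ 2 - chi r phi).
Proof.
have : \sum_a \sum_b T a b phi = (kappa * \sum_i phi (wt i)) *+ 2.
  transitivity (\sum_i phi (wt i) * casimir P i i).
    rewrite /casimir; under [RHS]eq_bigr => i _ do rewrite summxE mulr_sumr.
    rewrite [RHS]exchange_big; apply: eq_bigr => a _ /=.
    under [RHS]eq_bigr => i _ do rewrite summxE mulr_sumr.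
    by rewrite [RHS]exchange_big; apply: eq_bigr => b _ /=.
  rewrite P_casimir -mulrnAl mulr_sumr; apply: eq_bigr => i _.
  by rewrite mxE eqxx mulrC.
rewrite sum_index_pair; last 2 first.
- move=> a b; rewrite /T; apply: eq_bigr => i _.
  by rewrite !rep_dual // mulNmx mulmxN opprK.
- by move=> a; rewrite /T big1 // => i _; rewrite rep0 // mul0mx mxE mulr0.
move/eqP; rewrite eqr_pMn2r // => /eqP <-; congr (_ + _).
  rewrite exchange_big; apply: eq_bigr => i _ /=.
  rewrite -mulr_sumr mulrC; congr (_ * _); rewrite /dot rmorph_sum; apply: eq_bigr => l _.
  by rewrite P_diag mul_diag_mx !mxE eqxx vec_weight_lshift dot_epsr rmorphM.
by apply: eq_bigr => r _; rewrite Tcomm mulr2n addrA.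
Qed.

(** The exponents of e^rho prod (1 - e^(-a)), expanded over the sets [S] of positive roots; [sg]
    gives the signs. *)
Let nu (S : {set posroot k}) := rho k - \sum_(r in S) root_of r.
Let sg (S : {set posroot k}) : C := (-1) ^+ #|S|.

(* In the sum over S, the terms of S and of r |: S differ by a shift by the root r. *)
Let T_alternating phi r :
  \sum_S sg S * (T (root_left r) (root_right r) (fun be => phi (nu S + be)) *+ 2) =
  \sum_S sg S * ((1 + (-1) ^+ (r \in S)) * chi r (fun be => phi (nu S + be))).
Proof.
rewrite !(sum_set_split r); apply: eq_bigr => S rS.
rewrite /sg !cardsU1 rS setU11 (negPf rS) expr0 expr1 subrr mul0r mulr0 addr0.
rewrite exprS mulN1r mulNr -mulrBr; congr (_ * _).
rewrite [X in _ - X *+ 2]T_root.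
have nuU be : nu (r |: S) + (be + root_of r) = nu S + be.
  by rewrite /nu big_setU1 //=; apply/rowP => i; rewrite !mxE; ring.
have -> : T (root_left r) (root_right r) (fun be => phi (nu (r |: S) + (be + root_of r))) =
          T (root_left r) (root_right r) (fun be => phi (nu S + be)).
  by apply: eq_bigr => i _; rewrite nuU.
have -> : chi r (fun be => phi (nu (r |: S) + (be + root_of r))) = chi r (fun be => phi (nu S +
  be)).
  by apply: eq_bigr => i _; rewrite nuU.
by rewrite mulrnBl opprB addrC subrK [RHS]mulrDl !mul1r mulr2n.
Qed.

Lemma nu_double S : nu S *+ 2 = \sum_r (-1) ^+ (r \in S) *: root_of r.
Proof.
rewrite /nu mulrnBl -sum_posroot (bigID (mem S)) [RHS](bigID (mem S)) /=.
have -> : \sum_(r in S) (-1) ^+ (r \in S) *: root_of r = - \sum_(r in S) root_of r.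
  by rewrite -sumrN; apply: eq_bigr => r ->; rewrite scaleN1r.
have -> : \sum_(r | r \notin S) (-1) ^+ (r \in S) *: root_of r = \sum_(r | r \notin S) root_of r.
  by apply: eq_bigr => r /negPf ->; rewrite scale1r.
by rewrite mulr2n opprD addrACA subrr add0r addrC.
Qed.

(* Freudenthal's identity, multiplied by the product form of the Weyl denominator. *)
Lemma freudenthal phi :
  \sum_S sg S * \sum_i ratr (dot (wt i) (wt i) + 2 * dot (nu S) (wt i)) * phi (nu S + wt i) =
  kappa * \sum_S sg S * \sum_i phi (nu S + wt i).
Proof.
rewrite mulr_sumr; under [RHS]eq_bigr => S _.
  rewrite mulrCA (casimir_trace (fun be => phi (nu S + be))) mulrDr sumrB mulrBr.
  over.
rewrite big_split /= sumrB /=.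
have -> : \sum_S sg S * \sum_r T (root_left r) (root_right r) (fun be => phi (nu S + be)) *+ 2 =
  \sum_S sg S * \sum_r ((1 + (-1) ^+ (r \in S)) * chi r (fun be => phi (nu S + be))).
  under eq_bigr do rewrite mulr_sumr; rewrite exchange_big /=.
  under eq_bigr do rewrite T_alternating; rewrite exchange_big /=.
  by apply: eq_bigr => S _; rewrite mulr_sumr.
rewrite -sumrB -big_split /=; apply: eq_bigr => S _.
rewrite -mulrBr -mulrDr; congr (_ * _); rewrite -sumrB.
(* Subtracting [chi] leaves each root with the sign given by [S]; the signed sum of the roots is 2
   nu(S), which yields the cross term. *)
have -> : \sum_r ((1 + (-1) ^+ (r \in S)) * chi r (fun be => phi (nu S + be)) - chi r (fun be =>
  phi (nu S + be)))
   = \sum_i ratr (2 * dot (nu S) (wt i)) * phi (nu S + wt i).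
  under eq_bigr do rewrite mulrDl mul1r addrC addKr mulr_sumr.
  rewrite exchange_big /=; apply: eq_bigr => i _.
  under eq_bigr do rewrite mulrA; rewrite -mulr_suml; congr (_ * _).
  rewrite -dotZl scaler_nat nu_double dot_suml rmorph_sum; apply: eq_bigr => r _ /=.
  by rewrite dotZl rmorphM rmorph_sign [dot (wt i) _]dotC.
by rewrite -big_split; apply: eq_bigr => i _; rewrite rmorphD mulrDl.
Qed.

End Freudenthal.

(** * The Weyl denominator *)

Section CompleteSymmetric.
Variable F : fieldType.
Implicit Types (x z : F) (xs zs : seq F).

Fixpoint csym zs (r : nat) : F :=
  if zs is z :: zs' then \sum_(j < r.+1) z ^+ j * csym zs' (r - j) else (r == 0%N)%:R.

Lemma csym0 zs : csym zs 0 = 1.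
Proof. by elim: zs => //= z zs IH; rewrite big_ord1 expr0 mul1r. Qed.

Lemma csymS z zs r : csym (z :: zs) r.+1 = csym zs r.+1 + z * csym (z :: zs) r.
Proof.
rewrite /= big_ord_recl expr0 mul1r subn0; congr (_ + _); rewrite mulr_sumr.
by apply: eq_bigr => j _; rewrite exprS mulrA subSS.
Qed.

(** The recursion [csymS] links consecutive degrees, so two of them are carried through the
    induction. *)
Lemma csym_swap z x zs : csym [:: z, x & zs] =1 csym [:: x, z & zs].
Proof.
move=> r; suff [] : csym [:: z, x & zs] r = csym [:: x, z & zs] r /\
  csym [:: z, x & zs] r.+1 = csym [:: x, z & zs] r.+1 by [].
elim: r => [|r [IH IH']]; first by rewrite !(csymS, csym0); split; first done; ring.
split=> //; rewrite !(csymS _ _ r.+1) -IH'.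
have /eqP := csymS z (x :: zs) r; rewrite -subr_eq => /eqP <-.
have /eqP := csymS x (z :: zs) r; rewrite -subr_eq => /eqP <-.
by rewrite -IH -IH'; ring.
Qed.

Lemma eq_csym_cons z zs zs' : csym zs =1 csym zs' -> csym (z :: zs) =1 csym (z :: zs').
Proof. by move=> H r /=; apply: eq_bigr => j _; rewrite H. Qed.

(* The complete homogeneous functions of x_1, 1/x_1, .., x_n, 1/x_n, extended by
   0 to negative degrees. *)
Definition inv_pairs xs := foldr (fun x zs => [:: x, x^-1 & zs]) [::] xs.

Definition csym2 xs (r : int) : F :=
  match r with Posz r => csym (inv_pairs xs) r | Negz _ => 0 end.

(** Multiplying the generating function by (1 - t x)(1 - t / x) = 1 - (x + 1/x) t + t^2 removes x
    and 1/x from the variables. *)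
Lemma csym2_rec x xs r : x != 0 ->
  csym2 (x :: xs) r - (x + x^-1) * csym2 (x :: xs) (r - 1) + csym2 (x :: xs) (r - 2) =
  csym2 xs r.
Proof.
move=> x0; have consE n : csym2 (x :: xs) (Posz n) = csym [:: x, x^-1 & inv_pairs xs] n by [].
have posE n : csym2 xs (Posz n) = csym (inv_pairs xs) n by [].
have negE ys n : csym2 ys (Negz n) = 0 by [].
case: r => [[|[|r]]|r].
- rewrite (_ : Posz 0 - 1 = Negz 0) // (_ : Posz 0 - 2 = Negz 1) //.
  by rewrite !negE consE posE !csym0 mulr0 subr0 addr0.
- rewrite (_ : Posz 1 - 1 = Posz 0) // (_ : Posz 1 - 2 = Negz 0) //.
  by rewrite negE !consE posE !csymS !csym0; ring.
- rewrite (_ : r.+2%:Z - 1 = Posz r.+1); last by lia.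
  rewrite (_ : r.+2%:Z - 2 = Posz r); last by lia.
  rewrite !consE posE (csymS x _ r.+1) (csymS x^-1 _ r.+1).
  have /eqP := csymS x (x^-1 :: inv_pairs xs) r; rewrite -subr_eq => /eqP <-.
  by field.
- rewrite (_ : Negz r - 1 = Negz r.+1); last by lia.
  rewrite (_ : Negz r - 2 = Negz r.+2); last by lia.
  by rewrite !negE; ring.
Qed.

Lemma csym2_swap x z xs : csym2 [:: x, z & xs] =1 csym2 [:: z, x & xs].
Proof.
case=> // r; set zs := inv_pairs xs.
change (csym [:: x, x^-1, z, z^-1 & zs] r = csym [:: z, z^-1, x, x^-1 & zs] r).
transitivity (csym [:: x, z, x^-1, z^-1 & zs] r).
  by apply: eq_csym_cons; apply: csym_swap.
rewrite csym_swap; apply: eq_csym_cons => {}r.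
transitivity (csym [:: x, z^-1, x^-1 & zs] r); last exact: csym_swap.
by apply: eq_csym_cons; apply: csym_swap.
Qed.

(* The generating function of [harm xs] is (1 - t^2) / prod (1 - t y + t^2),
   where y = x + 1/x. *)
Definition harm xs r := csym2 xs r - csym2 xs (r - 2).

Lemma harm_rec x xs r : x != 0 ->
  harm (x :: xs) r - (x + x^-1) * harm (x :: xs) (r - 1) + harm (x :: xs) (r - 2) =
  harm xs r.
Proof.
move=> x0; rewrite /harm -!(@csym2_rec x xs) //.
have -> : r - 2 - 1 = r - 1 - 2 by lia.
ring.
Qed.

Lemma harm_swap x z xs r : harm [:: x, z & xs] r = harm [:: z, x & xs] r.
Proof. by rewrite /harm (csym2_swap x z xs r) (csym2_swap x z xs (r - 2)). Qed.

(** Removing z, or x, from the list [x, z, ..] by the recursion gives two expressions whose outer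
    terms agree; only the middle ones differ. *)
Lemma harm_divided_difference x z xs r : x != 0 -> z != 0 ->
  harm (x :: xs) (r + 1) - harm (z :: xs) (r + 1) =
  (x + x^-1 - (z + z^-1)) * harm [:: x, z & xs] r.
Proof.
move=> x0 z0; rewrite -(@harm_rec z (x :: xs)) // -(@harm_rec x (z :: xs)) //.
rewrite !(harm_swap z x) (_ : r + 1 - 1 = r); last by lia.
ring.
Qed.

(** The orbit sum of x^s under x -> 1/x; for s = 0 the orbit has one element, hence 1 and not 2. *)
Definition xsum (s : nat) x := if s is 0%N then 1 else x ^+ s + x^-1 ^+ s.

Lemma harm_nil (r : nat) : harm [::] r = (r == 0%N)%:R - (r == 2)%:R.
Proof.
rewrite /harm; case: r => [|[|[|r]]]; rewrite /csym2 /= ?subr0 ?subrr ?sub0r //.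
Qed.

Lemma harm_neg xs r : harm xs (Negz r) = 0.
Proof.
by rewrite /harm (_ : Negz r - 2 = Negz r.+2) ?subrr //; lia.
Qed.

Lemma harm0 xs : harm xs 0 = 1.
Proof. by rewrite /harm -[0]/(Posz 0) /csym2 csym0 subr0. Qed.

(** For one variable, (1 - t^2) / ((1 - t x)(1 - t / x)) = 1 + sum_(s >= 1) (x^s + x^(-s)) t^s. *)
Lemma harm1 x s : x != 0 -> harm [:: x] (Posz s) = xsum s x.
Proof.
move=> x0; suff [] : harm [:: x] (Posz s) = xsum s x /\ harm [:: x] (Posz s.+1) = xsum s.+1 x by
  [].
elim: s => [|s [IH IH']].
  split=> //; first exact: harm0.
  have := @harm_rec x [::] (Posz 1) x0; rewrite harm_nil.
  rewrite (_ : Posz 1 - 1 = Posz 0) // (_ : Posz 1 - 2 = Negz 0) //.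
  by rewrite harm_neg harm0 subrr addr0 mulr1 => /eqP; rewrite subr_eq0 => /eqP.
split=> //; have := @harm_rec x [::] s.+2 x0; rewrite harm_nil.
rewrite (_ : s.+2%:Z - 1 = Posz s.+1); last by lia.
rewrite (_ : s.+2%:Z - 2 = Posz s); last by lia.
rewrite IH IH' => /eqP; rewrite -subr_eq0 => /eqP E.
apply/eqP; rewrite -subr_eq0 -[X in _ == X]E; apply/eqP.
case: s {IH IH' E} => [|s] /=; first by rewrite !expr1; field.
by rewrite subrr !exprS; field.
Qed.

(* Newton's interpolation of x |-> xsum s x as a function of y = x + 1/x, with its
   remainder; the divided differences are values of [harm]. *)
Lemma newton xs s : all (fun z => z != 0) xs -> exists p : {poly F},
  [/\ (size p <= size xs)%N,
      forall m, size xs = m.+1 -> p`_m = harm xs (s%:Z - m%:Z) &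
      forall x, x != 0 -> xsum s x = p.[x + x^-1] +
        harm (x :: xs) (s%:Z - (size xs)%:Z) * \prod_(z <- xs) (x + x^-1 - (z + z^-1))].
Proof.
elim: xs => [|z xs IH] /=.
  exists 0; split=> [|//|x x0]; first by rewrite size_poly0.
  by rewrite horner0 add0r big_nil mulr1 subr0 harm1.
move=> /andP[z0 /IH[p [ps pm pE]]].
pose q := \prod_(z <- xs) ('X - (z + z^-1)%:P).
pose c := harm (z :: xs) (s%:Z - (size xs)%:Z).
have sq : size q = (size xs).+1 by rewrite size_prod_XsubC.
have qn : q`_(size xs) = 1.
  by have /monicP := monic_prod_XsubC xs predT (fun z => z + z^-1); rewrite /lead_coef -/q sq.
exists (p + c *: q); split.
- apply: leq_trans (size_polyD _ _) _; rewrite geq_max (leq_trans ps) //=.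
  by rewrite (leq_trans (size_scale_leq _ _)) ?sq.
- by move=> m [<-]; rewrite coefD coefZ qn mulr1 nth_default ?add0r.
move=> x x0; rewrite pE // hornerD hornerZ big_cons -addrA; congr (_ + _).
have -> : q.[x + x^-1] = \prod_(z <- xs) (x + x^-1 - (z + z^-1)).
  by rewrite horner_prod; apply: eq_bigr => y _; rewrite hornerXsubC.
rewrite mulrA -mulrDl; congr (_ * _).
have := @harm_divided_difference x z xs (s%:Z - (size xs).+1%:Z) x0 z0.
rewrite (_ : _ + 1 = s%:Z - (size xs)%:Z); last by lia.
by move/eqP; rewrite subr_eq => /eqP ->; rewrite addrC mulrC.
Qed.

(** Newton's formula with s + 1 nodes, all equal to 1: the remainder contains [harm] in degree -1,
    which is 0, and the coefficient of degree s is [harm] in degree 0. *)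
Lemma xsum_poly s : exists p : {poly F},
  [/\ (size p <= s.+1)%N, p`_s = 1 & forall x, x != 0 -> xsum s x = p.[x + x^-1]].
Proof.
have [|p [ps pn pE]] := @newton (nseq s.+1 1) s.
  by rewrite all_nseq oner_eq0 orbT.
rewrite size_nseq in ps pn pE; exists p; split=> //.
  by rewrite (pn s erefl) (_ : s%:Z - s%:Z = 0) ?harm0 //; lia.
move=> x x0; rewrite pE // (_ : s%:Z - s.+1%:Z = Negz 0); last by lia.
by rewrite harm_neg mul0r addr0.
Qed.

(** In y_i = x_i + 1/x_i the column j < k - 1 is a monic polynomial of degree j. The last column is
    replaced by its interpolation polynomial at all the y_i, where the remainder vanishes; its
    coefficient of degree k - 1 is [harm] in degree r. The matrix is then Vandermonde times
    triangular. *)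
Lemma det_xsum k (x : 'I_k -> F) (r : nat) : (0 < k)%N -> (forall i, x i != 0) ->
  \det (\matrix_(i < k, j < k) xsum (if j.+1 == k then (r + j)%N else j) (x i)) =
  (\prod_(i < k) \prod_(j < k | (i < j)%N) (x j + (x j)^-1 - (x i + (x i)^-1))) *
  harm (codom x) r.
Proof.
move=> k0 x0; pose y i := x i + (x i)^-1.
have col_poly (j : 'I_k) : exists p : {poly F}, [/\ (size p <= if j.+1 == k then k else j.+1)%N,
    p`_j = (if j.+1 == k then harm (codom x) r else 1) &
    forall i, xsum (if j.+1 == k then (r + j)%N else j) (x i) = p.[y i]].
  case: eqP => jk; last first.
    have [p [ps pj pE]] := xsum_poly j; exists p; split=> // i; exact: pE.
  have [|p [ps pj pE]] := @newton (codom x) (r + j).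
    by apply/allP => _ /codomP[i ->].
  rewrite size_codom card_ord in ps pj; exists p; split=> // [|i].
    by rewrite (pj j) ?jk //; congr harm; lia.
  rewrite pE // -[RHS]addr0; congr (_ + _).
  have xi : x i \in codom x by apply: codom_f.
  by rewrite (big_rem (x i)) //= subrr mul0r mulr0.
have [p pP] : exists p : 'I_k -> {poly F}, forall j, [/\ (size (p j) <= if j.+1 == k then k else
  j.+1)%N,
    (p j)`_j = (if j.+1 == k then harm (codom x) r else 1) &
    forall i, xsum (if j.+1 == k then (r + j)%N else j) (x i) = (p j).[y i]].
  have /fin_all_exists[p pP] := col_poly; by exists p.
pose U := \matrix_(l < k, j < k) (p j)`_l.
have -> : \matrix_(i < k, j < k) xsum (if j.+1 == k then (r + j)%N else j) (x i) =
   (Vandermonde k (\row_i y i))^T *m U.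
  apply/matrixP => i j; have [ps _ pE] := pP j; rewrite !mxE pE.
  have sz : (size (p j) <= k)%N by apply: leq_trans ps _; case: ifP.
  rewrite (horner_coef_wide _ sz); apply: eq_bigr => l _.
  by rewrite !mxE mulrC.
rewrite det_mulmx det_tr det_Vandermonde; congr (_ * _).
  by apply: eq_bigr => i _; apply: eq_bigr => j _; rewrite !mxE.
rewrite -det_tr det_trig; last first.
  apply/is_trig_mxP => j l jl; rewrite !mxE; have [ps _ _] := pP j.
  rewrite nth_default // (leq_trans ps) //; case: eqP => // jk.
  by have := ltn_ord l; move: jk jl; clear; lia.
under eq_bigr do rewrite !mxE.
have k1 : (k.-1 < k)%N by rewrite prednK.
pose j1 : 'I_k := Ordinal k1.
rewrite (bigD1 j1) //= big1 ?mulr1 => [|j jj1].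
  by have [_ -> _] := pP j1; rewrite /= prednK ?eqxx.
have [_ -> _] := pP j; case: eqP => // jk; case/eqP: jj1; apply: val_inj => /=.
by rewrite -[in RHS](congr1 predn jk).
Qed.

End CompleteSymmetric.

(** With x = e^eps_i and y = e^eps_j, the two brackets are the factors 1 - e^(-a) of the roots eps_i
    - eps_j and eps_i + eps_j; the leading x is the share of j in e^rho, since rho_i is the number
    of j < i. *)
Lemma sub_inv_factor (F : fieldType) (x y : F) : x != 0 -> y != 0 ->
  x * ((- (x^-1 * y) + 1) * (- (x^-1 * y^-1) + 1)) = x + x^-1 - (y + y^-1).
Proof. by move=> x0 y0; field; rewrite x0 y0. Qed.

Section Denominator.
Variable k : nat.
Hypothesis k_gt1 : (1 < k)%N.
Implicit Types (w : weyl k) (be la mu nu : 'rV[rat]_k).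

Let k_gt0 : (0 < k)%N := ltnW k_gt1.

Lemma weyl_sum (R : nmodType) (f : {perm 'I_k} * {set 'I_k} -> R) :
  \sum_(w : weyl k) f (val w) =
  \sum_(s : {perm 'I_k}) \sum_(E : {set 'I_k} | ~~ odd #|E|) f (s, E).
Proof.
transitivity (\sum_(p : {perm 'I_k} * {set 'I_k} | ~~ odd #|p.2|) f p).
  by apply: esym; exact: (big_sub (fun p : {perm 'I_k} * {set 'I_k} => ~~ odd #|p.2|)).
by rewrite pair_big_dep; apply: eq_bigr => -[s E].
Qed.

Definition weps (i : 'I_k) : char_field k := wexp (eps k i).

Lemma half_int_eps (i : nat) : half_int (eps k i).
Proof. by apply: int_half_int => j; rewrite mxE rpred_nat. Qed.

Lemma weps_neq0 i : weps i != 0.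
Proof.
apply/prodf_neq0 => j _; rewrite expfz_neq0 //; exact: X_neq0.
Qed.

Lemma row_sum_eps be : be = \sum_(j < k) be 0 j *: eps k j.
Proof.
apply/rowP => i; rewrite summxE (bigD1 i) //= big1 ?addr0 => [|j ji].
  by rewrite !mxE eqxx mulr1.
by rewrite !mxE val_eqE eq_sym (negPf ji) mulr0.
Qed.

Lemma wexp_nat (e : 'I_k -> nat) (E : {set 'I_k}) :
  wexp (\row_i ((-1) ^+ (i \in E) * (e i)%:R)) =
  \prod_i (if i \in E then (weps i)^-1 else weps i) ^+ e i.
Proof.
rewrite [X in wexp X]row_sum_eps wexp_sum => [|i _]; last first.
  rewrite !mxE; apply: int_half_int => j; rewrite !mxE.
  by rewrite !rpredM ?rpredX ?rpredN ?rpred1 ?rpred_nat.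
apply: eq_bigr => i _; rewrite mxE mulrC -scalerA scaler_nat wexp_Mn.
  case: (i \in E); rewrite ?expr0 ?expr1 ?scale1r ?scaleN1r // wexpN //.
  exact: half_int_eps.
by case: (i \in E); rewrite ?expr0 ?expr1 ?scale1r ?scaleN1r; [apply: half_intN|];
  apply: half_int_eps.
Qed.

(* Since e z = 0, the parity of E can be adjusted at z. *)
Lemma sum_even_sets (z : 'I_k) (e : 'I_k -> nat) (x : 'I_k -> char_field k) :
  e z = 0%N -> (forall i, i != z -> (0 < e i)%N) ->
  \sum_(E : {set 'I_k} | ~~ odd #|E|) \prod_i (if i \in E then (x i)^-1 else x i) ^+ e i =
  \prod_i xsum (e i) (x i).
Proof.
move=> ez0 e_gt0; pose f (E : {set 'I_k}) := \prod_i (if i \in E then (x i)^-1 else x i) ^+ e i.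
(* Exactly one of E and z |: E has even size, and both have the same product; the pair is counted
   once by giving the choice of 1/x at z the value 0. *)
pose g (b : bool) i := if b then (if i == z then 0 else (x i)^-1 ^+ e i) else x i ^+ e i.
have -> : \prod_i xsum (e i) (x i) = \prod_i (g true i + g false i).
  apply: eq_bigr => i _; rewrite /g; case: eqVneq => [->|iz].
    by rewrite ez0 expr0 add0r.
  by have := e_gt0 i iz; case: (e i) => // n _; rewrite addrC.
rewrite bigA_distr big_mkcond !(sum_set_split z); apply: eq_bigr => E zE.
have fU : f (z |: E) = f E.
  apply: eq_bigr => i _; rewrite !inE; case: eqVneq => [->|//].
  by rewrite ez0 !expr0.
have -> : \prod_i (if i \in z |: E then g true i else g false i) = 0.
  by rewrite (bigD1 z) //= setU11 /g eqxx mul0r.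
have -> : \prod_i (if i \in E then g true i else g false i) = f E.
  apply: eq_bigr => i _; rewrite /g; case: ifP => // iE; case: eqVneq => [iz|//].
  by rewrite iz (negPf zE) in iE.
rewrite -/(f E) -/(f (z |: E)) fU cardsU1 zE /= addr0.
by case: (odd #|E|); rewrite /= ?add0r ?addr0.
Qed.

(** For a fixed permutation the even sign changes sum up to a product of [xsum], so the alternant is
    the determinant of [det_xsum]: the added vector weight only raises the exponents of the last
    column. *)
Lemma wexp_alternating_sum (r : nat) :
  \sum_(w : weyl k) (-1) ^+ wodd w * wexp (wact w (vector_weight k r + rho k)) =
  (\prod_(i < k) \prod_(j < k | (i < j)%N)
     (weps j + (weps j)^-1 - (weps i + (weps i)^-1))) * harm (codom weps) r.
Proof.
rewrite -det_xsum //; last exact: weps_neq0.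
pose e (j : 'I_k) := if j.+1 == k then (r + j)%N else j : nat.
have wE : vector_weight k r + rho k = \row_j (e j)%:R.
  apply/rowP => j; rewrite !mxE /e.
  have -> : (j.+1 == k) = (j == k.-1 :> nat) by move: (ltn_ord j); lia.
  by case: eqP => _; rewrite ?mulr1 ?natrD // mulr0 add0r.
pose f (p : {perm 'I_k} * {set 'I_k}) : char_field k :=
  (-1) ^+ p.1 * \prod_i (if i \in p.2 then (weps i)^-1 else weps i) ^+ e (p.1 i).
transitivity (\sum_(w : weyl k) f (val w)).
  apply: eq_bigr => w _; rewrite /f -wexp_nat; congr (_ * wexp _).
  by apply/rowP => i; rewrite wactE wE !mxE.
rewrite weyl_sum /determinant; apply: eq_bigr => s _; rewrite /f /= -mulr_sumr.
(* The position that receives the coordinate 0 of rho. Since k > 1, this is not the leading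
   coordinate, which is raised by r, so the exponent at z is 0. *)
congr (_ * _); pose z : 'I_k := (s^-1)%g (Ordinal k_gt0).
rewrite (@sum_even_sets z (fun i => e (s i))).
- by apply: eq_bigr => i _; rewrite mxE.
- by rewrite /z permKV /e /=; case: eqP => // k1; have := k_gt1; rewrite -k1.
move=> i iz; rewrite /e; case: (posnP (s i)) => [si|si]; last first.
  by case: eqP => _ //; rewrite addn_gt0 si orbT.
by case/eqP: iz; apply: (@perm_inj _ s); rewrite permKV; apply: val_inj.
Qed.

Lemma wexp_posroot_product :
  \sum_(S : {set posroot k}) (-1) ^+ #|S| * wexp (rho k - \sum_(a in S) root_of a) =
  \prod_(i < k) \prod_(j < k | (i < j)%N)
     (weps j + (weps j)^-1 - (weps i + (weps i)^-1)).
Proof.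
have half_root a : half_int (@root_of k a) by apply: int_half_int; apply: root_int.
transitivity (wexp (rho k) * \prod_(a : posroot k) (- wexp (- root_of a) + 1)).
  rewrite bigA_distr mulr_sumr; apply: eq_bigr => S _.
  rewrite wexpD; [|exact: half_int_rho|apply: half_intN; apply: half_int_sum => a _;
    exact: half_root].
  rewrite mulrCA; congr (_ * _); rewrite -big_mkcond /= -sumrN wexp_sum => [|a _];
    last exact/half_intN/half_root.
  by rewrite -prodrN.
pose g (p : 'I_k * 'I_k * bool) : char_field k :=
  - wexp (- (eps k p.1.1 + (-1) ^+ p.2 *: eps k p.1.2)) + 1.
rewrite (eq_bigr (fun a => g (val a))); last first.
  by move=> a _; rewrite /g /root_of; case: (val a) => [[i j] b].
rewrite posroot_big.
have -> : wexp (rho k) = \prod_(i < k) \prod_(j < k | (j < i)%N) weps i.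
  have -> : rho k = \row_i ((-1) ^+ (i \in (set0 : {set 'I_k})) * (i : nat)%:R).
    by apply/rowP => i; rewrite !mxE inE mul1r.
  rewrite wexp_nat; apply: eq_bigr => i _; rewrite inE prodr_const; congr (_ ^+ _).
  by rewrite -[LHS]card_ord -!sum1_card [RHS](big_ord_narrow (ltnW (ltn_ord i))).
rewrite -big_split /= [RHS](exchange_big_dep predT) //=; apply: eq_bigr => i _.
rewrite -big_split; apply: eq_bigr => j ji /=.
have hi := half_int_eps i; have hj := half_int_eps j.
have xi := weps_neq0 i; have xj := weps_neq0 j.
rewrite /g /= expr1 expr0 scale1r scaleN1r !opprD opprK.
rewrite !wexpD ?wexpN //; try exact: half_intN.
by rewrite -/(weps i) -/(weps j) -opprD sub_inv_factor.
Qed.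

(** Both sides are the product of the differences of the x_i + 1/x_i, the sum over W being the
    alternant above for r = 0. *)
Lemma weyl_denominator (M : zmodType) (phi : 'rV[rat]_k -> M) :
  \sum_(S : {set posroot k}) phi (rho k - \sum_(a in S) root_of a) *~ (-1) ^+ #|S| =
  \sum_(w : weyl k) phi (wact w (rho k)) *~ (-1) ^+ wodd w.
Proof.
have half_root a : half_int (@root_of k a) by apply: int_half_int; apply: root_int.
apply: wexp_transfer => [S|w|].
- by apply: half_intB; [exact: half_int_rho | exact: half_int_sum].
- by apply/half_int_wact/half_int_rho.
under eq_bigr do rewrite rmorphXn rmorphN1.
under [RHS]eq_bigr do rewrite rmorphXn rmorphN1.
have := wexp_alternating_sum 0; rewrite (harm0 _ : harm _ (Posz 0) = 1) mulr1
  wexp_posroot_product => <-.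
by apply: eq_bigr => w _; rewrite /vector_weight scale0r add0r.
Qed.

End Denominator.

Lemma mulrz_sign (R : pzRingType) (x : R) n : x *~ (-1) ^+ n = (-1) ^+ n * x.
Proof. by rewrite -mulrzl rmorphXn rmorphN1. Qed.

Lemma sum_mulrz_by_value (I : finType) (T : eqType) (M : zmodType) (phi : T -> M)
    (f : I -> T) (c : I -> int) (D : seq T) : uniq D -> (forall i, f i \in D) ->
  \sum_i phi (f i) *~ c i = \sum_(x <- D) phi x *~ (\sum_(i | f i == x) c i).
Proof.
move=> uD fD; under [RHS]eq_bigr => x _.
  rewrite mulrz_sumr (eq_bigr (fun i => phi (f i) *~ c i)); first over.
  by move=> i /eqP ->.
rewrite (exchange_big_dep predT) //=; apply: eq_bigr => i _.
rewrite big_mkcond (bigD1_seq (f i)) ?fD //= eqxx big1 ?addr0 // => x.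
by rewrite eq_sym => /negPf ->.
Qed.

Lemma sum_mulrz_eq (I J : finType) (T : eqType) (M : zmodType) (phi : T -> M)
    (f : I -> T) (c : I -> int) (g : J -> T) (d : J -> int) :
  (forall x, \sum_(i | f i == x) c i = \sum_(j | g j == x) d j) ->
  \sum_i phi (f i) *~ c i = \sum_j phi (g j) *~ d j.
Proof.
move=> H; pose D := undup (codom f ++ codom g).
rewrite (@sum_mulrz_by_value _ _ _ phi f c D) ?undup_uniq //; last first.
  by move=> i; rewrite mem_undup mem_cat codom_f.
rewrite (@sum_mulrz_by_value _ _ _ phi g d D) ?undup_uniq //; last first.
  by move=> i; rewrite mem_undup mem_cat codom_f orbT.
by apply: eq_bigr => x _; rewrite H.
Qed.

Section FromFreudenthal.
Variables (C : numClosedFieldType) (k n : nat).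
Hypothesis k_gt1 : (1 < k)%N.
Variable P : 'I_(k + k) -> 'I_(k + k) -> 'M[C]_n.
Hypothesis repP : rep_axioms P.
Variable wt : 'I_n -> 'rV[rat]_k.
Hypothesis P_diag : forall c, P c c = diag_mx (\row_j ratr (dot (wt j) (vec_weight c))).
Variable la : 'rV[rat]_k.
Hypothesis la_dom : dominant la.
Hypothesis P_casimir : casimir P = (ratr (dot la la + 2 * dot la (rho k)) *+ 2)%:M.
Hypothesis wt_cone : forall j, pos_cone (la - wt j).
Hypothesis wt_la : #|[set j | wt j == la]| = 1%N.
Implicit Types (w : weyl k) (mu nu : 'rV[rat]_k).

Let wt_int i (r : posroot k) : dot (wt i) (root_of r) \is a Num.int.
Proof.
have [s /eqP] := wt_cone i; rewrite subr_eq addrC -subr_eq => /eqP <-.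
rewrite dotBl rpredB //.
  by apply: weight_lattice_dot; case/andP: la_dom.
rewrite dot_suml rpred_sum // => a _; rewrite dot_root.
by rewrite rpredD ?rpredM ?rpredX ?rpredN ?rpred1 ?root_int.
Qed.

(* The coefficient of x^nu in the product of a_rho and of the character. *)
Let b nu : int :=
  \sum_(w : weyl k) (-1) ^+ wodd w * (#|[pred i | wact w (rho k) + wt i == nu]|)%:Z.

Let b_posroots nu : b nu = \sum_(S : {set posroot k})
  (-1) ^+ #|S| * (#|[pred i | rho k - \sum_(a in S) root_of a + wt i == nu]|)%:Z.
Proof.
have := @weyl_denominator _ k_gt1 int (fun mu => (#|[pred i | mu + wt i == nu]|)%:Z).
by under eq_bigr do rewrite mulrz_sign; under [RHS]eq_bigr do rewrite mulrz_sign.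
Qed.

(** The family of weights is stable under W, so [b] inherits the antisymmetry of a_rho. *)
Let b_antisym u nu : b (wact u nu) = (-1) ^+ wodd u * b nu.
Proof.
rewrite /b mulr_sumr [LHS](reindex_inj (@wmul_inj _ u)); apply: eq_bigr => w _ /=.
rewrite wodd_mul signr_addb -mulrA; congr (_ * (_ * Posz _)).
have /seq.permP/(_ [pred be | wact w (rho k) + be == nu]) := wt_wact repP P_diag wt_int (winv u)
  k_gt1.
rewrite !count_codom /= => ->; apply: eq_card => i; rewrite !inE /= wact_wmul.
by rewrite -{1}(wactKV u (wt i)) -wactD (inj_eq (@wact_inj _ u)).
Qed.

Let b_cone nu : b nu != 0 -> pos_cone (la + rho k - nu).
Proof.
rewrite b_posroots => sum_neq0.
have /existsP[S /andP[_]] : [exists S : {set posroot k}, true &&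
    (#|[pred i | rho k - \sum_(a in S) root_of a + wt i == nu]| != 0%N)].
  apply: contraR sum_neq0 => /existsPn H; rewrite big1 // => S _.
  by have := H S; rewrite negbK => /eqP ->; rewrite mulr0.
rewrite -lt0n => /card_gt0P[i]; rewrite inE => /eqP <-.
have -> : la + rho k - (rho k - \sum_(a in S) root_of a + wt i) =
   (la - wt i) + \sum_(a in S) root_of a by apply/rowP => l; rewrite !mxE; ring.
by apply: pos_coneD => //; exists (enum S); rewrite big_enum.
Qed.

Let b_la : b (la + rho k) = 1.
Proof.
have eq_la S i : rho k - \sum_(a in S) root_of a + wt i = la + rho k ->
    \sum_(a in S) root_of a = 0 /\ la - wt i = 0.
  move=> e; have sum0 : \sum_(a in S) root_of a + (la - wt i) = 0.
    move/rowP in e; apply/rowP => l; have := e l; rewrite !mxE => el.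
    by lra.
  have coneS : pos_cone (\sum_(a in S) root_of a) by exists (enum S); rewrite big_enum.
  have S0 := pos_cone_add_eq0 coneS (wt_cone i) sum0; split=> //.
  by move: sum0; rewrite S0 add0r.
have card0 : #|[pred i | rho k - \sum_(a in set0) root_of a + wt i == la + rho k]| = 1%N.
  apply: etrans wt_la; apply: eq_card => i.
  by rewrite !inE big_set0 subr0 addrC (inj_eq (addIr _)).
rewrite b_posroots (bigD1 set0) //= card0 cards0 big1 // => S S0.
suff -> : #|[pred i | rho k - \sum_(a in S) root_of a + wt i == la + rho k]| = 0%N.
  by rewrite mulr0.
apply: eq_card0 => i; apply/negP; rewrite inE => /eqP/eq_la[sum0 _].
case/set0Pn: S0 => a aS; have := congr1 (dot (rho k)) sum0.
rewrite dotC dot_suml [in RHS]dotC dot0l (bigD1 a) //=.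
have : 0 <= \sum_(i in S | i != a) dot (root_of i) (rho k).
  by apply: sumr_ge0 => c _; rewrite dotC; apply/ltW/dot_rho.
have := dot_rho a; rewrite dotC; lra.
Qed.

(* By Freudenthal's identity, the product of the denominator and of the character is
   an eigenvector of the Laplacian, which multiplies x^nu by |nu|^2. *)
Let b_norm nu : b nu != 0 -> dot nu nu = dot (la + rho k) (la + rho k).
Proof.
move=> b0; pose phi mu : C := (mu == nu)%:R.
have F := freudenthal repP P_diag P_casimir phi.
pose T (psi : 'rV[rat]_k -> C) := \sum_(w : weyl k) (-1) ^+ wodd w * psi (wact w (rho k)).
have D (psi : 'rV[rat]_k -> C) :
    \sum_(S : {set posroot k}) (-1) ^+ #|S| * psi (rho k - \sum_(a in S) root_of a) = T psi.
  have := @weyl_denominator _ k_gt1 C psi.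
  by under eq_bigr do rewrite mulrz_sign; under [RHS]eq_bigr do rewrite mulrz_sign.
rewrite (D (fun mu => \sum_i ratr (dot (wt i) (wt i) + 2 * dot mu (wt i)) * phi (mu + wt i))) in
  F.
rewrite (D (fun mu => \sum_i phi (mu + wt i))) in F.
have bE : T (fun mu => \sum_i phi (mu + wt i)) = (b nu)%:~R.
  rewrite /b rmorph_sum; apply: eq_bigr => w _.
  rewrite rmorphM rmorphXn rmorphN1; congr (_ * _).
  rewrite -[RHS]/(_%:R) -sum1_card natr_sum [RHS]big_mkcond; apply: eq_bigr => i _.
  by rewrite inE /phi; case: eqP.
have : ratr (dot nu nu) * T (fun mu => \sum_i phi (mu + wt i)) =
       ratr (dot (la + rho k) (la + rho k)) * T (fun mu => \sum_i phi (mu + wt i)).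
  (* Where w(rho) + wt(i) = nu, one has |nu|^2 = |rho|^2 + |wt(i)|^2 + 2 (w(rho), wt(i)). The last
     two terms form the factor in Freudenthal's identity, and |rho|^2 completes the Casimir value to
     |la + rho|^2. *)
  have -> : dot (la + rho k) (la + rho k) = dot (rho k) (rho k) + (dot la la + 2 * dot la (rho
    k)).
    by rewrite !(dotDl, dotDr) [dot (rho k) la]dotC; ring.
  rewrite rmorphD mulrDl -F /T !mulr_sumr -big_split; apply: eq_bigr => w _ /=.
  rewrite mulrCA [X in _ = X + _]mulrCA -mulrDr; congr (_ * _).
  rewrite !mulr_sumr -big_split; apply: eq_bigr => i _ /=; rewrite -mulrDl -rmorphD /phi.
  case: eqP => [<-|]; rewrite ?mulr0 // !mulr1; congr ratr.
  by rewrite !(dotDl, dotDr) dot_wact [dot (wt i) (wact w _)]dotC; ring.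
have bC : (b nu)%:~R != 0 :> C by rewrite intr_eq0.
by rewrite bE => /(mulIf bC)/fmorph_inj.
Qed.

(** By antisymmetry [b] is determined at dominant exponents, where the cone and the norm leave only
    la + rho, with coefficient 1. *)
Lemma weyl_character (M : zmodType) (phi : 'rV[rat]_k -> M) :
  \sum_(w : weyl k) (\sum_i phi (wact w (rho k) + wt i)) *~ (-1) ^+ wodd w =
  \sum_(w : weyl k) phi (wact w (la + rho k)) *~ (-1) ^+ wodd w.
Proof.
have la_strict := strictly_dominant_rho la_dom.
have bE nu : b nu = \sum_(w : weyl k | wact w (la + rho k) == nu) (-1) ^+ wodd w.
  have orbit w : b (wact w (la + rho k)) = (-1) ^+ wodd w by rewrite b_antisym b_la mulr1.
  case: (boolP [exists w, wact w (la + rho k) == nu]) => [/existsP[w /eqP <-]|/existsPn no_w].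
    rewrite orbit (bigD1 w) //= big1 ?addr0 // => w' /andP[/eqP e w'w].
    by case/eqP: w'w; have [] := wact_strictly_dominant_inj k_gt1 la_strict la_strict e.
  rewrite [RHS]big_pred0 => [|w]; last by apply: negPf; apply: no_w.
  apply/eqP; apply: contraT => b0; have [u u_dom] := exists_dominant nu.
  have bu0 : b (wact u nu) != 0 by rewrite b_antisym mulf_neq0 // signr_eq0.
  (* Equal norms make the difference of la + rho and the dominant conjugate of nu orthogonal to
     their sum; the sum is strictly dominant and the difference lies in the positive cone. *)
  have e0 : la + rho k - wact u nu = 0.
    apply: (@pos_cone_eq0 _ _ (la + rho k + wact u nu)) (b_cone bu0) _.
      by move=> a; rewrite dotDl ltr_pwDl.
    move: (b_norm bu0); set Y := wact u nu; set X := la + rho k => XY.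
    by rewrite dotBl !(dotDr _ X Y) [dot Y X]dotC XY; ring.
  by have := no_w (winv u); rewrite wact_eqV winvK -subr_eq0 e0 eqxx.
pose f (p : weyl k * 'I_n) := wact p.1 (rho k) + wt p.2.
transitivity (\sum_(p : weyl k * 'I_n) phi (f p) *~ (-1) ^+ wodd p.1).
  rewrite -(pair_bigA _ (fun w i => phi (wact w (rho k) + wt i) *~ (-1) ^+ wodd w)) /=.
  by apply: eq_bigr => w _; rewrite mulrz_suml.
apply: sum_mulrz_eq => nu; rewrite -bE /b.
rewrite -(pair_big_dep predT (fun w i => wact w (rho k) + wt i == nu)
  (fun (w : weyl k) _ => (-1) ^+ wodd w)) /=.
by apply: eq_bigr => w _; rewrite sumr_const -mulr_natr natz.
Qed.

End FromFreudenthal.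

(** * Characters of modules *)

Section Modules.
Variables (C : numClosedFieldType) (k : nat).
Implicit Types (M N : so_module C k) (a b c : 'I_(k + k)).

Lemma so_linear (x : C) (X Y : 'M[C]_(k + k)) : so X -> so Y -> so (x *: X + Y).
Proof.
move=> /soP HX /soP HY; apply/soP => a b.
by rewrite !mxE (HX a b) (HY a b) mulrN -opprD.
Qed.

Lemma so0 : so (0 : 'M[C]_(k + k)).
Proof. by apply/soP => a b; rewrite !mxE oppr0. Qed.

Lemma mact0 M : mact M 0 = 0.
Proof.
have := mact_linear M 1 so0 so0; rewrite !scale1r addr0 => /eqP.
by rewrite -subr_eq subrr eq_sym => /eqP.
Qed.

Lemma mactD M X Y : so X -> so Y -> mact M (X + Y) = mact M X + mact M Y.
Proof. by move=> HX HY; rewrite -[X in mact M (X + _)]scale1r mact_linear // scale1r. Qed.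

Lemma mactZ M x X : so X -> mact M (x *: X) = x *: mact M X.
Proof. by move=> HX; rewrite -[_ *: X]addr0 mact_linear ?so0 // mact0 addr0. Qed.

Lemma so_sumr (I : Type) (s : seq I) (F : I -> 'M[C]_(k + k)) :
  (forall i, so (F i)) -> so (\sum_(i <- s) F i).
Proof.
move=> H; elim: s => [|i s IHs]; first by rewrite big_nil so0.
by rewrite big_cons -[F i]scale1r so_linear.
Qed.

Lemma mact_sum M (I : Type) (s : seq I) (F : I -> 'M[C]_(k + k)) :
  (forall i, so (F i)) -> mact M (\sum_(i <- s) F i) = \sum_(i <- s) mact M (F i).
Proof.
move=> H; elim: s => [|i s IHs]; first by rewrite !big_nil mact0.
by rewrite !big_cons mactD ?IHs // so_sumr.
Qed.

Lemma soZ (x : C) (X : 'M[C]_(k + k)) : so X -> so (x *: X).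
Proof. by move=> HX; rewrite -[_ *: X]addr0 so_linear // so0. Qed.

Lemma soD (X Y : 'M[C]_(k + k)) : so X -> so Y -> so (X + Y).
Proof. by move=> HX HY; rewrite -[X]scale1r so_linear. Qed.

Lemma mact_lin4 M x1 x2 x3 x4 X1 X2 X3 X4 : so X1 -> so X2 -> so X3 -> so X4 ->
  mact M (x1 *: X1 + x2 *: X2 + x3 *: X3 + x4 *: X4) =
  x1 *: mact M X1 + x2 *: mact M X2 + x3 *: mact M X3 + x4 *: mact M X4.
Proof. by move=> *; rewrite !mactD ?mactZ ?(soD, soZ). Qed.

Lemma rep_axioms_so_elt : rep_axioms (@so_elt C k).
Proof.
split=> [a b|a b c e]; first exact: so_elt_dual.
exact: bracket_so_elt.
Qed.

Lemma rep_axioms_mact M : rep_axioms (fun a b => mact M (so_elt C a b)).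
Proof.
split=> [a b|a b c e].
  by rewrite so_elt_dual -scaleN1r mactZ ?so_so_elt // scaleN1r.
rewrite -[LHS]/(bracket _ _) -mact_bracket ?so_so_elt // bracket_so_elt -!scaleNr.
by apply: mact_lin4; apply: so_so_elt.
Qed.

Lemma irr_module_stable M : so_irreducible M -> forall U : {vspace 'cV[C]_(mdim M)},
  (forall a b u, u \in U -> mact M (so_elt C a b) *m u \in U) -> U = 0%VS \/ U = fullv.
Proof.
move=> [_ irr] U H; apply: irr => X u HX uU.
rewrite (so_sum_elt HX) mact_sum => [|a]; last first.
  by apply: so_sumr => b; rewrite soZ ?so_so_elt.
rewrite mulmx_suml memv_suml // => a _; rewrite mact_sum => [|b]; last first.
  by rewrite soZ ?so_so_elt.
rewrite mulmx_suml memv_suml // => b _.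
by rewrite mactZ ?so_so_elt // -scalemxAl memvZ // H.
Qed.

(** The columns of [B] are a basis of weight vectors, so [wt] is the character of [M]: its weights
    listed with multiplicity. *)
Definition has_weights M n (wt : 'I_n -> 'rV[rat]_k) : Prop :=
  exists (B : 'M[C]_(mdim M, n)) (E : 'M[C]_(n, mdim M)),
    [/\ B *m E = 1%:M, E *m B = 1%:M &
        forall i, mact M (cartan C i) *m B = B *m diag_mx (\row_j ratr (wt j 0 i))].

Lemma rep_axioms_conj d n (P : 'I_(k + k) -> 'I_(k + k) -> 'M[C]_d)
    (B : 'M[C]_(d, n)) (E : 'M[C]_(n, d)) : B *m E = 1%:M ->
  rep_axioms P -> rep_axioms (fun a b => E *m P a b *m B).
Proof.
move=> BE repP; split=> [a b|a b c e].
  by rewrite rep_dual // mulmxN mulNmx.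
have mulE (X Y : 'M[C]_d) : (E *m X *m B) *m (E *m Y *m B) = E *m (X *m Y) *m B.
  by rewrite !mulmxA -[E *m X *m B *m E]mulmxA BE mulmx1.
rewrite !mulE -mulmxBl -mulmxBr rep_bracket //.
by rewrite !(mulmxDr, mulmxDl, mulmxN, mulNmx) -!(scalemxAr, scalemxAl).
Qed.

Hypothesis k_gt1 : (1 < k)%N.

(** In the basis of [weight_basis] the Cartan elements are diagonal and the Casimir element is
    scalar, which is the setting of [weyl_character]. *)
Theorem irreducible_weights (la : 'rV[rat]_k) M : dominant la ->
  irreducible_of_highest_weight la M ->
  exists n (wt : 'I_n -> 'rV[rat]_k), [/\ has_weights M wt,
    forall j, pos_cone (la - wt j) &
    forall (Z : zmodType) (phi : 'rV[rat]_k -> Z),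
    \sum_(w : weyl k) (\sum_i phi (wact w (rho k) + wt i)) *~ (-1) ^+ wodd w =
    \sum_(w : weyl k) phi (wact w (la + rho k)) *~ (-1) ^+ wodd w].
Proof.
move=> la_dom [irr [v [v0 v_cartan v_pos]]].
pose P a b := mact M (so_elt C a b).
have repP : rep_axioms P := rep_axioms_mact M.
have v_wt : weight_vector P v la.
  have H i : P (lshift k i) (lshift k i) *m v = ratr (la 0 i) *: v.
    by rewrite /P -cartan_elt v_cartan.
  move=> c; rewrite -(splitK c); case: (split c) => i /=.
    by rewrite H vec_weight_lshift dot_epsr.
  rewrite -dual_lshift rep_dual // mulNmx H vec_weight_dual dotNr vec_weight_lshift.
  by rewrite dot_epsr rmorphN scaleNr.
have v_hw r : P (root_left r) (root_right r) *m v = 0.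
  apply: (v_pos r); split=> [|i]; first exact: so_so_elt.
  rewrite cartan_elt -[LHS]/(_ - _) (rep_bracket_cartan rep_axioms_so_elt).
  by rewrite -root_of_vec_weight vec_weight_lshift dot_epsr.
have [n [wt [B [E [BE EB HB HC [wt_cone wt_la]]]]]] :=
  weight_basis repP v0 v_wt v_hw (irr_module_stable irr).
exists n, wt; split=> //.
  exists B, E; split=> // i; rewrite cartan_elt HB; congr (_ *m diag_mx _).
  by apply/rowP => j; rewrite !mxE vec_weight_lshift dot_epsr.
have repP' := rep_axioms_conj BE repP.
apply: (weyl_character k_gt1 repP') => // [c|].
  by rewrite -mulmxA HB mulmxA EB mul1mx.
have -> : casimir (fun a b => E *m P a b *m B) = E *m casimir P *m B.
  rewrite /casimir mulmx_sumr mulmx_suml; apply: eq_bigr => a _.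
  rewrite mulmx_sumr mulmx_suml; apply: eq_bigr => b _.
  by rewrite !mulmxA -[E *m _ *m B *m E]mulmxA BE mulmx1.
rewrite -mulmxA HC -scalemxAr EB scalemx1; congr _%:M.
by rewrite rmorphM /= rmorph_nat mulr_natr.
Qed.

(** The base change intertwines two families of diagonal matrices, so a nonzero entry joins equal
    weights; its determinant is nonzero, so some permutation meets only nonzero entries and matches
    the two families. *)
Lemma has_weights_iso M N m n (wt : 'I_m -> 'rV[rat]_k) (wt' : 'I_n -> 'rV[rat]_k) :
  so_iso M N -> has_weights M wt -> has_weights N wt' ->
  perm_eq (codom wt) (codom wt').
Proof.
move=> [T [Tfree Tfull HT]] [B [E [BE EB HB]]] [B' [E' [BE' EB' HB']]].
have [Ti [TT' T'T]] : exists Ti, T *m Ti = 1%:M /\ Ti *m T = 1%:M.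
  by exists (pinvmx T); rewrite mulmxVp // mulVpmx.
pose S := E' *m T *m B; pose S' := E *m Ti *m B'.
have SS' : S *m S' = 1%:M.
  rewrite /S /S' !mulmxA -[_ *m B *m E]mulmxA BE mulmx1.
  by rewrite -[E' *m T *m _]mulmxA TT' mulmx1.
have S'S : S' *m S = 1%:M.
  rewrite /S /S' !mulmxA -[_ *m B' *m E']mulmxA BE' mulmx1.
  by rewrite -[E *m _ *m T]mulmxA T'T mulmx1.
have HE' i : E' *m mact N (cartan C i) = diag_mx (\row_j ratr (wt' j 0 i)) *m E'.
  rewrite -[LHS]mulmx1 -BE' mulmxA -[E' *m _ *m B']mulmxA HB' !mulmxA EB' mul1mx.
  by [].
have SD i : S *m diag_mx (\row_j ratr (wt j 0 i)) = diag_mx (\row_j ratr (wt' j 0 i)) *m S.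
  rewrite /S -mulmxA -HB mulmxA -[E' *m T *m _]mulmxA HT; last by rewrite cartan_elt so_so_elt.
  by rewrite !mulmxA HE'.
clearbody S S'.
have eq_wt i j : S i j != 0 -> wt' i = wt j.
  move=> Sij; apply/rowP => l.
  have := congr1 (fun A : 'M_(n, m) => A i j) (SD l).
  rewrite mul_diag_mx mul_mx_diag !mxE [_ * S i j]mulrC => /(mulfI Sij).
  by move/fmorph_inj.
have nm : n = m.
  have rank_id p : \rank (1%:M : 'M[C]_p) = p by rewrite mxrank1.
  apply/eqP; rewrite eqn_leq; apply/andP; split.
    by rewrite -{1}(rank_id n) -SS' (leq_trans (mxrankM_maxr _ _)) ?rank_leq_row.
  by rewrite -{1}(rank_id m) -S'S (leq_trans (mxrankM_maxr _ _)) ?rank_leq_row.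
subst n; have detS : \det S != 0.
  have := congr1 determinant SS'; rewrite det_mulmx det1 => /eqP; apply: contraTneq => ->.
  by rewrite mul0r eq_sym oner_eq0.
have /existsP[s] : [exists s : {perm 'I_m}, \prod_i S i (s i) != 0].
  apply: contraR detS => /existsPn H; rewrite /determinant big1 // => s _.
  by have := H s; rewrite negbK => /eqP ->; rewrite mulr0.
move=> /prodf_neq0 Hs; apply: perm_eq_codom => x.
rewrite -[RHS](card_imset _ (@perm_inj _ s)); apply: eq_card => i.
rewrite -(permKV s i) (mem_imset _ _ (@perm_inj _ s)) !inE.
by rewrite (eq_wt _ _ (Hs ((s^-1)%g i) isT)).
Qed.

End Modules.

Section Multiplicities.
Variables (C : numClosedFieldType) (k : nat).
Implicit Types (M N : so_module C k).

Lemma has_weights_zero (wt : 'I_0 -> 'rV[rat]_k) : has_weights (so_zero C k) wt.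
Proof.
by exists 0, 0; split=> [||i]; apply/matrixP => -[].
Qed.

Lemma has_weights_sum2 M N m n (wt : 'I_m -> 'rV[rat]_k) (wt' : 'I_n -> 'rV[rat]_k) :
  has_weights M wt -> has_weights N wt' ->
  has_weights (so_sum2 M N) (fun i => match split i with inl j => wt j | inr j => wt' j end).
Proof.
move=> [B [E [BE EB HB]]] [B' [E' [BE' EB' HB']]].
exists (block_mx B 0 0 B'), (block_mx E 0 0 E'); split=> [||i].
- by rewrite mulmx_block !(mulmx0, mul0mx, addr0, add0r) BE BE' -scalar_mx_block.
- by rewrite mulmx_block !(mulmx0, mul0mx, addr0, add0r) EB EB' -scalar_mx_block.
have -> : (\row_j ratr ((match split j with inl j => wt j | inr j => wt' j end) 0 i) : 'rV[C]_(m
  + n)) =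
    row_mx (\row_j ratr (wt j 0 i)) (\row_j ratr (wt' j 0 i)).
  by apply/rowP => j; rewrite !mxE; case: (split j) => l; rewrite mxE.
by rewrite diag_mx_row !mulmx_block !(mulmx0, mul0mx, addr0, add0r) HB HB'.
Qed.

Lemma tens11 m n : 1%:M *t 1%:M = 1%:M :> 'M[C]_(m * n)%N.
Proof.
apply/matrixP => i j; case: (mxtens_indexP i) => i0 i1; case: (mxtens_indexP j) => j0 j1.
rewrite tensmxE !mxE (inj_eq (can_inj (@mxtens_indexK m n))) xpair_eqE.
by case: (i0 == j0); case: (i1 == j1); rewrite ?(mulr0, mul0r, mulr1).
Qed.

Lemma has_weights_tensor M N m n (wt : 'I_m -> 'rV[rat]_k) (wt' : 'I_n -> 'rV[rat]_k) :
  has_weights M wt -> has_weights N wt' ->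
  has_weights (so_tensor M N)
    (fun i => wt (mxtens_unindex i).1 + wt' (mxtens_unindex i).2).
Proof.
move=> [B [E [BE EB HB]]] [B' [E' [BE' EB' HB']]].
exists (B *t B'), (E *t E'); split=> [||i].
- by rewrite tensmx_mul BE BE' tens11.
- by rewrite tensmx_mul EB EB' tens11.
rewrite /= mulmxDl !tensmx_mul HB HB' !mul1mx.
have -> : diag_mx (\row_j ratr ((wt (mxtens_unindex j).1 + wt' (mxtens_unindex j).2) 0 i)) =
   diag_mx (\row_j ratr (wt j 0 i)) *t 1%:M + 1%:M *t diag_mx (\row_j ratr (wt' j 0 i)) :>
     'M[C]_(m * n)%N.
  apply/matrixP => a b; case: (mxtens_indexP a) => a0 a1; case: (mxtens_indexP b) => b0 b1.
  rewrite [RHS]mxE !tensmxE !mxE !mxtens_indexK /=.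
  rewrite (inj_eq (can_inj (@mxtens_indexK m n))) xpair_eqE rmorphD.
  by case: (a0 == b0); case: (a1 == b1); rewrite ?(mulr0, mul0r, mulr1, mul1r, mulr0n, mulr1n,
    addr0).
by rewrite mulmxDr !tensmx_mul !mulmx1.
Qed.

Lemma sum_tensor_weights (R : nmodType) m n (wt : 'I_m -> 'rV[rat]_k)
    (wt' : 'I_n -> 'rV[rat]_k) (phi : 'rV[rat]_k -> R) :
  \sum_(i < m * n) phi (wt (mxtens_unindex i).1 + wt' (mxtens_unindex i).2) =
  \sum_i \sum_j phi (wt i + wt' j).
Proof.
rewrite [RHS]pair_bigA [LHS](reindex (@mxtens_index m n)).
  by apply: eq_bigr => -[i j] _; rewrite mxtens_indexK.
by exists (@mxtens_unindex m n) => x _; rewrite ?mxtens_indexK ?mxtens_unindexK.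
Qed.

Hypothesis k_gt1 : (1 < k)%N.
Variable V : 'rV[rat]_k -> so_module C k.
Hypothesis V_irr : forall la, dominant la -> irreducible_of_highest_weight la (V la).

Lemma so_sum_weights (s : seq 'rV[rat]_k) : all (@dominant k) s ->
  exists n (wt : 'I_n -> 'rV[rat]_k), has_weights (so_sum (map V s)) wt /\
    forall (Z : zmodType) (phi : 'rV[rat]_k -> Z),
    \sum_(w : weyl k) (\sum_i phi (wact w (rho k) + wt i)) *~ (-1) ^+ wodd w =
    \sum_(la <- s) \sum_(w : weyl k) phi (wact w (la + rho k)) *~ (-1) ^+ wodd w.
Proof.
elim: s => [_|la s IHs /= /andP[la_dom /IHs[n [wt [Hwt HS]]]]].
  exists 0%N, (fun _ => 0); split=> [|Z phi]; first exact: has_weights_zero.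
  by rewrite big_nil big1 // => w _; rewrite big_ord0 mul0rz.
have [m [wt1 [Hwt1 _ H1]]] := irreducible_weights k_gt1 la_dom (V_irr la_dom).
exists (m + n)%N, (fun i => match split i with inl j => wt1 j | inr j => wt j end).
split=> [|Z phi]; first exact: has_weights_sum2.
rewrite big_cons -H1 -HS -big_split; apply: eq_bigr => w _ /=.
rewrite -mulrzDl big_split_ord; congr ((_ + _) *~ _); apply: eq_bigr => i _.
  by rewrite (unsplitK (inl _ i)).
by rewrite (unsplitK (inr _ i)).
Qed.

(** Multiply the character of the tensor product by a_rho. The decomposition gives a sum of
    alternants, in which la + rho occurs once for each copy of V(la); the character formula for
    V(ga) gives the alternant of ga + rho shifted by the weights of V(nu). *)
Theorem brauer_multiplicity la ga nu n (wt : 'I_n -> 'rV[rat]_k) (d : nat) :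
  dominant la -> dominant ga -> has_weights (V nu) wt ->
  multiplicity V la (so_tensor (V ga) (V nu)) d ->
  d%:Z = \sum_(w : weyl k)
    (#|[pred j | wact w (ga + rho k) + wt j == la + rho k]|)%:Z * (-1) ^+ wodd w.
Proof.
move=> la_dom ga_dom Hwt [s [s_dom iso ->]].
have [m [wt1 [Hwt1 _ H1]]] := irreducible_weights k_gt1 ga_dom (V_irr ga_dom).
have [p [wts [Hwts Hs]]] := so_sum_weights s_dom.
have pe := has_weights_iso iso (has_weights_tensor Hwt1 Hwt) Hwts.
pose phi (be : 'rV[rat]_k) : int := (be == la + rho k)%:R.
have la_strict := strictly_dominant_rho la_dom.
(* At la + rho the alternant of mu + rho has coefficient 1 if mu = la and 0 otherwise. *)
transitivity (\sum_(mu <- s) \sum_(w : weyl k) phi (wact w (mu + rho k)) *~ (-1) ^+ wodd w).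
  rewrite -sum1_count big_mkcond /= -natz natr_sum; apply: eq_big_seq => mu mus.
  have mu_dom := allP s_dom _ mus; have mu_strict := strictly_dominant_rho mu_dom.
  case: eqP => [->|mula].
    rewrite (bigD1 (wone k)) //= wact_wone /phi eqxx /wodd /= odd_perm1 expr0.
    rewrite big1 // => w w1; case: eqP => [e|_]; last by rewrite mul0rz.
    case/eqP: w1; apply: (strictly_dominant_wact_eq k_gt1 la_strict).
    by rewrite e.
  rewrite big1 // => w _; rewrite /phi; case: eqP => [e|_]; last by rewrite mul0rz.
  case: mula; apply: (addIr (rho k)).
  have [] := wact_strictly_dominant_inj (w := w) (w' := wone k) k_gt1 mu_strict la_strict => //.
  by rewrite wact_wone.
rewrite -Hs; pose psi (be : 'rV[rat]_k) := \sum_(w : weyl k) phi (wact w (rho k) + be) *~ (-1)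
  ^+ wodd w.
transitivity (\sum_i psi (wts i)).
  rewrite /psi exchange_big; apply: eq_bigr => w _ /=; rewrite mulrz_suml.
  by apply: eq_bigr.
rewrite -(perm_eq_codom_sum psi pe) sum_tensor_weights exchange_big /=.
(* A fixed weight of V(nu) is absorbed into the test function, so that the formula for V(ga)
   applies. *)
under eq_bigr => j _.
  rewrite /psi exchange_big /=.
  rewrite (eq_bigr (fun w => (\sum_i phi ((wact w (rho k) + wt1 i) + wt j)) *~ (-1) ^+ wodd w));
    last first.
    by move=> w _; rewrite mulrz_suml; apply: eq_bigr => i _; rewrite addrA.
  rewrite (H1 _ (fun be => phi (be + wt j))).
  over.
rewrite exchange_big; apply: eq_bigr => w _ /=.
rewrite -mulrz_suml mulrzz; congr (_ * _).
by rewrite -sum1_card -natz natr_sum [RHS]big_mkcond; apply: eq_bigr => j _; rewrite /phi inE;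
  case: eqP.
Qed.

End Multiplicities.

(** * Sums over multisets of weights *)

Section MultisetSums.
Variable V : zmodType.
Implicit Types (s t : seq V) (v be : V).

(* The exponents, with multiplicity, of the complete homogeneous function of degree
   [N] evaluated at the exponentials of the items of [s]. *)
Fixpoint msums s (N : nat) : seq V :=
  if s is v :: s' then
    flatten [seq [seq be + v *+ j | be <- msums s' (N - j)] | j <- iota 0 N.+1]
  else nseq (N == 0%N) 0.

Lemma msums_cons (R : nmodType) v s N (phi : V -> R) :
  \sum_(be <- msums (v :: s) N) phi be =
  \sum_(j < N.+1) \sum_(be <- msums s (N - j)) phi (be + v *+ j).
Proof.
transitivity (\sum_(be <- flatten [seq [seq be + v *+ j | be <- msums s (N - j)] | j <- iota 0
  N.+1]) phi be).
  by [].
rewrite big_flatten big_map.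
rewrite -(big_mkord predT (fun j => \sum_(be <- msums s (N - j)) phi (be + v *+ j))).
by apply: eq_bigr => j _; rewrite big_map.
Qed.

Lemma msums_nil (R : nmodType) N (phi : V -> R) :
  \sum_(be <- msums [::] N) phi be = if N == 0%N then phi 0 else 0.
Proof. by rewrite /=; case: eqP => _; rewrite ?big_seq1 ?big_nil. Qed.

Lemma triangle_exchange (R : nmodType) N (F : nat -> nat -> R) :
  \sum_(i < N.+1) \sum_(j < (N - i).+1) F i j =
  \sum_(j < N.+1) \sum_(i < (N - j).+1) F i j.
Proof.
have E (G : nat -> nat -> R) : \sum_(i < N.+1) \sum_(j < (N - i).+1) G i j =
    \sum_(i < N.+1) \sum_(j < N.+1 | (i + j <= N)%N) G i j.
  apply: eq_bigr => i _; have le_i : ((N - i).+1 <= N.+1)%N by rewrite ltnS leq_subr.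
  rewrite (big_ord_widen N.+1 (fun j => G i j) le_i).
  by apply: eq_bigl => j; have := ltn_ord i; lia.
rewrite (E F) (E (fun j i => F i j)) (exchange_big_dep predT) //=; apply: eq_bigr => i _.
by apply: eq_bigl => j; rewrite addnC.
Qed.

Lemma msums_swap (R : nmodType) u v s N (phi : V -> R) :
  \sum_(be <- msums [:: u, v & s] N) phi be = \sum_(be <- msums [:: v, u & s] N) phi be.
Proof.
rewrite !msums_cons; under eq_bigr do rewrite msums_cons.
under [RHS]eq_bigr do rewrite msums_cons.
rewrite (triangle_exchange N (fun i j => \sum_(be <- msums s (N - i - j)) phi (be + v *+ j + u
  *+ i))).
apply: eq_bigr => i _; apply: eq_bigr => j _; rewrite -!subnDA addnC.
by apply: eq_bigr => be _; rewrite addrAC.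
Qed.

Lemma eq_msums_cons (R : nmodType) v s t :
  (forall N (phi : V -> R), \sum_(be <- msums s N) phi be = \sum_(be <- msums t N) phi be) ->
  forall N (phi : V -> R),
  \sum_(be <- msums (v :: s) N) phi be = \sum_(be <- msums (v :: t) N) phi be.
Proof. by move=> H N phi; rewrite !msums_cons; apply: eq_bigr => j _; apply: H. Qed.

Lemma msums_perm (R : nmodType) s t : perm_eq s t -> forall N (phi : V -> R),
  \sum_(be <- msums s N) phi be = \sum_(be <- msums t N) phi be.
Proof.
elim: s t => [|v s IHs] t st N phi.
  by move: st; rewrite perm_sym => /perm_nilP ->.
have vt : v \in t by rewrite -(perm_mem st) mem_head.
case/splitPr: vt st => t1 t2 st.
have st' : perm_eq s (t1 ++ t2).
  by rewrite -(perm_cons v) (perm_trans st) // -cat1s perm_catCA.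
have -> : \sum_(be <- msums (t1 ++ v :: t2) N) phi be =
          \sum_(be <- msums (v :: t1 ++ t2) N) phi be.
  elim: t1 {st st'} N phi => [//|u t1 IH] N phi.
  by rewrite (eq_msums_cons u IH) /= msums_swap.
by apply: eq_msums_cons => M psi; apply: IHs.
Qed.

Lemma msums_cat (R : nmodType) s t N (phi : V -> R) :
  \sum_(be <- msums (s ++ t) N) phi be =
  \sum_(j < N.+1) \sum_(be <- msums s (N - j)) \sum_(be' <- msums t j) phi (be + be').
Proof.
elim: s N phi => [|v s IHs] N phi.
  under [RHS]eq_bigr do rewrite msums_nil.
  rewrite [RHS](bigD1 ord_max) //= subnn eqxx [X in _ = _ + X]big1 ?addr0 => [|j jN].
    by apply: eq_bigr => be _; rewrite add0r.
  by rewrite subn_eq0 ifF //; apply: contraNF jN => Nj; rewrite -val_eqE eqn_leq Nj -ltnS ltn_ord.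
rewrite cat_cons msums_cons; under eq_bigr do rewrite IHs.
under [RHS]eq_bigr do rewrite msums_cons.
rewrite (triangle_exchange N (fun i j => \sum_(be <- msums s (N - i - j))
  \sum_(be' <- msums t j) phi (be + be' + v *+ i))).
apply: eq_bigr => i _; apply: eq_bigr => j _; rewrite -!subnDA addnC.
by do 2!(apply: eq_bigr => ? _); rewrite addrAC.
Qed.

Lemma msums_multiplicities (R : nmodType) (T : finType) (wt : T -> V) N (phi : V -> R) :
  \sum_(be <- msums [seq wt a | a <- enum T] N) phi be =
  \sum_(m : {ffun T -> 'I_N.+1} | (\sum_a m a == N)%N) phi (\sum_a wt a *+ m a).
Proof.
(* Removing an item lowers the degree but not the range of the functions, hence a bound [B] separate
   from the degree. *)
suff H B (s : seq T) M (psi : V -> R) : uniq s -> (M <= B)%N ->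
    \sum_(be <- msums (map wt s) M) psi be =
    \sum_(m : {ffun T -> 'I_B.+1} |
       (\sum_a m a == M)%N && [forall a, (a \notin s) ==> (m a == ord0)]) psi (\sum_a wt a *+ m
         a).
  rewrite (H N) ?enum_uniq //; apply: eq_bigl => m.
  rewrite (_ : [forall a, _]) ?andbT //; apply/forallP => a.
  by rewrite mem_enum.
elim: s M psi => [|a s IHs] M psi.
  move=> _ MB; rewrite msums_nil.
  have zero_sum (m : {ffun T -> 'I_B.+1}) : [forall a, (a \notin [::]) ==> (m a == ord0)] ->
      (forall a, m a = ord0).
    by move=> /forallP m0 a; apply/eqP; have := m0 a.
  case: eqP => [->|M0].
    rewrite (big_pred1 [ffun=> ord0]) => [|m].
      by rewrite big1 // => a _; rewrite ffunE.
    apply/andP/eqP => [[_ /zero_sum m0]|->]; first by apply/ffunP => a; rewrite ffunE.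
    split; last by apply/forallP => a; rewrite ffunE eqxx implybT.
    by rewrite big1 // => a _; rewrite ffunE.
  rewrite big_pred0 // => m; apply/negP => /andP[/eqP sM /zero_sum m0]; apply: M0.
  by rewrite -sM big1 // => a _; rewrite m0.
move=> /andP[a_s us] MB; rewrite [map _ _]/= msums_cons.
rewrite [RHS](partition_big (fun m : {ffun T -> 'I_B.+1} => m a) predT) //=.
rewrite (big_ord_widen B.+1 (fun j => \sum_(be <- msums (map wt s) (M - j)) psi (be + wt a *+
  j))) //.
rewrite big_mkcond; apply: eq_bigr => j _.
(* Changing the value at [a] between 0 and j matches the functions supported on [s] with those on
   [a :: s] that take the value j at [a]. *)
pose upd (x : 'I_B.+1) (m : {ffun T -> 'I_B.+1}) := [ffun b => if b == a then x else m b].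
case: ltnP => [jM|Mj]; last first.
  rewrite big_pred0 // => m; apply/negP => /andP[/andP[/eqP sM _] /eqP ma].
  by move: Mj; rewrite -sM (bigD1 a) //= ma; lia.
rewrite (IHs _ _ us) ?(leq_trans (leq_subr _ _)) //.
rewrite [RHS](reindex_onto (upd j) (upd ord0)) /=; last first.
  move=> m /andP[_ /eqP ma]; apply/ffunP => b; rewrite !ffunE.
  by case: eqVneq => [->|//]; rewrite ma.
apply: eq_big => [m|m /andP[_ /forallP m0]].
  rewrite [upd j m a]ffunE eqxx eqxx andbT.
  have -> : (upd ord0 (upd j m) == m) = (m a == ord0).
    apply/eqP/eqP => [<-|ma]; first by rewrite !ffunE eqxx.
    by apply/ffunP => b; rewrite !ffunE; case: eqVneq => [->|].
  case: (eqVneq (m a) ord0) => [ma|ma]; last first.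
    rewrite andbF; apply/negP => /andP[_ /forallP/(_ a)].
    by rewrite a_s (negPf ma).
  rewrite andbT; congr (_ && _).
    have -> : (\sum_b upd j m b = \sum_b m b + j)%N.
      rewrite (bigD1 a) //= [in RHS](bigD1 a) //= ma ffunE eqxx add0n addnC; congr (_ + _)%N.
      by apply: eq_bigr => b /negPf ba; rewrite ffunE ba.
    by rewrite ltnS in jM; lia.
  apply: eq_forallb => b; rewrite inE negb_or ffunE.
  by case: (eqVneq b a) => [->|_] /=; rewrite ?a_s ?ma ?eqxx ?implybT.
have ma : m a = ord0 by apply/eqP; have := m0 a; rewrite a_s.
congr psi; rewrite (bigD1 a) //= [in RHS](bigD1 a) //= ma ffunE eqxx add0r addrC; congr (_ + _).
by apply: eq_bigr => b /negPf ba; rewrite ffunE ba.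
Qed.

End MultisetSums.

Lemma msums_map (V W : zmodType) (g : {additive V -> W}) (s : seq V) N :
  msums (map g s) N = map g (msums s N).
Proof.
elim: s N => [|v s IHs] N; first by rewrite /= map_nseq raddf0.
have E (U : zmodType) (x : U) t : msums (x :: t) N =
  flatten [seq [seq be + x *+ j | be <- msums t (N - j)] | j <- iota 0 N.+1] by [].
rewrite [map g _]/= !E map_flatten -map_comp; congr flatten.
apply: eq_map => j; rewrite [RHS]/= IHs -!map_comp; apply: eq_map => be /=.
by rewrite raddfD raddfMn.
Qed.

Lemma perm_eq_sum (T : eqType) (s t : seq T) :
  (forall phi : T -> nat, \sum_(x <- s) phi x = \sum_(x <- t) phi x) -> perm_eq s t.
Proof.
move=> H; apply/allP => x _ /=.
have E (u : seq T) : count_mem x u = \sum_(y <- u) (y == x : nat).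
  by elim: u => [|y u IH]; rewrite ?big_nil ?big_cons //= IH.
by rewrite !E H.
Qed.

(** * Weights of the vector representation and of V(r) *)

Section VectorWeights.
Variable k : nat.
Implicit Types (w : weyl k) (be la nu : 'rV[rat]_k).

HB.instance Definition _ w :=
  GRing.isZmodMorphism.Build 'rV[rat]_k 'rV[rat]_k (wact w) (wactB w).

Definition vecs : seq 'rV[rat]_k := codom (@vec_weight k).

Lemma sum_vecs (R : nmodType) (phi : 'rV[rat]_k -> R) :
  \sum_(v <- vecs) phi v = \sum_(i < k) (phi (eps k i) + phi (- eps k i)).
Proof.
transitivity (\sum_a phi (@vec_weight k a)); first by rewrite /vecs big_image.
rewrite big_split_ord [RHS]big_split.
by congr (_ + _); apply: eq_bigr => i _; rewrite ?vec_weight_lshift ?vec_weight_rshift.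
Qed.

Lemma wact_eps w (i : 'I_k) : wact w (eps k ((val w).1 i)) = (-1) ^+ (i \in (val w).2) *: eps k i.
Proof.
apply/rowP => j; rewrite wactE !mxE !val_eqE (inj_eq perm_inj).
by case: eqVneq => [->|]; rewrite ?mulr0.
Qed.

Lemma wact_vecs w : perm_eq (map (wact w) vecs) vecs.
Proof.
apply: perm_eq_sum => phi; rewrite big_map !sum_vecs.
rewrite (reindex_inj (@perm_inj _ (val w).1)) /=; apply: eq_bigr => i _.
rewrite wactN wact_eps; case: (i \in _); rewrite ?expr0 ?expr1 ?scale1r ?scaleN1r //.
by rewrite opprK addrC.
Qed.

Lemma opp_vecs : perm_eq (map -%R vecs) vecs.
Proof.
apply: perm_eq_sum => phi; rewrite big_map !sum_vecs; apply: eq_bigr => i _.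
by rewrite opprK addrC.
Qed.

Lemma sum_msums_vecs_wact (R : nmodType) w N (phi : 'rV[rat]_k -> R) :
  \sum_(be <- msums vecs N) phi (wact w be) = \sum_(be <- msums vecs N) phi be.
Proof.
rewrite -(big_map (wact w) predT phi) -msums_map.
exact: msums_perm (wact_vecs w) _ _.
Qed.

Lemma sum_msums_vecs_opp (R : nmodType) N (phi : 'rV[rat]_k -> R) :
  \sum_(be <- msums vecs N) phi (- be) = \sum_(be <- msums vecs N) phi be.
Proof.
rewrite -(big_map -%R predT phi) -msums_map.
exact: msums_perm opp_vecs _ _.
Qed.

Lemma half_int_msums (s : seq 'rV[rat]_k) N :
  (forall v, v \in s -> half_int v) -> forall be, be \in msums s N -> half_int be.
Proof.
elim: s N => [|v s IHs] N Hs be.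
  by rewrite mem_nseq => /andP[_ /eqP ->]; apply: int_half_int => i; rewrite mxE rpred0.
move=> /flatten_mapP[j _ /mapP[be' be's ->]]; apply: half_intD.
  by apply: IHs be's => u us; apply: Hs; rewrite inE us orbT.
rewrite -[j]subn0 -sumr_const_nat; apply: half_int_sum => _ _.
by apply: Hs; rewrite mem_head.
Qed.

Lemma sum_msums_wexp (s : seq 'rV[rat]_k) N : (forall v, v \in s -> half_int v) ->
  \sum_(be <- msums s N) wexp be = csym (map (@wexp k) s) N.
Proof.
elim: s N => [|v s IHs] N Hs.
  by rewrite msums_nil wexp0 /=; case: eqP.
have Hs' u : u \in s -> half_int u by move=> us; apply: Hs; rewrite inE us orbT.
have Hv : half_int v by apply: Hs; rewrite mem_head.
rewrite msums_cons /=; apply: eq_bigr => j _; rewrite -IHs // mulr_sumr.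
apply: eq_big_seq => be /(half_int_msums Hs') Hbe.
rewrite wexpD ?wexp_Mn // 1?mulrC //.
by rewrite -[nat_of_ord j]subn0 -sumr_const_nat; apply: half_int_sum.
Qed.

Lemma half_int_vecs v : v \in vecs -> half_int v.
Proof.
move=> /codomP[a ->]; rewrite -(splitK a); case: (split a) => i /=.
  by rewrite vec_weight_lshift; apply: half_int_eps.
by rewrite vec_weight_rshift; apply/half_intN/half_int_eps.
Qed.

Lemma sum_msums_vecs_wexp N :
  \sum_(be <- msums vecs N) wexp be = csym (inv_pairs (codom (@weps k))) N.
Proof.
pose s := foldr (fun i (l : seq 'rV[rat]_k) => [:: eps k (i : 'I_k), - eps k i & l]) [::] (enum
  'I_k).
have s_vecs : perm_eq vecs s.
  apply: perm_eq_sum => phi; rewrite sum_vecs -big_enum /s /=.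
  elim: (enum _) => [|i l IH]; first by rewrite !big_nil.
  by rewrite /= !big_cons IH addrA.
rewrite (msums_perm s_vecs) sum_msums_wexp => [|v vs]; last first.
  by apply: half_int_vecs; rewrite (perm_mem s_vecs).
congr (csym _ N); rewrite /s /codom /image_mem /inv_pairs.
elim: (enum _) => //= i l ->; rewrite wexpN //; exact: half_int_eps.
Qed.

Lemma dominant_vector_weight r : (1 < k)%N -> dominant (vector_weight k r).
Proof.
move=> k1; apply: dominantP => // [|a].
  apply/orP; left; apply/forallP => i; rewrite !mxE.
  by rewrite rpredM ?rpred_nat.
rewrite dot_root !mxE; case: a => [[[i j] b] /= ji].
rewrite (_ : (j == k.-1 :> nat) = false) ?mulr0 ?addr0; last by have := ltn_ord i; lia.
by rewrite -natrM ler0n.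
Qed.

(* The weights of the traceless part of the symmetric power of the vector
   representation: Sym^r = V(r) + Sym^(r-2). *)
Theorem vector_weight_sum (C : numClosedFieldType) (M : so_module C k) r : (1 < k)%N ->
  irreducible_of_highest_weight (vector_weight k r) M ->
  exists n (wt : 'I_n -> 'rV[rat]_k), has_weights M wt /\
  forall (Z : zmodType) (psi : 'rV[rat]_k -> Z),
    \sum_j psi (wt j) = \sum_(be <- msums vecs r) psi be -
      (if (r < 2)%N then 0 else \sum_(be <- msums vecs (r - 2)) psi be).
Proof.
move=> k1 irr; have [n [wt [Hwt wt_cone H]]] :=
  irreducible_weights k1 (dominant_vector_weight r k1) irr.
exists n, wt; split=> // Z psi.
have half_wt j : half_int (wt j).
  have [s /eqP] := wt_cone j; rewrite subr_eq addrC -subr_eq => /eqP <-.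
  apply: half_intB.
    by apply: int_half_int => i; rewrite !mxE rpredM ?rpred_nat.
  by apply: half_int_sum => a _; apply: int_half_int; apply: root_int.
pose x := codom (@weps k).
(* The denominator has coefficient 1 at rho, so it is nonzero and can be cancelled. *)
have alt0 : \sum_(w : weyl k) (-1) ^+ wodd w * wexp (wact w (rho k)) != 0.
  apply/eqP => alt0; pose phi (be : 'rV[rat]_k) : int := (be == rho k)%:R.
  have := @wexp_transfer k int phi (weyl k) 'I_0 (fun w => (-1) ^+ wodd w)
    (fun w => wact w (rho k)) (fun _ => 0) (fun _ => 0).
  rewrite !big_ord0; have hr w : half_int (wact w (rho k)) by apply/half_int_wact/half_int_rho.
  have e0 : \sum_(w : weyl k) ((-1) ^+ wodd w)%:~R * wexp (wact w (rho k)) = 0 :> char_field k.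
    by rewrite -[RHS]alt0; apply: eq_bigr => w _; rewrite rmorphXn rmorphN1.
  move=> /(_ hr (fun x => match x with Ordinal _ p => False_rect _ (notF p) end) e0).
  rewrite (bigD1 (wone k)) //= /phi wact_wone eqxx /wodd /= odd_perm1 big1 => [//|w w1].
  case: eqP => [e|_]; last by rewrite mul0rz.
  case/eqP: w1; apply: (strictly_dominant_wact_eq k1 (@dot_rho k)).
  by rewrite e; apply: dot_rho.
(* The character formula, tested on [wexp], equates a_rho times the character with an alternant that
   is a_rho times [harm] in degree r. *)
have chE : \sum_j wexp (wt j) = harm x r.
  apply: (mulfI alt0).
  have E0 := wexp_alternating_sum k1 0; rewrite (harm0 _ : harm _ (Posz 0) = 1) mulr1 in E0.
  have vw0 : vector_weight k 0 = 0 by rewrite /vector_weight scale0r.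
  rewrite vw0 add0r in E0; rewrite [in RHS]E0 -wexp_alternating_sum //.
  have <- := eq_bigr _ (fun w _ => mulrz_sign (wexp (wact w (vector_weight k r + rho k))) (wodd
    w)).
  rewrite -H mulr_suml; apply: eq_bigr => w _; rewrite mulrz_sign -mulrA; congr (_ * _).
  rewrite mulr_sumr; apply: eq_bigr => j _; rewrite wexpD //.
  by apply: half_int_wact; apply: half_int_rho.
pose L r' := msums vecs r'.
pose S := [seq (1 : int, wt j) | j <- index_enum (ordinal n)] ++ [seq (- 1 : int, be) | be <- L
  r] ++
  (if (r < 2)%N then [::] else [seq (1 : int, be) | be <- L (r - 2)%N]).
have SE (U : zmodType) (f : int * 'rV[rat]_k -> U) : \sum_(y <- S) f y =
  \sum_j f (1, wt j) + (\sum_(be <- L r) f (- 1, be) +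
    (if (r < 2)%N then 0 else \sum_(be <- L (r - 2)%N) f (1, be))).
  rewrite /S !big_cat !big_map /=; congr (_ + (_ + _)).
  by case: ifP; rewrite ?big_nil ?big_map.
have T := @wexp_transfer_seq k Z psi S; rewrite !SE /= in T.
apply/eqP; rewrite -subr_eq0 opprB [X in _ + X]addrC; apply/eqP; apply: etrans (T _ _).
- congr (_ + (_ + _)); first by rewrite -sumrN; apply: eq_bigr => be _; rewrite mulrNz.
- move=> y; rewrite !mem_cat => /orP[/mapP[j _ ->]|/orP[/mapP[be bes ->]|]] //=.
    exact: half_int_msums half_int_vecs _ bes.
  by case: ifP => // _ /mapP[be bes ->]; apply: half_int_msums half_int_vecs _ bes.
under eq_bigr do rewrite mul1r; rewrite chE.
have -> : \sum_(be <- L r) (-1)%:~R * wexp be = - csym (inv_pairs x) r.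
  by rewrite -sum_msums_vecs_wexp -sumrN; apply: eq_bigr => be _; rewrite mulN1r.
have -> : (if (r < 2)%N then 0 else \sum_(be <- L (r - 2)%N) 1%:~R * wexp be) = csym2 x (r%:Z -
  2).
  case: ltnP => r2.
    rewrite (_ : r%:Z - 2 = Negz (1 - r)) //; last by lia.
  rewrite (_ : r%:Z - 2 = Posz (r - 2)); last by lia.
  by under eq_bigr do rewrite mul1r; rewrite sum_msums_vecs_wexp.
by rewrite /harm -[csym2 x r]/(csym (inv_pairs x) r) addrACA subrr addNr addr0.
Qed.

End VectorWeights.

(** * Straightening *)

Section Wcons.
Variable k : nat.
Implicit Types (be ga : 'rV[rat]_k) (a b : rat).

Lemma wcons_lift a ga (j : 'I_k) : wcons a ga 0 (lift ord_max j) = ga 0 j.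
Proof. by rewrite mxE liftK. Qed.

Lemma wcons_max a ga : wcons a ga 0 ord_max = a.
Proof. by rewrite mxE unlift_none. Qed.

Lemma eq_wcons (v : 'rV[rat]_k.+1) a ga : v 0 ord_max = a ->
  (forall j, v 0 (lift ord_max j) = ga 0 j) -> v = wcons a ga.
Proof.
move=> va vga; apply/rowP => i.
by case: (unliftP ord_max i) => [j ->|->]; rewrite ?wcons_lift ?wcons_max.
Qed.

Lemma wconsD a b be ga : wcons a be + wcons b ga = wcons (a + b) (be + ga).
Proof. by apply: eq_wcons => [|j]; rewrite !mxE ?unlift_none ?liftK // mxE. Qed.

Lemma wcons0B : zmod_morphism (@wcons k 0).
Proof.
move=> u v; apply/esym/eq_wcons => [|j]; rewrite !mxE ?unlift_none ?liftK ?subr0 //.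
Qed.

HB.instance Definition _ := GRing.isZmodMorphism.Build 'rV[rat]_k 'rV[rat]_k.+1 (@wcons k 0)
  wcons0B.

Lemma wcons_Mn a be n : wcons a be *+ n = wcons (a *+ n) (be *+ n).
Proof.
apply: eq_wcons => [|j]; first by rewrite mulmxnE wcons_max.
by rewrite !mulmxnE wcons_lift.
Qed.

Lemma wcons_rho a be : wcons a be + rho k.+1 = wcons (a + k%:R) (be + rho k).
Proof.
apply: eq_wcons => [|j]; first by rewrite !mxE unlift_none.
by rewrite !mxE liftK lift_max.
Qed.

Lemma wcons_wtail (mu : 'rV[rat]_k.+1) : mu = wcons (mu 0 ord_max) (wtail mu).
Proof. by apply: eq_wcons => // j; rewrite mxE. Qed.

Lemma wlift_even (w : weyl k) :
  ~~ odd #|(lift_perm ord_max ord_max (val w).1, lift ord_max @: (val w).2).2|.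
Proof. by rewrite card_imset; [exact: valP w | exact: lift_inj]. Qed.

Definition wlift (w : weyl k) : weyl k.+1 := exist _ (_, _) (wlift_even w).

Lemma wact_wlift w a be : wact (wlift w) (wcons a be) = wcons a (wact w be).
Proof.
apply: eq_wcons => [|j]; rewrite wactE /=.
  rewrite lift_perm_id wcons_max (_ : (ord_max \in _) = false) ?mul1r //.
  by apply/negP => /imsetP[j _ /eqP]; rewrite (negPf (neq_lift _ _)).
by rewrite lift_perm_lift wcons_lift (mem_imset _ _ (@lift_inj _ ord_max)) wactE.
Qed.

Lemma wodd_wlift w : wodd (wlift w) = wodd w.
Proof. by rewrite /wodd /= odd_lift_perm addbb. Qed.

(** The Weyl group of D_k sits in that of D_(k+1) as acting on all but the leading coordinate, and
    rho of D_(k+1) is k followed by rho of D_k, so the dot actions agree. *)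
Lemma schur_wcons_antisym (k_gt0 : (0 < k)%N) w a be :
  schur (wcons a (wact w (be + rho k) - rho k)) = (-1) ^+ wodd w * schur (wcons a be).
Proof.
rewrite /schur !wcons_rho subrK -wact_wlift alternant_wact ?ltnS // wodd_wlift.
by rewrite mulrA.
Qed.

Lemma sum_posroot_succ (R : nmodType) (phi : 'rV[rat]_k.+1 -> R) :
  \sum_(a : posroot k.+1) phi (root_of a) =
  \sum_(a : posroot k) phi (wcons 0 (root_of a)) + \sum_(v <- vecs k) phi (wcons 1 v).
Proof.
have epsE (j : nat) : (j < k)%N -> eps k.+1 j = wcons 0 (eps k j).
  by move=> jk; apply: eq_wcons => [|l]; rewrite !mxE ?lift_max // gtn_eqF.
have eps_max : eps k.+1 k = wcons 1 0.
  by apply: eq_wcons => [|l]; rewrite !mxE ?lift_max ?eqxx // ltn_eqF.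
pose f n (p : 'I_n * 'I_n * bool) := eps n p.1.1 + (-1) ^+ p.2 *: eps n p.1.2.
transitivity (\sum_(a : posroot k.+1) phi (f _ (val a))).
  by apply: eq_bigr => a _; rewrite /root_of /f; case: (val a) => [[i j] b].
have -> : \sum_(a : posroot k) phi (wcons 0 (root_of a)) =
          \sum_(a : posroot k) phi (wcons 0 (f _ (val a))).
  by apply: eq_bigr => a _; rewrite /root_of /f; case: (val a) => [[i j] b].
rewrite (posroot_sum (fun p => phi (f _ p))) (posroot_sum (fun p => phi (wcons 0 (f _ p)))).
have inner (i : nat) (g : nat -> R) : (i <= k)%N ->
    \sum_(j < k.+1 | (j < i)%N) g j = \sum_(j < k | (j < i)%N) g j.
  by move=> ik; rewrite big_mkcond big_ord_recr /= ltnNge ik addr0 -big_mkcond.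
pose g i j := phi (eps k.+1 i + (-1) ^+ true *: eps k.+1 j) +
              phi (eps k.+1 i + (-1) ^+ false *: eps k.+1 j).
transitivity (\sum_(i < k.+1) \sum_(j < k.+1 | (j < i)%N) g i j); first by [].
have scale_wcons (b : nat) (v : 'rV[rat]_k) : (-1) ^+ b *: wcons 0 v = wcons 0 ((-1) ^+ b *: v).
  by apply: eq_wcons => [|j]; rewrite !mxE ?unlift_none ?liftK ?mulr0 // mxE.
rewrite big_ord_recr /=; congr (_ + _).
  apply: eq_bigr => i _; rewrite (inner i (g i)) ?(ltnW (ltn_ord i)) //.
  apply: eq_bigr => j ji; rewrite /g /f /= !epsE //.
  by rewrite !scale_wcons !wconsD add0r.
rewrite (inner k (g k)) // sum_vecs big_mkcond; apply: eq_bigr => j _; rewrite ltn_ord.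
rewrite /g eps_max epsE // !scale_wcons !wconsD !add0r !addr0 expr1 expr0 scale1r scaleN1r.
exact: addrC.
Qed.

Lemma msums_wcons1 (R : nmodType) (s : seq 'rV[rat]_k) N (phi : 'rV[rat]_k.+1 -> R) :
  \sum_(be <- msums (map (wcons 1) s) N) phi be = \sum_(be <- msums s N) phi (wcons N%:R be).
Proof.
elim: s N phi => [|v s IHs] N phi.
  rewrite !msums_nil; case: eqP => // ->; congr phi.
  by apply: eq_wcons => [|j]; rewrite !mxE.
rewrite [map _ _]/= !msums_cons; apply: eq_bigr => j _; rewrite IHs.
apply: eq_bigr => be _; congr phi; rewrite wcons_Mn wconsD -natrD subnK //.
by rewrite -ltnS.
Qed.

Definition posroots : seq 'rV[rat]_k := [seq root_of r | r <- enum {: posroot k}].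

End Wcons.

Lemma hall_littlewood_msums k (mu : 'rV[rat]_k) N :
  hall_littlewood mu N = \sum_(be <- msums (posroots k) N) schur (mu + be).
Proof.
rewrite msums_multiplicities; apply: eq_bigl => m.
by rewrite inE.
Qed.

(** The partition function at w(la + rho) - (mu + rho) counts the sums of N positive roots that lead
    from mu to w(la + rho) - rho, which is the coefficient met in straightening. *)
Lemma kostka_msums k (k_gt1 : (1 < k)%N) (la mu : 'rV[rat]_k) N :
  kostka la mu N = \sum_(w : weyl k) (-1) ^+ wodd w *
    (count_mem (wact w (la + rho k) - rho k) [seq mu + be | be <- msums (posroots k) N])%:Z.
Proof.
apply: eq_bigr => w _; rewrite sign_wlength //; congr (_ * Posz _).
rewrite /qpartition count_map -sum1_count big_mkcond msums_multiplicities -sum1_card.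
rewrite [RHS]big_mkcond [LHS]big_mkcond; apply: eq_bigr => m _; rewrite !inE.
case: (_ == N) => //=.
congr (if _ then _ else _); rewrite /root_sum [mu + rho k]addrC opprD addrA eq_sym subr_eq.
by rewrite [_ + mu]addrC eq_sym.
Qed.

Lemma hall_littlewood_succ k (mu : 'rV[rat]_k.+1) N :
  hall_littlewood mu N = \sum_(R < N.+1) \sum_(be <- msums (posroots k) (N - R))
    \sum_(be' <- msums (vecs k) R)
      schur (wcons (mu 0 ord_max + R%:R) (wtail mu + be + be')).
Proof.
have pe : perm_eq (posroots k.+1) (map (wcons 0) (posroots k) ++ map (wcons 1) (vecs k)).
  apply: perm_eq_sum => phi; have E n (psi : 'rV[rat]_n -> nat) : \sum_(v <- posroots n) psi v =
    \sum_r psi (root_of r).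
    by rewrite /posroots big_map; apply: big_enum.
  rewrite E big_cat (big_map (wcons 0)) (big_map (wcons 1)) E.
  exact: sum_posroot_succ.
rewrite hall_littlewood_msums (msums_perm pe) msums_cat; apply: eq_bigr => R _.
rewrite msums_map big_map; apply: eq_bigr => be _; rewrite msums_wcons1.
apply: eq_bigr => be' _; rewrite {1}(wcons_wtail mu) !wconsD.
by rewrite add0r addrA.
Qed.

Section Straightening.
Variables (k : nat) (F : fieldType) (phi : 'rV[rat]_k -> F).
Hypothesis k_gt1 : (1 < k)%N.
Hypothesis two_neq0 : (2 : F) != 0.
Hypothesis phi_antisym : forall w be,
  phi (wact w (be + rho k) - rho k) = (-1) ^+ wodd w * phi be.
Implicit Types (w : weyl k) (be la : 'rV[rat]_k).

Lemma straighten_dominant w la be (D : seq 'rV[rat]_k) : uniq D -> all (@dominant k) D ->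
  la \in D -> wact w (la + rho k) = be + rho k ->
  phi be = \sum_(ga <- D) (\sum_(u : weyl k)
    (-1) ^+ wodd u * (wact u (ga + rho k) == be + rho k)%:R) * phi ga.
Proof.
move=> uD D_dom laD laE; have la_strict := strictly_dominant_rho (allP D_dom _ laD).
rewrite (bigD1_seq la) //= [X in _ + X]big_seq_cond [X in _ + X]big1 ?addr0 => [|ga /andP[gaD
  gala]].
  rewrite (bigD1 w) //= laE eqxx mulr1 [X in _ + X]big1 ?addr0 => [|u uw].
    by rewrite -[be](addrK (rho k)) -laE phi_antisym.
  case: eqP => [uE|_]; last by rewrite mulr0.
  case/eqP: uw; have [] := wact_strictly_dominant_inj (w := u) (w' := w) k_gt1 la_strict
    la_strict => //.
  by rewrite uE.
rewrite big1 ?mul0r // => u _; case: eqP => [uE|_]; last by rewrite mulr0.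
have ga_strict := strictly_dominant_rho (allP D_dom _ gaD).
case/eqP: gala; apply: (addIr (rho k)).
by have [] := wact_strictly_dominant_inj (w := u) (w' := w) k_gt1 ga_strict la_strict (etrans uE
  (esym laE)).
Qed.

(** A conjugate of the reflection in [a] fixes be + rho and is odd, so phi(be) = - phi(be). *)
Lemma straighten_singular w (a : posroot k) be : dot (wact w (be + rho k)) (root_of a) = 0 ->
  phi be = 0.
Proof.
move=> H; pose u := wmul (winv w) (wmul (wrefl a) w).
have uE : wact u (be + rho k) = be + rho k.
  by rewrite !wact_wmul wact_wrefl H scale0r subr0 wactK.
have := phi_antisym u be; rewrite uE addrK !wodd_mul wodd_wrefl wodd_inv.
have -> : wodd w (+) (true (+) wodd w) = true by case: (wodd w).
rewrite expr1 mulN1r.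
move/eqP; rewrite -addr_eq0 -mulr2n -mulr_natl mulf_eq0 (negPf two_neq0).
by move/eqP.
Qed.

End Straightening.

Lemma singular_not_dominant k (w : weyl k) (a : posroot k) be : (1 < k)%N ->
  dot (wact w (be + rho k)) (root_of a) = 0 ->
  forall la u, dominant la -> wact u (la + rho k) <> be + rho k.
Proof.
move=> k1 H la u la_dom uE; have la_strict := strictly_dominant_rho la_dom.
have e : wact (wmul (wrefl a) (wmul w u)) (la + rho k) = wact (wmul w u) (la + rho k).
  by rewrite !wact_wmul uE wact_wrefl H scale0r subr0.
have [/(congr1 (@wodd k))] := wact_strictly_dominant_inj k1 la_strict la_strict e.
by rewrite wodd_mul wodd_wrefl; case: (wodd _).
Qed.

(** Each be contributes its dominant dot-conjugate, or nothing if be + rho is singular. The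
    expansion is asserted for every larger list [D], so that the lists for several [L] can be
    merged. *)
Lemma straighten_seq k (k_gt1 : (1 < k)%N) (L : seq 'rV[rat]_k) :
  all (@weight_lattice k) L -> exists D0 : seq 'rV[rat]_k,
  [/\ all (@dominant k) D0,
      forall la w, dominant la -> la \notin D0 ->
        count_mem (wact w (la + rho k) - rho k) L = 0%N &
      forall (F : fieldType) (phi : 'rV[rat]_k -> F) D, (2 : F) != 0 ->
        (forall w be, phi (wact w (be + rho k) - rho k) = (-1) ^+ wodd w * phi be) ->
        uniq D -> all (@dominant k) D -> {subset D0 <= D} ->
        \sum_(be <- L) phi be = \sum_(la <- D) (\sum_(w : weyl k) (-1) ^+ wodd w *
          (count_mem (wact w (la + rho k) - rho k) L)%:R) * phi la].
Proof.
elim: L => [_|be L IHL /= /andP[be_lat /IHL[D0 [D0_dom D0_out D0_sum]]]].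
  exists [::]; split=> // F phi D _ _ _ _ _; rewrite big_nil big1 // => la _.
  by rewrite big1 ?mul0r // => w _; rewrite mulr0.
have eqE w la : (be == wact w (la + rho k) - rho k) = (wact w (la + rho k) == be + rho k).
  by rewrite eq_sym subr_eq.
have sumE (F : fieldType) (phi : 'rV[rat]_k -> F) D :
  \sum_(la <- D) (\sum_(w : weyl k) (-1) ^+ wodd w *
     ((be == wact w (la + rho k) - rho k) + count_mem (wact w (la + rho k) - rho k) L)%:R) * phi
       la =
  \sum_(la <- D) (\sum_(w : weyl k) (-1) ^+ wodd w * (wact w (la + rho k) == be + rho k)%:R) *
    phi la +
  \sum_(la <- D) (\sum_(w : weyl k) (-1) ^+ wodd w *
     (count_mem (wact w (la + rho k) - rho k) L)%:R) * phi la.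
  rewrite -big_split; apply: eq_bigr => la _; rewrite /= -mulrDl -big_split; congr (_ * _).
  by apply: eq_bigr => w _; rewrite natrD mulrDr eqE.
have [w w_dom] := exists_dominant (be + rho k).
case: (boolP [forall a : posroot k, dot (wact w (be + rho k)) (root_of a) != 0]) => [/forallP
  reg|].
  pose la := wact w (be + rho k) - rho k.
  have la_dom : dominant la.
    apply: strictly_dominant_sub_rho => //.
      by apply: weight_lattice_wact; rewrite weight_lattice_rho.
    by move=> a; rewrite lt_def reg w_dom.
  have laE : wact (winv w) (la + rho k) = be + rho k by rewrite subrK wactK.
  exists (la :: D0); split=> [|ga u ga_dom|F phi D two phi_anti uD D_dom DD].
  - by rewrite /= la_dom.
  - rewrite inE negb_or => /andP[gala /(D0_out _ u ga_dom) ->].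
    rewrite addn0 eqE; case: eqP => [uE|//]; case/eqP: gala; apply: (addIr (rho k)).
    by have [] := wact_strictly_dominant_inj k_gt1 (strictly_dominant_rho ga_dom)
      (strictly_dominant_rho la_dom) (etrans uE (esym laE)).
  rewrite big_cons sumE -(D0_sum F phi D) // => [|x xD0]; last by apply: DD; rewrite inE xD0 orbT.
  by congr (_ + _); apply: (straighten_dominant k_gt1 phi_anti uD D_dom _ laE); apply: DD;
    apply: mem_head.
rewrite negb_forall => /existsP[a]; rewrite negbK => /eqP sing.
exists D0; split=> // [ga u ga_dom gaD0|F phi D two phi_anti uD D_dom DD].
  rewrite (D0_out _ u ga_dom gaD0) addn0 eqE; case: eqP => // uE.
  by case: (singular_not_dominant k_gt1 sing ga_dom uE).
rewrite big_cons sumE -(D0_sum F phi D) // (straighten_singular two phi_anti sing).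
congr (_ + _); rewrite big_seq big1 // => ga gaD.
rewrite big1 ?mul0r // => u _; case: eqP => [uE|_]; last by rewrite mulr0.
by case: (singular_not_dominant k_gt1 sing (allP D_dom _ gaD) uE).
Qed.

(** m determines r = R - 2m, and the differences telescope to the term m = 0; the case r < 2
    expresses that negative degrees give 0. *)
Lemma sum_two_step (G : nat -> int) R :
  \sum_(r < R.+1) \sum_(m < R.+1 | (r + 2 * m == R)%N)
    (G r - (if (r < 2)%N then 0 else G (r - 2)%N)) = G R.
Proof.
pose a m := if (2 * m <= R)%N then G (R - 2 * m)%N else 0.
rewrite (exchange_big_dep predT) //=.
transitivity (\sum_(m < R.+1) (a m - a m.+1)).
  apply: eq_bigr => m _; case: (leqP (2 * m) R) => mR; last first.
    rewrite big_pred0 => [|r]; last by lia.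
    by rewrite /a !ifF ?subrr //; lia.
  have rR : (R - 2 * m < R.+1)%N by lia.
  rewrite (big_pred1 (Ordinal rR)) => [|r]; last first.
    by rewrite /= -[in RHS]val_eqE /=; lia.
  rewrite /a mR /=; congr (_ - _); case: ltnP => H.
    by rewrite ifF //; lia.
  by rewrite ifT; [congr G; lia | lia].
rewrite -(big_mkord predT (fun m => a m - a m.+1)).
under eq_bigr do rewrite -opprB; rewrite sumrN telescope_sumr // opprB.
by rewrite /a muln0 subn0 leq0n ifF ?subr0 //; lia.
Qed.

(** * Tensor multiplicities summed over r + 2m = R *)

Section TensorSum.
Variables (C : numClosedFieldType) (k : nat).
Hypothesis k_gt1 : (1 < k)%N.
Variable V : 'rV[rat]_k -> so_module C k.
Hypothesis V_irr : forall la, dominant la -> irreducible_of_highest_weight la (V la).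
Variable d : 'rV[rat]_k -> 'rV[rat]_k -> nat -> nat.
Hypothesis d_mult : forall la ga r, dominant la -> dominant ga ->
  multiplicity V la (so_tensor (V ga) (V (vector_weight k r))) (d la ga r).

(** Brauer's formula turns d into a signed count of weights of V(r), the count for degree r minus
    that for degree r - 2; over r + 2m = R these telescope to degree R. *)
Lemma sum_multiplicities la ga R : dominant la -> dominant ga ->
  \sum_(r < R.+1) \sum_(m < R.+1 | (r + 2 * m == R)%N) (d la ga r)%:Z =
  \sum_(w : weyl k) (-1) ^+ wodd w *
    (count_mem (wact w (ga + rho k) - rho k) [seq la + be | be <- msums (vecs k) R])%:Z.
Proof.
move=> la_dom ga_dom.
pose c w r : int := (count_mem (wact w (ga + rho k) - rho k) [seq la + be | be <- msums (vecs k)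
  r])%:Z.
pose G r := \sum_(w : weyl k) (-1) ^+ wodd w * c w r.
(* Brauer's formula asks for w(ga + rho) + be = la + rho, straightening for la + be = w(ga + rho) -
   rho; the exponents be of h_r are stable under negation. *)
have cE w r : \sum_(be <- msums (vecs k) r) (wact w (ga + rho k) + be == la + rho k)%:R = c w r.
  rewrite -(sum_msums_vecs_opp r (fun be => (wact w (ga + rho k) + be == la + rho k)%:R)).
  rewrite /c count_map -sum1_count -natz natr_sum [RHS]big_mkcond; apply: eq_bigr => be _ /=.
  have -> : (wact w (ga + rho k) - be == la + rho k) = (la + be == wact w (ga + rho k) - rho k).
    by rewrite subr_eq [RHS]eq_sym subr_eq addrAC.
  by case: eqP.
rewrite -[RHS]/(G R) -(sum_two_step G R); apply: eq_bigr => r _; apply: eq_bigr => m _.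
have [n [wt [Hwt wtE]]] := vector_weight_sum k_gt1 (V_irr (dominant_vector_weight r k_gt1)).
rewrite (brauer_multiplicity k_gt1 V_irr la_dom ga_dom Hwt (d_mult r la_dom ga_dom)).
have termE w : (#|[pred j | wact w (ga + rho k) + wt j == la + rho k]|)%:Z =
    c w r - (if (r < 2)%N then 0 else c w (r - 2)%N).
  rewrite -!cE -(wtE _ (fun be => (wact w (ga + rho k) + be == la + rho k)%:R : int)).
  rewrite -sum1_card -natz natr_sum big_mkcond; apply: eq_bigr => j _ /=.
  by rewrite inE; case: eqP.
under eq_bigr do rewrite termE mulrC mulrBr; rewrite sumrB; congr (_ - _).
by case: ifP => // _; rewrite big1 // => w _; rewrite mulr0.
Qed.

End TensorSum.

Lemma int_msums k (s : seq 'rV[rat]_k) N :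
  (forall v, v \in s -> forall i, v 0 i \is a Num.int) ->
  forall be, be \in msums s N -> forall i, be 0 i \is a Num.int.
Proof.
elim: s N => [|v s IHs] N Hs be.
  by rewrite mem_nseq => /andP[_ /eqP ->] i; rewrite mxE rpred0.
move=> /flatten_mapP[j _ /mapP[be' be's ->]] i; rewrite mxE mulmxnE rpredD //.
  by apply: IHs be's i => u us; apply: Hs; rewrite inE us orbT.
by rewrite rpredMn ?Hs ?mem_head.
Qed.

(** Merging the lists of [straighten_seq] gives one [D] for all [L]; all coefficients vanish outside
    it. *)
Lemma straighten_family k (k_gt1 : (1 < k)%N) (Ls : seq (seq 'rV[rat]_k)) :
  all (all (@weight_lattice k)) Ls -> exists D : seq 'rV[rat]_k,
  [/\ all (@dominant k) D, uniq D,
      forall L la w, L \in Ls -> dominant la -> la \notin D ->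
        count_mem (wact w (la + rho k) - rho k) L = 0%N &
      forall (F : fieldType) (phi : 'rV[rat]_k -> F) L, L \in Ls -> (2 : F) != 0 ->
        (forall w be, phi (wact w (be + rho k) - rho k) = (-1) ^+ wodd w * phi be) ->
        \sum_(be <- L) phi be = \sum_(la <- D) (\sum_(w : weyl k) (-1) ^+ wodd w *
          (count_mem (wact w (la + rho k) - rho k) L)%:R) * phi la].
Proof.
move=> Ls_lat; suff [D [D_dom D_out D_sum]] : exists D : seq 'rV[rat]_k,
  [/\ all (@dominant k) D,
      forall L la w, L \in Ls -> dominant la -> la \notin D ->
        count_mem (wact w (la + rho k) - rho k) L = 0%N &
      forall (F : fieldType) (phi : 'rV[rat]_k -> F) L D', L \in Ls -> (2 : F) != 0 ->
        (forall w be, phi (wact w (be + rho k) - rho k) = (-1) ^+ wodd w * phi be) ->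
        uniq D' -> all (@dominant k) D' -> {subset D <= D'} ->
        \sum_(be <- L) phi be = \sum_(la <- D') (\sum_(w : weyl k) (-1) ^+ wodd w *
          (count_mem (wact w (la + rho k) - rho k) L)%:R) * phi la].
  have uD_dom : all (@dominant k) (undup D).
    by apply/allP => la; rewrite mem_undup => /(allP D_dom).
  exists (undup D); split=> // [|L la w LLs la_dom|F phi L LLs two phi_anti].
  - exact: undup_uniq.
  - by rewrite mem_undup; apply: D_out.
  by apply: D_sum => //; [exact: undup_uniq | move=> la; rewrite mem_undup].
elim: Ls Ls_lat => [_|L Ls IH /= /andP[/(straighten_seq k_gt1)[D0 [D0_dom D0_out D0_sum]]]].
  by exists [::].
move=> /IH[D [D_dom D_out D_sum]]; exists (D0 ++ D); split.
- by rewrite all_cat D0_dom.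
- move=> L' la w; rewrite inE mem_cat negb_or => /orP[/eqP ->|L'Ls] la_dom /andP[la0 laD].
    exact: D0_out.
  exact: D_out.
move=> F phi L' D'; rewrite inE => /orP[/eqP ->|L'Ls] two phi_anti uD' D'_dom DD'.
  by apply: D0_sum => // la laD0; apply: DD'; rewrite mem_cat laD0.
by apply: D_sum => // la laD; apply: DD'; rewrite mem_cat laD orbT.
Qed.

From mathcomp Require Import boolp classical_sets cardinality fsbigop.
Local Open Scope classical_set_scope.

(** Replaces a sum over a possibly infinite set by one over a list outside which the terms
    vanish. *)
Lemma fsbig_seq_support (R : nmodType) (T : choiceType) (P : pred T) (Q : T -> Prop) (s : seq T)
    (f : T -> R) : uniq s -> (forall x, x \in s -> P x) ->
  (forall x, P x -> Q x -> x \notin s -> f x = 0) ->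
  (forall x, x \in s -> ~ Q x -> f x = 0) ->
  \sum_(x \in [set x | P x /\ Q x]) f x = \sum_(x <- s) f x.
Proof.
move=> us sP f0 f0'.
pose s' := [seq x <- s | `[< Q x >]].
rewrite (@fsbigE _ _ _ _ _ s') ?filter_uniq //; last 2 first.
- by move=> x /=; rewrite mem_filter => /andP[/asboolP Qx /sP].
- move=> x [Px Qx]; rewrite mem_filter negb_and => /orP[/asboolPn //|]; exact: f0.
rewrite big_filter_cond big_mkcond; apply: eq_big_seq => x xs.
case: (boolP `[< Q x >]) => [/asboolP Qx|/asboolPn nQ] /=; last by rewrite f0'.
by rewrite ifT //; apply/mem_set; split; [apply: sP | ].
Qed.

(* The ranks n and n - 1 are written k.+1 and k. *)
Theorem theorem3p2p2
  (C : numClosedFieldType) (k : nat) (k_ge2 : (2 <= k)%N)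
  (V : 'rV[rat]_k -> so_module C k)
  (V_irr : forall la, dominant la -> irreducible_of_highest_weight la (V la))
  (d : 'rV[rat]_k -> 'rV[rat]_k -> nat -> nat)
  (d_mult : forall la ga r, dominant la -> dominant ga ->
     multiplicity V la (so_tensor (V ga) (V (vector_weight k r))) (d la ga r))
  (mu : 'rV[rat]_k.+1) (mu_dom : dominant mu) :
  forall N : nat,
    let term (ga : 'rV[rat]_k) : char_field k.+1 :=
      \sum_(R < N.+1) \sum_(r < R.+1) \sum_(m < R.+1 | (r + 2 * m == R)%N)
        \sum_(la \in [set la | dominant la /\ d la ga r != 0%N])
          (d la ga r)%:R * (kostka la (wtail mu) (N - R))%:~R
            * schur (wcons (mu 0 ord_max + R%:R) ga) in
    finite_set [set ga | dominant ga /\ term ga != 0] /\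
    hall_littlewood mu N = \sum_(ga \in [set ga | dominant ga]) term ga.
Proof.
move=> N term; set mu' := wtail mu; set a := mu 0 ord_max.
have k_gt0 : (0 < k)%N := ltnW k_ge2.
have two_neq0 : (2 : char_field k.+1) != 0.
  by have := intr_char_field_eq0 k.+1 2; rewrite mulrz_nat => ->.
pose phi R (be : 'rV[rat]_k) : char_field k.+1 := schur (wcons (a + R%:R) be).
have phi_antisym R w be : phi R (wact w (be + rho k) - rho k) = (-1) ^+ wodd w * phi R be.
  exact: schur_wcons_antisym.
(* Multiplication by h_R; it preserves antisymmetry because W permutes the weights of the vector
   representation. *)
pose Phi R be := \sum_(be' <- msums (vecs k) R) phi R (be + be').
have Phi_antisym R w be : Phi R (wact w (be + rho k) - rho k) = (-1) ^+ wodd w * Phi R be.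
  rewrite /Phi -(sum_msums_vecs_wact w) mulr_sumr; apply: eq_bigr => be' _.
  by rewrite -phi_antisym; congr (phi R _); rewrite addrAC -wactD addrAC.
(* [L1] holds the exponents that are straightened into la, [L2] those that lead from la to ga. The
   coefficients [cnt] are Kostka-Foulkes coefficients for [L1] and sums of tensor multiplicities for
   [L2]. *)
pose L1 R := [seq mu' + be | be <- msums (posroots k) (N - R)].
pose L2 la R := [seq la + be | be <- msums (vecs k) R].
pose cnt la L := \sum_(w : weyl k) (-1) ^+ wodd w *
   (count_mem (wact w (la + rho k) - rho k) L)%:Z.
have mu'_lat : weight_lattice mu'.
  have /andP[/orP[/forallP H|/forallP H] _] := mu_dom; apply/orP; [left|right].
    by apply/forallP => j; rewrite mxE.
  by apply/forallP => j; rewrite mxE; apply: H.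
have posroots_int N' be : be \in msums (posroots k) N' -> forall i, be 0 i \is a Num.int.
  apply: int_msums => v /mapP[r _ ->] i; exact: root_int.
have vecs_int R be : be \in msums (vecs k) R -> forall i, be 0 i \is a Num.int.
  apply: int_msums => v /codomP[b ->] i; rewrite vec_weightE.
  by rewrite rpredB ?rpred_nat.
have L1_lat R : all (@weight_lattice k) (L1 R).
  by apply/allP => _ /mapP[be /posroots_int Hbe ->]; apply: weight_lattice_int.
have L2_lat la R : dominant la -> all (@weight_lattice k) (L2 la R).
  by move=> /andP[Hla _]; apply/allP => _ /mapP[be /vecs_int Hbe ->]; apply: weight_lattice_int.
have cntE (F : fieldType) la L : (cnt la L)%:~R = \sum_(w : weyl k) (-1) ^+ wodd w *
    (count_mem (wact w (la + rho k) - rho k) L)%:R :> F.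
  by rewrite rmorph_sum; apply: eq_bigr => w _; rewrite rmorphM rmorphXn rmorphN1.
(* One list of weights la for all R <= N. *)
have [D1 [D1_dom D1_uniq D1_out D1_sum]] : exists D1 : seq 'rV[rat]_k,
   [/\ all (@dominant k) D1, uniq D1,
      forall R la, (R < N.+1)%N -> dominant la -> la \notin D1 -> cnt la (L1 R) = 0 &
      forall R, (R < N.+1)%N ->
        \sum_(be <- L1 R) Phi R be = \sum_(la <- D1) (cnt la (L1 R))%:~R * Phi R la].
  have Ls_lat : all (all (@weight_lattice k)) [seq L1 R | R <- iota 0 N.+1].
    by apply/allP => _ /mapP[R _ ->].
  have [D1 [D1_dom D1_uniq D1_out D1_sum]] := straighten_family k_ge2 Ls_lat.
  have L1in R : (R < N.+1)%N -> L1 R \in [seq L1 R | R <- iota 0 N.+1].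
    by move=> RN; apply: map_f; rewrite mem_iota.
  exists D1; split=> // [R la RN la_dom laD1|R RN].
    by rewrite /cnt big1 // => w _; rewrite (D1_out _ _ w (L1in R RN)) // mulr0.
  rewrite (D1_sum _ _ _ (L1in R RN) two_neq0 (Phi_antisym R)).
  by apply: eq_bigr => la _; rewrite cntE.
(* One list of weights ga for all la in [D1] and all R <= N. *)
have [D2 [D2_dom D2_uniq D2_out D2_sum]] : exists D2 : seq 'rV[rat]_k,
   [/\ all (@dominant k) D2, uniq D2,
      forall R la ga, (R < N.+1)%N -> la \in D1 -> dominant ga -> ga \notin D2 -> cnt ga (L2 la
        R) = 0 &
      forall R la, (R < N.+1)%N -> la \in D1 ->
        Phi R la = \sum_(ga <- D2) (cnt ga (L2 la R))%:~R * phi R ga].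
  pose Ls := [seq L2 la R | la <- D1, R <- iota 0 N.+1].
  have Ls_lat : all (all (@weight_lattice k)) Ls.
    by apply/allP => _ /allpairsP[[la R] /= [laD1 _ ->]]; apply: L2_lat; apply: (allP D1_dom).
  have [D2 [D2_dom D2_uniq D2_out D2_sum]] := straighten_family k_ge2 Ls_lat.
  have L2in R la : (R < N.+1)%N -> la \in D1 -> L2 la R \in Ls.
    by move=> RN laD1; apply/allpairsP; exists (la, R); rewrite mem_iota.
  exists D2; split=> // [R la ga RN laD1 ga_dom gaD2|R la RN laD1].
    by rewrite /cnt big1 // => w _; rewrite (D2_out _ _ w (L2in R la RN laD1)) // mulr0.
  transitivity (\sum_(be <- L2 la R) phi R be); first by rewrite big_map.
  rewrite (D2_sum _ _ _ (L2in R la RN laD1) two_neq0 (phi_antisym R)).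
  by apply: eq_bigr => ga _; rewrite cntE.
have termE ga : dominant ga -> term ga =
    \sum_(R < N.+1) \sum_(la <- D1) (cnt la (L1 R))%:~R * (cnt ga (L2 la R))%:~R * phi R ga.
  move=> ga_dom; apply: eq_bigr => R _.
  have kostkaE la : kostka la mu' (N - R) = cnt la (L1 R) by exact: kostka_msums.
  transitivity (\sum_(r < R.+1) \sum_(m < R.+1 | (r + 2 * m == R)%N)
     \sum_(la <- D1) (cnt la (L1 R))%:~R * (d la ga r)%:R * phi R ga).
    apply: eq_bigr => r _; apply: eq_bigr => m _.
    (* On [D1] the terms with d = 0 vanish, and outside it the Kostka-Foulkes coefficients do. *)
    rewrite (fsbig_seq_support (P := @dominant k) (Q := fun la => d la ga r != 0%N) (s := D1)) //.
    - by apply: eq_bigr => la _; rewrite kostkaE [_ * (cnt _ _)%:~R]mulrC.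
    - exact: (allP D1_dom).
    - by move=> la la_dom _ laD1; rewrite kostkaE (D1_out R) // mulr0 mul0r.
    - by move=> la _ /negP; rewrite negbK => /eqP ->; rewrite !mul0r.
  under eq_bigr do rewrite exchange_big /=; rewrite exchange_big /=.
  apply: eq_big_seq => la laD1; have la_dom := allP D1_dom _ laD1.
  have := sum_multiplicities k_ge2 V_irr d_mult R la_dom ga_dom.
  rewrite -/(cnt ga (L2 la R)) => <-; set c := (cnt la (L1 R))%:~R.
  rewrite rmorph_sum mulr_sumr mulr_suml.
  apply: eq_bigr => r _; rewrite rmorph_sum mulr_sumr mulr_suml.
  by apply: eq_bigr => m _.
have term0 ga : dominant ga -> ga \notin D2 -> term ga = 0.
  move=> ga_dom gaD2; rewrite termE // big1 // => R _; rewrite big_seq big1 // => la laD1.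
  by rewrite (D2_out R) // mulr0 mul0r.
split.
  apply: sub_finite_set (finite_seq D2) => ga [ga_dom]; apply: contraNT => gaD2.
  by rewrite term0.
rewrite hall_littlewood_succ.
transitivity (\sum_(ga <- D2) term ga); last first.
  rewrite -(fsbig_seq_support (P := @dominant k) (Q := fun _ => True)) //; last 2 first.
  - exact: (allP D2_dom).
  - by move=> ga ga_dom _; apply: term0.
  by congr (\sum_(ga \in _) _); apply/seteqP; split=> ga // [].
rewrite (eq_big_seq _ (fun ga gaD2 => termE ga (allP D2_dom _ gaD2))) exchange_big /=.
(* In degree R the left side sums [Phi R] over [L1 R]; this is straightened into la, and then each
   [Phi R la] into ga. *)
apply: eq_bigr => R _; transitivity (\sum_(be <- L1 R) Phi R be); first by rewrite big_map.
rewrite (D1_sum R (ltn_ord R)) exchange_big /=; apply: eq_big_seq => la laD1.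
rewrite (D2_sum R la (ltn_ord R) laD1) mulr_sumr; apply: eq_bigr => ga _.
by rewrite mulrA.
Qed.
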